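(* Let $p,q\ge0$, and let $1\le k_1\le\ldots\le k_p$ and $1\le j_1\le\ldots\le j_q$ be integers. Consider the complex random variable $$\mathcal{I}_{p,q}(e_{k_1}\otimes\cdots\otimes e_{k_p}\otimes\overline{e_{j_1}}\otimes\cdots\otimes\overline{e_{j_q}}):=F_1+\mathrm{i}F_2,$$ with $F_1,F_2$ real-valued. Then the law of the two-dimensional random vector $(F_1,F_2)$ is absolutely continuous with respect to Lebesgue measure on $\mathbb{R}^2$ if and only if $p\ne q$, or $p=q$ and there exists $1\le l\le p$ such that $k_l\ne j_l$.
   Context: $\mathfrak{H}$ is a real separable Hilbert space, $\mathfrak{H}_{\mathbb{C}}$ its complexification (inner product linear in the first variable); $^{\odot n}$ is the $n$-th symmetric tensor power, $\mathrm{symm}$ the symmetrization. $X$, $Y$ are two independent isonormal Gaussian processes over $\mathfrak{H}$ (centered Gaussian families with $\mathbb{E}[X(h)X(g)]=\langle h,g\rangle_{\mathfrak{H}}$, likewise $Y$). For $\mathfrak{h}=f+\mathrm{i}g\in\mathfrak{H}_{\mathbb{C}}$ put $X_{\mathbb{C}}(\mathfrak{h})=X(f)+\mathrm{i}X(g)$, similarly $Y_{\mathbb{C}}$, and $Z(\mathfrak{h})=(X_{\mathbb{C}}(\mathfrak{h})+\mathrm{i}Y_{\mathbb{C}}(\mathfrak{h}))/\sqrt2$ (complex isonormal Gaussian process). Complex Hermite polynomials are defined by $\exp\{\lambda\bar z+\bar\lambda z-2|\lambda|^2\}=\sum_{p,q\ge0}\frac{\bar\lambda^p\lambda^q}{p!q!}J_{p,q}(z)$.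 For a complete orthonormal system $\{\xi_k\}$ of $\mathfrak{H}_{\mathbb{C}}$, $\mathcal{I}_{p,q}$ is the linear isometry from $\mathfrak{H}_{\mathbb{C}}^{\odot p}\otimes\mathfrak{H}_{\mathbb{C}}^{\odot q}$ with norm $\sqrt{p!q!}\|\cdot\|$ into $L^2_{\mathbb{C}}(\Omega)$ given by $\mathcal{I}_{p,q}(\mathrm{symm}(\otimes_k\xi_k^{\otimes p_k})\otimes\mathrm{symm}(\otimes_k\overline{\xi}_k^{\otimes q_k}))=\prod_k2^{-(p_k+q_k)/2}J_{p_k,q_k}(\sqrt2Z(\xi_k))$, for sequences $\{p_k\},\{q_k\}$ of non-negative integers with sums $p$ and $q$. By convention $\mathcal{I}_{p,q}(e_{k_1}\otimes\cdots\otimes e_{k_p}\otimes\overline{e_{j_1}}\otimes\cdots\otimes\overline{e_{j_q}})=\mathcal{I}_{p,q}(\mathrm{symm}(e_{k_1}\otimes\cdots\otimes e_{k_p})\otimes\mathrm{symm}(\overline{e_{j_1}}\otimes\cdots\otimes\overline{e_{j_q}}))$. $\{e_k\}_{k\ge1}$ is a complete orthogonal system in $\mathfrak{H}_{\mathbb{C}}$ with $\|e_k\|_{\mathfrak{H}_{\mathbb{C}}}=\sqrt2$. *)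

(* Defs.v *)
From HB Require Import structures.
From mathcomp Require Import all_boot all_order all_algebra all_fingroup.
From mathcomp Require Import all_classical all_reals all_analysis.
From mathcomp Require Import complex.

Set Implicit Arguments.
Unset Strict Implicit.
Unset Printing Implicit Defensive.

Import Order.TTheory GRing.Theory Num.Theory.
Import numFieldNormedType.Exports.

Local Open Scope classical_set_scope.
Local Open Scope ring_scope.
Local Open Scope complex_scope.

(* [R[i]] has no topology or Borel structure in the libraries: limits are stated on
   the real modulus [Normc.normc], measurability on real and imaginary parts. *)

(* A real Hilbert space is a [completeNormedModType R] with a positive definite
   symmetric form [dot : {dot H for idfun}] inducing its norm. *)

Definition separable (R : realType) (H : normedModType R) :=
  exists D : set H, countable D /\ dense D.

(* The pair [(f, g)] stands for [f + i g]. *)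
Definition complexification (R : realType) (H : lmodType R) : Type := (H * H)%type.

Section Complexification.
Context (R : realType) (H : lmodType R).
Local Notation HC := (complexification H).

HB.instance Definition _ := GRing.Zmodule.copy HC (H * H)%type.

Definition cscale (a : R[i]) (x : HC) : HC :=
  (complex.Re a *: x.1 - complex.Im a *: x.2,
   complex.Re a *: x.2 + complex.Im a *: x.1).

Lemma cscaleA a b x : cscale a (cscale b x) = cscale (a * b) x.
Proof.
case: a => a1 a2; case: b => b1 b2; case: x => f g.
apply: injective_projections; rewrite /cscale /=;
  rewrite !(scalerDr, scalerN, scalerDl, scaleNr, scalerA, opprD);
  by rewrite [X in _ + X = _]addrC addrACA.
Qed.

Lemma cscale1 : left_id 1 cscale.
Proof.
case=> f g; apply: injective_projections; rewrite /cscale /=.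
- by rewrite scale1r scale0r subr0.
- by rewrite scale1r scale0r addr0.
Qed.

Lemma cscaleDr : right_distributive cscale +%R.
Proof.
move=> [a1 a2] [f g] [f' g']; apply: injective_projections; rewrite /cscale /=.
- by rewrite !scalerDr opprD addrACA.
- by rewrite !scalerDr addrACA.
Qed.

Lemma cscaleDl x : {morph cscale^~ x : a b / a + b}.
Proof.
move=> [a1 a2] [b1 b2]; case: x => f g.
apply: injective_projections; rewrite /cscale /=.
- by rewrite !scalerDl opprD addrACA.
- by rewrite !scalerDl addrACA.
Qed.

HB.instance Definition _ := GRing.Zmodule_isLmodule.Build R[i] HC
  cscaleA cscale1 cscaleDr cscaleDl.

Definition vconj (x : HC) : HC := (x.1, - x.2).

Variable dot : {dot H for idfun}.

(* Linear in the first variable, antilinear in the second. *)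
Definition cdot (x y : HC) : R[i] :=
  (dot x.1 y.1 + dot x.2 y.2) +i* (dot x.2 y.1 - dot x.1 y.2).

Definition cnorm (x : HC) : R := Num.sqrt (complex.Re (cdot x x)).

Definition orthonormal_family (I : eqType) (u : I -> HC) :=
  forall i j, cdot (u i) (u j) = (i == j)%:R.

Definition complete_orthogonal_system (u : nat -> HC) :=
  (forall i j, i <> j -> cdot (u i) (u j) = 0) /\
  (forall x, (forall i, cdot x (u i) = 0) -> x = 0).

Definition complete_orthonormal_system (u : nat -> HC) :=
  complete_orthogonal_system u /\ (forall i, cnorm (u i) = 1).

(* The Hilbert tensor power of order [n] of [HC] is realized as the space of
   Hilbert-Schmidt conjugate-multilinear forms on [HC ^ n], the elementary tensor
   [x_1 (x) ... (x) x_n] being [y |-> \prod_i <x_i, y_i>]. *)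

Definition tensor (n : nat) : Type := ('I_n -> HC) -> R[i].

Definition elementary n (x : 'I_n -> HC) : tensor n :=
  fun y => \prod_(i < n) cdot (x i) (y i).

Definition symm n (T : tensor n) : tensor n :=
  fun y => (n`!%:R)^-1 * \sum_(s : {perm 'I_n}) T (y \o s).

(* Elements of [HC^{(x) p} (x) HC^{(x) q}]. *)
Definition tensor2 (p q : nat) : Type := ('I_p -> HC) -> ('I_q -> HC) -> R[i].

Definition tensor_mul p q (S : tensor p) (T : tensor q) : tensor2 p q :=
  fun x y => S x * T y.

Definition update n (y : 'I_n -> HC) (i : 'I_n) (v : HC) : 'I_n -> HC :=
  fun l => if l == i then v else y l.

Definition conj_multilinear n (T : tensor n) :=
  forall (y : 'I_n -> HC) (i : 'I_n) (a : R[i]) (u v : HC),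
    T (update y i (a *: u + v)) =
    conjc a * T (update y i u) + T (update y i v).

(* The squared Hilbert-Schmidt norm: the supremum over finite orthonormal families
   equals the sum over any complete orthonormal system. *)
Definition hs_sqnorm p q (T : tensor2 p q) : \bar R :=
  ereal_sup [set r | exists N (u : 'I_N -> HC), orthonormal_family u /\
    r = (\sum_(a : {ffun 'I_p -> 'I_N}) \sum_(b : {ffun 'I_q -> 'I_N})
           Normc.normc (T (u \o a) (u \o b)) ^+ 2)%:E].

(* [HC^{(.) p} (x) HC^{(.) q}], as a subspace of [HC^{(x) p} (x) HC^{(x) q}]. *)
Definition sym_tensor2 p q (T : tensor2 p q) : Prop :=
  [/\ forall y, conj_multilinear (T^~ y),
      forall x, conj_multilinear (T x),
      forall (s : {perm 'I_p}) (t : {perm 'I_q}) x y, T (x \o s) (y \o t) = T x y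
    & (hs_sqnorm T < +oo)%E].

End Complexification.

(* Absolutely convergent, with sum [s]. *)
Definition double_series (R : realType) (t : nat -> nat -> R[i]) (s : R[i]) :=
  summable [set: nat * nat] (fun m => (Normc.normc (t m.1 m.2))%:E) /\
  (fun N : nat => Normc.normc (\sum_(p < N) \sum_(q < N) t p q - s))
    @ \oo --> (0 : R).

(* The exponent [l z^* + l^* z - 2 |l|^2] is real, so the real exponential
   suffices. *)
Definition complex_hermite (R : realType) (J : nat -> nat -> R[i] -> R[i]) :=
  forall l z : R[i],
    double_series
      (fun p q => conjc l ^+ p * l ^+ q / (p`! * q`!)%N%:R * J p q z)
      (expR (complex.Re (l * conjc z + conjc l * z
                         - 2 * ((Normc.normc l) ^+ 2)%:C)))%:C.

(* [normal_prob m s] is a normal law only for [s != 0]; the degenerate Gaussian laws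
   are the Dirac masses. *)
Definition gaussian_law (R : realType) (mu : set R -> \bar R) :=
  exists m : R,
    (exists2 s : R, 0 < s &
       forall A : set R, measurable A -> mu A = normal_prob m s A) \/
    (forall A : set R, measurable A -> mu A = dirac m A).

Section Processes.
Context (R : realType) (d : measure_display) (Omega : measurableType d)
  (P : probability Omega R).

Definition gaussian_family (I : Type) (X : I -> {RV P >-> R}) :=
  forall (n : nat) (h : 'I_n -> I) (a : 'I_n -> R),
    gaussian_law (pushforward P (fun w => \sum_(l < n) a l * X (h l) w)).

Definition generated_sigma_algebra (I : Type) (X : I -> {RV P >-> R}) :
    set (set Omega) :=
  <<s [set A | exists i (B : set R), measurable B /\ A = X i @^-1` B] >>.

Definition independent_processes (I I' : Type) (X : I -> {RV P >-> R})
    (Y : I' -> {RV P >-> R}) :=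
  forall A B, generated_sigma_algebra X A -> generated_sigma_algebra Y B ->
    P (A `&` B) = (P A * P B)%E.

Context (H : completeNormedModType R) (dot : {dot H for idfun}).
Local Notation HC := (complexification H).

Definition isonormal (X : H -> {RV P >-> R}) :=
  [/\ gaussian_family X,
      forall h, ('E_P[X h] = 0)%E
    & forall h g, ('E_P[fun w => (X h w * X g w)%R] = (dot h g)%:E)%E].

Definition complexify (X : H -> {RV P >-> R}) (x : HC) (w : Omega) : R[i] :=
  (X x.1 w)%:C + 'i%C * (X x.2 w)%:C.

Definition complex_isonormal (X Y : H -> {RV P >-> R}) (x : HC) (w : Omega) : R[i] :=
  (complexify X x w + 'i%C * complexify Y x w) / (Num.sqrt 2)%:C.

Definition complex_rv (F : Omega -> R[i]) :=
  measurable_fun setT (fun w => complex.Re (F w)) /\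
  measurable_fun setT (fun w => complex.Im (F w)).

(* The factors, in order, of [(x)_k (xi_k)^{(x) m_k}] for a sequence [m] of
   exponents supported in [0, N) and of sum [n]. *)
Definition power_family n (xi : nat -> HC) (N : nat) (m : nat -> nat) : 'I_n -> HC :=
  fun i => xi (nth 0%N (flatten [seq nseq (m k) k | k <- iota 0 N]) i).

(* [Ipq] takes its values in functions on [Omega], representing classes in
   [L^2_C(Omega)]; its values outside [sym_tensor2] are irrelevant. *)
Definition multiple_integral (J : nat -> nat -> R[i] -> R[i])
    (Z : HC -> Omega -> R[i]) (p q : nat) (Ipq : tensor2 H p q -> Omega -> R[i]) :=
  [/\ forall T, sym_tensor2 dot T -> complex_rv (Ipq T),
      forall (a : R[i]) S T, sym_tensor2 dot S -> sym_tensor2 dot T ->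
        {ae P, forall w,
          Ipq (fun x y => a * S x y + T x y) w = a * Ipq S w + Ipq T w},
      forall T, sym_tensor2 dot T ->
        ('E_P[fun w => (Normc.normc (Ipq T w) ^+ 2)%R] =
         (p`! * q`!)%N%:R%:E * hs_sqnorm dot T)%E
    & forall (xi : nat -> HC) (N : nat) (m n : nat -> nat),
        complete_orthonormal_system dot xi ->
        (\sum_(k < N) m k)%N = p -> (\sum_(k < N) n k)%N = q ->
        {ae P, forall w,
          Ipq (tensor_mul
                 (symm (elementary dot (power_family xi N m)))
                 (symm (elementary dot (power_family (@vconj R H \o xi) N n)))) w =
          \prod_(k < N) ((Num.sqrt 2)%:C ^- (m k + n k) *
                         J (m k) (n k) ((Num.sqrt 2)%:C * Z (xi k) w))}].

(* [I_{p,q}] at [x_1 (x) ... (x) x_p (x) y_1 (x) ... (x) y_q], by convention its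
   value at [symm (x_1 (x) ... (x) x_p) (x) symm (y_1 (x) ... (x) y_q)]. *)
Definition integral_of_factors p q (Ipq : tensor2 H p q -> Omega -> R[i])
    (x : 'I_p -> HC) (y : 'I_q -> HC) : Omega -> R[i] :=
  Ipq (tensor_mul (symm (elementary dot x)) (symm (elementary dot y))).

End Processes.

(* Main.v *)
Require Import Defs.
From HB Require Import structures.
From mathcomp Require Import all_boot all_order all_algebra all_fingroup.
From mathcomp Require Import all_classical all_reals all_analysis.
From mathcomp Require Import measurable_realfun charge complex.
From mathcomp Require Import ring lra.

Set Implicit Arguments.
Unset Strict Implicit.
Unset Printing Implicit Defensive.

Import Order.TTheory GRing.Theory Num.Theory.
Import numFieldNormedType.Exports.

Local Open Scope classical_set_scope.
Local Open Scope ring_scope.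
Local Open Scope complex_scope.

(** Put [B h = X (Re h) - Y (Im h)]. Since [X] and [Y] are independent isonormal
    processes, [B] is a real Gaussian process of covariance [Re <h, g>], and
    [sqrt 2 * Z h = B h + i B (- i h)] almost surely. Let [xi_i = e_i / sqrt 2],
    an orthonormal system, and let [m_i], [n_i] be the multiplicities of [i] among
    the indices [k] and [j]. The tensor built from the [e_i] is that built from the
    [xi_i] times the power of [sqrt 2] that the value of the multiple integral
    divides by, so that [F = \prod_i J_{m_i, n_i} (V_i)] almost surely, with
    [V_i = B xi_i + i B (- i xi_i)] independent standard Gaussian vectors of the
    plane ([integral_of_factors_hermite], [planar_process_law]).

    The sequences [k] and [j] are sorted, hence equal if and only if [m_i = n_i]
    for all [i]. If they are equal, all the factors [J_{m, m}] are real
    ([hermite_diag_real]) and the law of [F] is carried by a line, which is null.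

    Otherwise [m_i <> n_i] for some [i]. The product of the other factors is
    independent of [V_i] and almost surely nonzero, so by Fubini it is enough that
    [c J_{m, n} (V_i)] avoids null sets almost surely for all constants [c <> 0]
    and [m <> n] ([hermite_null]). Symmetry replaces the change of variables in the
    plane: [J_{m, n} (e^{it} z) = e^{i (m - n) t} J_{m, n} (z)], and the modulus of
    [J_{m, n} (z)] is that of a real polynomial of degree [m + n] in [|z|]. The
    Gaussian law is invariant under rotations; hence a null set meets all the
    circles around the origin in null sets of angles, except for a null set of
    radii ([gauss2_null_circles]). A nonconstant polynomial pulls null sets back to
    null sets ([poly_null_preimage]), so that almost every [v] is sent to a circle
    that is not exceptional; along the circle of [v] its image turns at speed
    [m - n <> 0] and is in the null set for almost no angle. Averaging over the
    rotations gives the claim ([gauss2_equivariant_null]).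

    The properties of [J] come from its generating function. Along a real line it
    is [exp (a t - b t ^ 2)], whose Taylor coefficients satisfy a recurrence of
    order two; reading it coefficientwise gives a recurrence for
    [J_{p, q} / (p! q!)], and each property follows by induction on [p + q].

    Gaussian laws and independence are recognized from the integrals of
    [cos (L + c)], where [L] runs over a linear space of random variables; they
    play the part of characteristic functions. The class generated by these
    cosines under linear combinations and bounded limits contains the indicators
    of the events determined by the variables [L] ([trig_event_unique],
    [trig_event_independent]). *)

(** * Moments and cosine transform of the normal law *)

Section normal.
Context {R : realType}.
Local Notation mu := (@lebesgue_measure R).

(** Integration by parts without boundary terms: from [m - n] to [m + n] the
    integral of [f] is a difference of values of [F], which the decay of [F] sends
    to 0. *)
Lemma Rintegral_derive_eq0 (F f : R -> R) (m C : R) :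
  (forall x : R, is_derive x 1 F (f x)) -> continuous f ->
  mu.-integrable setT (EFin \o f) ->
  (forall x, `|F x| * `|x - m| <= C) -> \int[mu]_x f x = 0.
Proof.
move=> dF cf intf FC.
pose I n : set R := `[m - n.+1%:R, m + n.+1%:R]%classic.
have ltI n : m - n.+1%:R < m + n.+1%:R.
  by rewrite ltrD2l gtrN ?ltr0n.
have ftc n : (\int[mu]_x ((f \_ (I n)) x)%:E =
    (F (m + n.+1%:R) - F (m - n.+1%:R))%:E)%E.
  rewrite EFinB -(@continuous_FTC2 _ f F) //.
  - by rewrite [RHS]integral_mkcond; apply: eq_integral => x _; rewrite restrict_EFin.
  - exact: continuous_subspaceT.
  - have cF x : {for x, continuous F}.
      by apply: differentiable_continuous; apply/derivable1_diffP; case: (dF x).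
    split.
    + by move=> x _; case: (dF x).
    + exact/cvg_at_right_filter/cF.
    + exact/cvg_at_left_filter/cF.
  - by move=> x _; rewrite derive1E; case: (dF x).
have cvg1 : (\int[mu]_x ((f \_ (I n)) x)%:E)%E @[n --> \oo] --> (\int[mu]_x (f x)%:E)%E.
  have mf : measurable_fun setT f by exact: continuous_measurable_fun.
  apply: (@dominated_cvg _ _ _ mu setT _ (fun n x => ((f \_ (I n)) x)%:E) _ (fun x =>
      `|(f x)%:E|%E)) => //.
  - move=> n; apply/measurable_EFinP; apply/(measurable_restrictT f) => //.
      exact: measurable_itv.
    exact: measurable_funTS.
  - move=> x _; apply: cvg_EFin; first exact: nearW.
    apply: cvg_near_cst; near=> n; rewrite /= patchE mem_set //.
    rewrite /I /= in_itv /= -ler_distlC.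
    apply: le_trans (_ : n%:R <= _); last by rewrite ler_nat.
    by near: n; exact: nbhs_infty_ger.
  - exact: integrable_abse.
  - move=> n x _; rewrite /= lee_fin patchE; case: ifP => // _.
    by rewrite normr0.
have cvg0 : (F (m + n.+1%:R) - F (m - n.+1%:R))%:E @[n --> \oo] --> 0%:E.
  apply: cvg_EFin; first exact: nearW.
  apply: (@norm_cvg0 _ R^o); apply: (@squeeze_cvgr _ _ _ _ (cst 0) (fun n => (2 * C) * harmonic n)).
  - apply: nearW => n; rewrite normr_ge0 /=.
    apply: le_trans (ler_normB _ _) _.
    have h (x : R) : `|x - m| = n.+1%:R -> `|F x| <= C * harmonic n.
      by move=> xm; rewrite /harmonic /= ler_pdivlMr ?ltr0n// -xm FC.
    rewrite mulr2n mulrDl mul1r mulrDl lerD// h//.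
      by rewrite addrC addKr ger0_norm.
    by rewrite addrC addKr normrN ger0_norm.
  - exact: cvg_cst.
  - rewrite -[X in _ --> X](mulr0 (2 * C)); apply: cvgMr; exact: cvg_harmonic.
rewrite (funext ftc) in cvg1.
by rewrite /Rintegral (cvg_unique _ cvg1 cvg0).
Unshelve. all: end_near. Qed.

Lemma normal_Rintegral (m s : R) (g : R -> R) : s != 0 ->
  (normal_prob m s).-integrable setT (EFin \o g) ->
  \int[normal_prob m s]_x g x = \int[mu]_x (g x * normal_pdf m s x).
Proof.
move=> s0 ig; rewrite /Rintegral; congr fine.
have dom := @normal_prob_dominates R m s.
rewrite -(Radon_Nikodym_change_of_variables dom) //.
apply: ae_eq_integral => //.
- apply: emeasurable_funM => //; first exact: measurable_int ig.
- apply/measurable_EFinP/measurable_funM; last exact: measurable_normal_pdf.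
  by apply/measurable_EFinP; exact: measurable_int ig.
- under [X in ae_eq _ _ _ X]eq_fun do rewrite EFinM.
  apply: ae_eqe_mul2l.
  apply: integral_ae_eq => //.
  + exact: Radon_Nikodym_integrable.
  + by apply/measurable_EFinP; exact: measurable_normal_pdf.
  + move=> E _ mE; rewrite -Radon_Nikodym_integral //.
Qed.

Lemma ler_norm1D_sq (u : R) : `|u| <= 1 + u ^+ 2.
Proof. rewrite -(real_normK (num_real u)); have := normr_ge0 u; nra. Qed.

Section moments.
Variables (m s : R).
Hypothesis s0 : s != 0.
Local Notation w := (normal_pdf m s).

Lemma is_derive_normal_pdf (x : R) : is_derive x 1 w (- (x - m) / s ^+ 2 * w x).
Proof.
rewrite normal_pdfE //.
have h : is_derive x 1 (fun y => - (y - m) ^+ 2 / (s ^+ 2 *+ 2)) (- (x - m) / s ^+ 2).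
  apply: is_derive_eq; rewrite /GRing.scale /= -mulr_natr; field.
  by rewrite s0.
apply: is_derive_eq.
by rewrite /normal_fun /GRing.scale /=; ring.
Qed.

(** With [a = (x - m)^2 / (4 s^2)] the left side is a constant times [a e^{-a}
    e^{-a}]. Since [a e^{-a} <= 1], one factor [e^{-a}] remains, and it is the
    density of standard deviation [sqrt 2 s] up to a constant. *)
Lemma sq_normal_pdf_le (x : R) :
  (x - m) ^+ 2 * w x <= 4 * s ^+ 2 * normal_peak s / normal_peak (s * Num.sqrt 2) *
                        normal_pdf m (s * Num.sqrt 2) x.
Proof.
have s2 : 0 < s ^+ 2 by rewrite exprn_even_gt0.
have sq0 : s * Num.sqrt 2 != 0 by rewrite mulf_neq0 // gt_eqF // sqrtr_gt0.
rewrite !normal_pdfE // /normal_fun exprMn sqr_sqrtr //.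
set u := (x - m) ^+ 2; have u0 : 0 <= u by rewrite sqr_ge0.
have p0 := normal_peak_gt0 s0.
have -> : 4 * s ^+ 2 * normal_peak s / normal_peak (s * Num.sqrt 2) *
   (normal_peak (s * Num.sqrt 2) * expR (- u / (s ^+ 2 * 2 *+ 2))) =
   4 * s ^+ 2 * normal_peak s * expR (- u / (s ^+ 2 * 2 *+ 2)).
  by field; rewrite gt_eqF // normal_peak_gt0.
pose a := u / (s ^+ 2 * 4).
have -> : - u / (s ^+ 2 * 2 *+ 2) = - a by rewrite /a -mulr_natr; field.
have -> : - u / (s ^+ 2 *+ 2) = - a + - a by rewrite /a -mulr_natr; field.
have -> : u = a * (4 * s ^+ 2) by rewrite /a; field.
rewrite expRD.
have ea : a * expR (- a) <= 1.
  rewrite expRN ler_pdivrMr ?expR_gt0 // mul1r.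
  by apply: le_trans (expR_ge1Dx a); rewrite lerDr.
have -> : a * (4 * s ^+ 2) * (normal_peak s * (expR (- a) * expR (- a))) =
  (a * expR (- a)) * (4 * s ^+ 2 * normal_peak s * expR (- a)) by ring.
apply: ler_piMl ea; apply: mulr_ge0; last exact: expR_ge0.
by apply: mulr_ge0 (ltW p0); apply: mulr_ge0 (ltW s2).
Qed.

Lemma integrable_dominated_normal (f : R -> R) (C : R) : measurable_fun setT f ->
  (forall x, `|f x| <= C * ((1 + (x - m) ^+ 2) * w x)) ->
  mu.-integrable setT (EFin \o f).
Proof.
move=> mf fC.
have C0 : 0 <= C.
  have := le_trans (normr_ge0 _) (fC m); rewrite subrr expr0n /= addr0 mul1r.
  by rewrite pmulr_lge0 // normal_pdfE // mulr_gt0 ?expR_gt0 ?normal_peak_gt0.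
have sq0 : s * Num.sqrt 2 != 0 by rewrite mulf_neq0 // gt_eqF // sqrtr_gt0.
set K := 4 * s ^+ 2 * normal_peak s / normal_peak (s * Num.sqrt 2).
apply: (@le_integrable _ _ _ mu _ _ _ (fun x => (C * (w x +
    K * normal_pdf m (s * Num.sqrt 2) x))%:E)) => //.
- exact/measurable_EFinP.
- move=> x _; rewrite /= lee_fin; apply: le_trans (fC x) _.
  apply: le_trans (ler_norm _); apply: ler_wpM2l => //.
  by rewrite mulrDl mul1r lerD2l sq_normal_pdf_le.
- under eq_fun do rewrite EFinM EFinD EFinM.
  apply: integrableZl => //; apply: integrableD => //; first exact: integrable_normal_pdf.
  by apply: integrableZl => //; exact: integrable_normal_pdf.
Qed.

Lemma normal_pdf_decay (x : R) : (1 + (x - m) ^+ 2) * w x <= (1 + 2 * s ^+ 2) * normal_peak s.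
Proof.
have s2 : 0 < s ^+ 2 by rewrite exprn_even_gt0.
have p0 := normal_peak_gt0 s0.
rewrite mulrDl mul1r mulrDl mul1r lerD // ?normal_pdf_ub //.
rewrite normal_pdfE // /normal_fun; set u := (x - m) ^+ 2.
have u0 : 0 <= u by rewrite sqr_ge0.
pose a := u / (s ^+ 2 * 2).
have -> : - u / (s ^+ 2 *+ 2) = - a by rewrite /a -mulr_natr; field.
have -> : u * (normal_peak s * expR (- a)) = (a * expR (- a)) * (2 * s ^+ 2 * normal_peak s).
  by rewrite /a; field.
apply: ler_piMl; first by apply: mulr_ge0 (ltW p0); apply: mulr_ge0 (ltW s2).
rewrite expRN ler_pdivrMr ?expR_gt0 // mul1r.
by apply: le_trans (expR_ge1Dx a); rewrite lerDr.
Qed.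

Lemma normal_parts (F f : R -> R) (C D : R) :
  (forall x : R, is_derive x 1 F (f x)) -> continuous f ->
  (forall x, `|f x| <= C * ((1 + (x - m) ^+ 2) * w x)) ->
  (forall x, `|F x| * `|x - m| <= D * ((1 + (x - m) ^+ 2) * w x)) ->
  \int[mu]_x f x = 0.
Proof.
move=> dF cf fC FD.
apply: (@Rintegral_derive_eq0 F f m (D * ((1 + 2 * s ^+ 2) * normal_peak s))) => //.
  by apply: integrable_dominated_normal fC; exact: continuous_measurable_fun.
have D0 : 0 <= D.
  have := le_trans _ (FD m); rewrite subrr expr0n /= addr0 mul1r normr0 mulr0.
  move=> /(_ 0 (lexx _)); rewrite pmulr_lge0 //.
  by rewrite normal_pdfE // mulr_gt0 ?expR_gt0 ?normal_peak_gt0.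
by move=> x; apply: le_trans (FD x) _; rewrite ler_wpM2l // normal_pdf_decay.
Qed.

(** The integrand is the derivative of [- s^2 w]. *)
Lemma normal_mean : \int[mu]_x ((x - m) * w x) = 0.
Proof.
have s2 : 0 < s ^+ 2 by rewrite exprn_even_gt0.
apply: (@normal_parts (fun x => - s ^+ 2 * w x) _ 1 (s ^+ 2)).
- move=> x; have := is_derive_normal_pdf x => dw.
  by apply: is_derive_eq; rewrite /GRing.scale /=; field.
- move=> x; apply: cvgM; last exact: continuous_normal_pdf.
  by apply: cvgB => //; exact: cvg_cst.
- move=> x; rewrite mul1r normrM (ger0_norm (normal_pdf_ge0 _ _ _)) ler_wpM2r ?normal_pdf_ge0 //.
  exact: ler_norm1D_sq.
- move=> x; rewrite normrM (ger0_norm (normal_pdf_ge0 _ _ _)) normrN (ger0_norm (ltW s2)).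
  rewrite -mulrA ler_pM2l // mulrC ler_wpM2r ?normal_pdf_ge0 //.
  exact: ler_norm1D_sq.
Qed.

(** The derivative of [(x - m) w] is [w - (x - m)^2 w / s^2]. *)
Lemma normal_variance : \int[mu]_x ((x - m) ^+ 2 * w x) = s ^+ 2.
Proof.
have s2 : 0 < s ^+ 2 by rewrite exprn_even_gt0.
have E : \int[mu]_x (w x - (x - m) ^+ 2 / s ^+ 2 * w x) = 0.
  apply: (@normal_parts (fun x => (x - m) * w x) _ (1 + (s ^+ 2)^-1) 1).
  - move=> x; have := is_derive_normal_pdf x => dw.
    by apply: is_derive_eq; rewrite /GRing.scale /=; field.
  - move=> x; apply: cvgB; first exact: continuous_normal_pdf.
    apply: cvgM; last exact: continuous_normal_pdf.
    apply: cvgM; last exact: cvg_cst.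
    apply: (@continuous_comp _ _ _ (fun x => x - m) (fun x => x ^+ 2));
        last exact: exprn_continuous.
    by apply: cvgB => //; exact: cvg_cst.
  - move=> x; have w0 := normal_pdf_ge0 m s x.
    have -> : w x - (x - m) ^+ 2 / s ^+ 2 * w x = (1 - (x - m) ^+ 2 / s ^+ 2) * w x by ring.
    rewrite normrM (ger0_norm w0) mulrA ler_wpM2r //.
    apply: le_trans (ler_normB _ _) _; rewrite normr1 ger0_norm ?divr_ge0 ?sqr_ge0 //.
    rewrite mulrDl mul1r mulrDr mulr1; have : 0 <= (s ^+ 2)^-1 by rewrite invr_ge0 ltW.
    by have := sqr_ge0 (x - m); set u := (x - m) ^+ 2; set v := _^-1; nra.
  - move=> x; have w0 := normal_pdf_ge0 m s x.
    rewrite normrM (ger0_norm w0) mul1r mulrAC ler_wpM2r //.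
    by rewrite -normrM -expr2 ger0_norm ?sqr_ge0 // lerDr.
have int1 : mu.-integrable setT (EFin \o w) by exact: integrable_normal_pdf.
have int2 : mu.-integrable setT (EFin \o (fun x => (x - m) ^+ 2 * w x)).
  apply: (@integrable_dominated_normal _ 1).
    apply: measurable_funM; last exact: measurable_normal_pdf.
    by apply: measurable_funX; exact: measurable_funB.
  move=> x; have w0 := normal_pdf_ge0 m s x; have := sqr_ge0 (x - m) => h.
  by rewrite ger0_norm ?(mulr_ge0 h w0) // mul1r ler_wpM2r // lerDr.
have int3 : mu.-integrable setT (EFin \o (fun x => (x - m) ^+ 2 / s ^+ 2 * w x)).
  have -> : (fun x => (x - m) ^+ 2 / s ^+ 2 * w x) = (fun x => (s ^+ 2)^-1 * ((x - m) ^+ 2 * w x)).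
    by apply/funext => x; ring.
  by under [X in integrable _ _ X]eq_fun do rewrite EFinM; exact: integrableZl.
rewrite RintegralB // in E.
have : \int[mu]_x w x = 1 by rewrite /Rintegral integral_normal_pdf.
move: E => /[swap] -> /eqP; rewrite subr_eq0 => /eqP.
have -> : (fun x => (x - m) ^+ 2 / s ^+ 2 * w x) = (fun x => (s ^+ 2)^-1 * ((x - m) ^+ 2 * w x)).
  by apply/funext => x; ring.
rewrite RintegralZl // => /(congr1 (fun t => s ^+ 2 * t)).
by rewrite mulr1 mulVKf // gt_eqF.
Qed.

Variable c : R.
Let phi (t : R) := \int[mu]_x (cos (t * (x - m) + c) * w x).

Lemma integrable_quadratic_growth (g : R -> R) (C : R) : measurable_fun setT g -> (forall x, `|g
    x| <= C * (1 + (x - m) ^+ 2)) ->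
  mu.-integrable setT (EFin \o (fun x => g x * w x)).
Proof.
move=> mg gC; apply: (@integrable_dominated_normal _ C).
  by apply: measurable_funM => //; exact: measurable_normal_pdf.
move=> x; rewrite normrM (ger0_norm (normal_pdf_ge0 _ _ _)) mulrA.
by rewrite ler_wpM2r // normal_pdf_ge0.
Qed.

Lemma measurable_cosM (t : R) : measurable_fun setT (fun x : R => cos (t * (x - m) + c)).
Proof.
apply: (measurableT_comp (f := cos)); first exact: continuous_measurable_fun (@continuous_cos R).
by apply: measurable_funD => //; apply: measurable_funM => //; exact: measurable_funB.
Qed.

Lemma measurable_sinM (t : R) : measurable_fun setT (fun x : R => sin (t * (x - m) + c)).
Proof.
apply: (measurableT_comp (f := sin)); first exact: continuous_measurable_fun (@continuous_sin R).
by apply: measurable_funD => //; apply: measurable_funM => //; exact: measurable_funB.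
Qed.

(** The derivative of [sin (t (x - m) + c) w] is the difference of the two
    integrands, up to the factors. *)
Lemma normal_sin_parts (t : R) :
  \int[mu]_x ((x - m) * sin (t * (x - m) + c) * w x) = s ^+ 2 * (t * phi t).
Proof.
have s2 : 0 < s ^+ 2 by rewrite exprn_even_gt0.
have E : \int[mu]_x (t * (cos (t * (x - m) + c) * w x) - (s ^+ 2)^-1 * ((x - m) * sin (t * (x -
    m) + c) * w x)) = 0.
  apply: (@normal_parts (fun x => sin (t * (x - m) + c) * w x) _ (`|t| + (s ^+ 2)^-1) 1).
  - move=> x; have := is_derive_normal_pdf x => dw.
    by apply: is_derive_eq; rewrite /GRing.scale /=; field.
  - have cw := @continuous_normal_pdf R m s s0.
    have c1 : continuous (fun x : R => x - m).
      by move=> x; apply: cvgB => //; exact: cvg_cst.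
    have c2 : continuous (fun x : R => t * (x - m) + c).
      by move=> x; apply: cvgD; [apply: cvgM; [exact: cvg_cst|exact: c1]|exact: cvg_cst].
    move=> x; apply: cvgB; (apply: cvgM; first exact: cvg_cst); (apply: cvgM; last exact: cw).
      exact: (continuous_comp (c2 x) (@continuous_cos R _)).
    apply: cvgM; first exact: c1.
    exact: (continuous_comp (c2 x) (@continuous_sin R _)).
  - move=> x; have w0 := normal_pdf_ge0 m s x.
    apply: le_trans (ler_normB _ _) _; rewrite [leRHS]mulrDl lerD //.
      rewrite !normrM ler_wpM2l // (ger0_norm w0) ler_wpM2r //.
      apply: (@le_trans _ _ 1); first by rewrite ler_norml cos_geN1 cos_le1.
      by rewrite lerDl sqr_ge0.
    have si : 0 <= (s ^+ 2)^-1 by rewrite invr_ge0 ltW.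
    rewrite !normrM (ger0_norm w0) (ger0_norm si).
    apply: (ler_wpM2l si); apply: (ler_wpM2r w0).
    apply: (@le_trans _ _ (`|x - m|)).
      by rewrite ler_piMr // ler_norml sin_geN1 sin_le1.
    exact: ler_norm1D_sq.
  - move=> x; have w0 := normal_pdf_ge0 m s x.
    rewrite normrM (ger0_norm w0) mul1r mulrAC ler_wpM2r //.
    apply: (@le_trans _ _ (1 * `|x - m|)).
      by rewrite ler_wpM2r // ler_norml sin_geN1 sin_le1.
    rewrite mul1r; exact: ler_norm1D_sq.
have i1 : mu.-integrable setT (EFin \o (fun x => cos (t * (x - m) + c) * w x)).
  apply: (@integrable_quadratic_growth _ 1); first exact: measurable_cosM.
  move=> x; rewrite mul1r; apply: (@le_trans _ _ 1); first by rewrite ler_norml cos_geN1 cos_le1.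
  by rewrite lerDl sqr_ge0.
have i2 : mu.-integrable setT (EFin \o (fun x => (x - m) * sin (t * (x - m) + c) * w x)).
  apply: (@integrable_quadratic_growth _ 1).
    by apply: measurable_funM; [exact: measurable_funB|exact: measurable_sinM].
  move=> x; rewrite mul1r normrM; apply: (@le_trans _ _ (`|x - m|)).
    by rewrite ler_piMr // ler_norml sin_geN1 sin_le1.
  exact: ler_norm1D_sq.
rewrite RintegralB // in E; first last.
- by under [X in integrable _ _ X]eq_fun do rewrite EFinM; exact: integrableZl.
- by under [X in integrable _ _ X]eq_fun do rewrite EFinM; exact: integrableZl.
rewrite !RintegralZl // in E.
move/eqP : E; rewrite subr_eq0 => /eqP E.
by rewrite -/(phi t) in E; rewrite E mulVKf // gt_eqF.
Qed.

(** Differentiation under the integral sign turns the cosine into the integrand of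
    [normal_sin_parts]. *)
Lemma is_derive_phi (t : R) : is_derive t 1 phi (- s ^+ 2 * t * phi t).
Proof.
have wE x y : (partial1of2 (fun t x => cos (t * (x - m) + c) * w x)) x y =
    - ((y - m) * sin (x * (y - m) + c) * w y).
  rewrite /partial1of2 derive1E.
  have h : is_derive x 1 (fun t => cos (t * (y - m) + c) * w y) (- ((y - m) * sin (x * (y -
      m) + c) * w y)).
    by apply: is_derive_eq; rewrite /GRing.scale /=; ring.
  by case: h.
pose G x := (1 + (x - m) ^+ 2) * w x.
have G0 y : 0 <= G y by rewrite mulr_ge0 ?normal_pdf_ge0 // addr_ge0 // sqr_ge0.
have tI : `]t - 1, t + 1[%classic t by rewrite /= in_itv /= ltrDl ltr01 gtrDl oppr_lt0 ltr01.
have intf x : mu.-integrable setT (EFin \o (fun y => cos (x * (y - m) + c) * w y)).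
  apply: (@integrable_quadratic_growth _ 1); first exact: measurable_cosM.
  move=> y; rewrite mul1r; apply: (@le_trans _ _ 1); first by rewrite ler_norml cos_geN1 cos_le1.
  by rewrite lerDl sqr_ge0.
have intG : mu.-integrable setT (EFin \o G).
  apply: (@integrable_quadratic_growth (fun x => 1 + (x - m) ^+ 2) 1).
    by apply: measurable_funD => //; apply: measurable_funX; exact: measurable_funB.
  by move=> x; rewrite mul1r ger0_norm // addr_ge0 // sqr_ge0.
have der x y : derivable (fun t : R => cos (t * (y - m) + c) * w y) x 1.
  by apply: ex_derive.
have bnd x y : `|partial1of2 (fun t x => cos (t * (x - m) + c) * w x) x y| <= G y.
  have w0 := normal_pdf_ge0 m s y.
  rewrite wE normrN normrM (ger0_norm w0) ler_wpM2r //.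
  rewrite normrM; apply: (@le_trans _ _ (`|y - m|)).
    by rewrite ler_piMr // ler_norml sin_geN1 sin_le1.
  exact: ler_norm1D_sq.
have D := @differentiation_under_integral _ _ _ mu _ setT measurableT t (t - 1) (t + 1) tI
   (fun x _ => intf x) (fun x y _ _ => der x y) G G0 intG (fun x y _ _ => bnd x y).
have D' := @derivable_under_integral _ _ _ mu _ setT measurableT t (t - 1) (t + 1) tI
   (fun x _ => intf x) (fun x y _ _ => der x y) G G0 intG (fun x y _ _ => bnd x y).
apply: DeriveDef; first exact: D'.
rewrite -derive1E D; under eq_Rintegral do rewrite wE -mulN1r.
rewrite RintegralZl // ?normal_sin_parts; first by ring.
apply: (@integrable_quadratic_growth _ 1).
  by apply: measurable_funM; [exact: measurable_funB|exact: measurable_sinM].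
move=> x; rewrite mul1r normrM; apply: (@le_trans _ _ (`|x - m|)).
  by rewrite ler_piMr // ler_norml sin_geN1 sin_le1.
exact: ler_norm1D_sq.
Qed.

(** By [is_derive_phi] the product of [phi t] and [exp (s^2 t^2 / 2)] is constant.
    *)
Lemma normal_cos_centered (t : R) :
  \int[mu]_x (cos (t * (x - m) + c) * w x) = expR (- (s ^+ 2 * t ^+ 2 / 2)) * cos c.
Proof.
rewrite -/(phi t).
pose h t := phi t * expR (s ^+ 2 * t ^+ 2 / 2).
have dh (x : R) : is_derive x 1 h 0.
  have dp := is_derive_phi x.
  have de : is_derive x 1 (fun t => s ^+ 2 * t ^+ 2 / 2) (s ^+ 2 * x).
    by apply: is_derive_eq; rewrite /GRing.scale /=; field.
  by apply: is_derive_eq; rewrite /GRing.scale /=; ring.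
have : h t = h 0 by apply: is_derive_0_is_cst.
rewrite /h expr0n /= mulr0 mul0r expR0 mulr1.
have -> : phi 0 = cos c.
  rewrite /phi; under eq_Rintegral do rewrite mul0r add0r.
  rewrite RintegralZl //; last exact: integrable_normal_pdf.
  by rewrite /Rintegral integral_normal_pdf mulr1.
move=> H; rewrite expRN -[LHS](mulfK (lt0r_neq0 (expR_gt0 (s ^+ 2 * t ^+ 2 / 2)))).
by rewrite H mulrC.
Qed.

End moments.

Lemma normal_prob_mean (m s : R) : s != 0 ->
  (normal_prob m s).-integrable setT (EFin \o id) ->
  \int[normal_prob m s]_x x = m.
Proof.
move=> s0 ix; rewrite (@normal_Rintegral m s id) //.
have -> : (fun x : R => id x * normal_pdf m s x) =
   (fun x => (x - m) * normal_pdf m s x + m * normal_pdf m s x).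
  by apply/funext => x /=; ring.
rewrite RintegralD //.
- rewrite normal_mean // add0r RintegralZl //; last exact: integrable_normal_pdf.
  by rewrite /Rintegral integral_normal_pdf mulr1.
- apply: (@integrable_quadratic_growth m s s0 (fun x => x - m) 1); first exact: measurable_funB.
  by move=> x; rewrite mul1r; exact: ler_norm1D_sq.
- under [X in integrable _ _ X]eq_fun do rewrite EFinM.
  by apply: integrableZl => //; exact: integrable_normal_pdf.
Qed.

Lemma normal_prob_sqr (s : R) : s != 0 ->
  (normal_prob 0 s).-integrable setT (EFin \o (fun x => x ^+ 2)) ->
  \int[normal_prob 0 s]_x x ^+ 2 = s ^+ 2.
Proof.
move=> s0 ix; rewrite normal_Rintegral // -[RHS](normal_variance 0 s0).
by apply: eq_Rintegral => x _; rewrite subr0.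
Qed.

Lemma normal_prob_cos (s t c : R) : s != 0 ->
  \int[normal_prob 0 s]_x cos (t * x + c) = expR (- (s ^+ 2 * t ^+ 2 / 2)) * cos c.
Proof.
move=> s0; rewrite normal_Rintegral //; last first.
  apply: (@le_integrable _ _ _ _ _ _ _ (cst 1%E)) => //.
  - apply/measurable_EFinP.
    by have := measurable_cosM 0 c t; under eq_fun do rewrite subr0.
  - by move=> x _; rewrite /= lee_fin normr1 ler_norml cos_geN1 cos_le1.
  - exact: finite_measure_integrable_cst.
rewrite -(normal_cos_centered 0 s0).
by apply: eq_Rintegral => x _; rewrite subr0.
Qed.

End normal.

(** * Null sets of the line under inverse images *)

Section null_preimages.
Context {R : realType}.
Local Notation mu := (@lebesgue_measure R).

Lemma lebesgue_null_cover (A : set R) (F : nat -> set R) :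
  measurable A -> (forall n, measurable (F n)) ->
  (forall n, mu (F n) = 0%E) -> A `<=` \bigcup_n F n -> mu A = 0%E.
Proof.
move=> mA mF F0 AF; apply/eqP; rewrite eq_le measure_ge0 andbT.
apply: le_trans (measure_sigma_subadditive mu mF mA AF) _.
by rewrite eseries0 // => n _ _; exact: F0.
Qed.

Lemma lebesgue_measure_diam (E : set R) (r : R) : measurable E -> 0 <= r ->
  (forall x y, E x -> E y -> `|x - y| <= r) -> (mu E <= (2 * r)%:E)%E.
Proof.
move=> mE r0 Er; have [->|/set0P[x Ex]] := eqVneq E set0.
  by rewrite measure0 lee_fin mulr_ge0.
apply: (@le_trans _ _ (mu `[x - r, x + r]%classic)).
  apply: le_measure; rewrite ?inE //.
  by move=> y Ey /=; rewrite in_itv /= -ler_distlC Er.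
rewrite lebesgue_measure_itv /=; case: ifPn => _; last by rewrite lee_fin mulr_ge0.
by rewrite -EFinD lee_fin; lra.
Qed.

(** The preimage of an interval has diameter at most its length divided by [c]. A
    cover of [N] by intervals of small total length is thus pulled back to a cover
    by sets of comparable total measure. *)
Lemma null_preimage_expanding (f : R -> R) (D N : set R) (c : R) : 0 < c ->
  measurable D -> measurable_fun setT f ->
  (forall x y, D x -> D y -> c * `|x - y| <= `|f x - f y|) ->
  measurable N -> mu N = 0%E -> mu (D `&` f @^-1` N) = 0%E.
Proof.
move=> c0 mD mf cf mN N0.
have mfN A : measurable A -> measurable (D `&` f @^-1` A).
  by move=> mA; apply: measurableI => //; rewrite -[_ @^-1` _]setTI; exact: mf.
apply/eqP; rewrite eq_le measure_ge0 andbT; apply/lee_addgt0Pr => e e0.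
rewrite add0e.
(* [lebesgue_measure_diam] bounds the measure by twice the diameter: the preimages
   cost at most [2 / c] times the lengths. *)
have ce0 : (0 < c / 2 * e)%R by rewrite mulr_gt0 // divr_gt0.
have /ereal_inf_lt[_ [/= M covNM <-] sMe] : (mu N < (c / 2 * e)%:E)%E by rewrite N0 lte_fin.
have Mi n : ocitv (M n) by case: covNM => /(_ n).
have mM n : measurable (M n : set R) by apply: sub_sigma_algebra; exact: Mi.
have step n : (mu (D `&` f @^-1` (M n)) <= (2 / c)%:E * wlength idfun (M n))%E.
  have /ocitvP[->|[[a b] /= ab ->]] := Mi n.
    by rewrite preimage_set0 setI0 measure0 wlength0 mule0.
  rewrite wlength_itv /= lte_fin ab -EFinB -EFinM.
  have -> : (2 / c * (b - a) = 2 * ((b - a) / c))%R by ring.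
  apply: lebesgue_measure_diam.
  - exact: mfN.
  - by rewrite divr_ge0 ?subr_ge0 ?(ltW ab) ?(ltW c0).
  - move=> x y [Dx /=]; rewrite in_itv /= => /andP[ax xb] [Dy /=];
        rewrite in_itv /= => /andP[ay yb].
    rewrite ler_pdivlMr // mulrC; apply: le_trans (cf _ _ Dx Dy) _.
    by rewrite ler_norml; lra.
apply: (@le_trans _ _ (\sum_(n <oo) mu (D `&` f @^-1` (M n)))%E).
  apply: measure_sigma_subadditive.
  - by move=> n; exact: mfN.
  - exact: mfN.
  - by case: covNM => _ NM x [Dx /NM[n _ Mn]]; exists n.
apply: (@le_trans _ _ (\sum_(n <oo) (2 / c)%:E * wlength idfun (M n))%E).
  by apply: lee_nneseries => // n _; exact: step.
rewrite nneseriesZl; last by move=> n _; exact: wlength_ge0.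
apply: (@le_trans _ _ ((2 / c)%:E * (c / 2 * e)%:E)%E).
  by rewrite lee_wpmul2l ?lee_fin ?divr_ge0 // ltW.
by rewrite -EFinM lee_fin; have -> : (2 / c * (c / 2 * e) = e)%R; [field; rewrite gt_eqF|].
Qed.

Lemma measurable_horner (p : {poly R}) : measurable_fun setT (horner p).
Proof. by apply: continuous_measurable_fun => x; exact: continuous_horner. Qed.

(** The derivative keeps at least half of its absolute value around [x0], and the
    mean value theorem applies there. *)
Lemma poly_expanding_near (p : {poly R}) (x0 : R) : p^`().[x0] != 0 ->
  exists a b : R, exists2 c, 0 < c & [/\ a < x0, x0 < b &
    forall x y, a < x < b -> a < y < b -> c * `|x - y| <= `|p.[x] - p.[y]|].
Proof.
move=> px0; pose c := `|p^`().[x0]| / 2.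
have c0 : 0 < c by rewrite divr_gt0 // normr_gt0.
have : \forall x \near x0, c < `|p^`().[x]|.
  have h : (fun x => `|p^`().[x]|) @ x0 --> `|p^`().[x0]|.
    by apply: cvg_norm; exact: continuous_horner.
  move/cvgrPdist_lt : h => /(_ c c0); apply: filterS => x /=.
  rewrite /c; have := normr_ge0 p^`().[x0]; move: (`|p^`().[x0]|) (`|p^`().[x]|) => u v u0.
  by rewrite ltr_norml => /andP[_]; lra.
move=> /nbhs_ballP[e /= e0 ec].
exists (x0 - e), (x0 + e), c => //; split; [lra|lra|].
have ic x : x0 - e < x < x0 + e -> c < `|p^`().[x]|.
  by move=> xe; apply: ec; rewrite /ball /= ltr_distlC.
have main x y : x < y -> x0 - e < x < x0 + e -> x0 - e < y < x0 + e ->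
    c * `|x - y| <= `|p.[x] - p.[y]|.
  move=> xy xi yi.
  have hd z : z \in `]x, y[ -> is_derive z 1 (horner p) p^`().[z].
    by move=> _; exact: is_derive_poly.
  have hc : {within `[x, y], continuous (horner p)}.
    by apply: continuous_subspaceT => z; exact: continuous_horner.
  have [z zxy E] := MVT xy hd hc.
  rewrite distrC [in leRHS]distrC E normrM ler_wpM2r //.
  by apply/ltW/ic; move: zxy; rewrite in_itv /=; lra.
move=> x y xi yi; have [xy|yx|->] := ltgtP x y; first exact: main.
  by rewrite distrC [in leRHS]distrC; exact: main.
by rewrite !subrr normr0 mulr0.
Qed.

Lemma finite_roots (p : {poly R}) : p != 0 -> finite_set [set x | root p x].
Proof.
have [n] := ubnP (size p); elim: n p => // n IH p sn p0.
have [[x rx]|nr] := pselect (exists x, root p x); last first.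
  by rewrite (_ : mkset _ = set0) // -subset0 => x rx; apply: nr; exists x.
have /factor_theorem[q pq] := rx.
have q0 : q != 0 by apply: contraNneq p0 => q0; rewrite pq q0 mul0r.
apply: (@sub_finite_set _ _ ([set y | root q y] `|` [set x])).
  by move=> y /=; rewrite pq rootM root_XsubC => /orP[|/eqP]; [left|right].
rewrite finite_setU; split => //; apply: IH => //.
by move: sn; rewrite pq size_Mmonic ?monicXsubC // size_XsubC addn2 /=; exact.
Qed.

(** Outside of the finitely many roots of [p^`()], every point has a neighborhood
    with rational endpoints on which [p] expands distances by some [1 / (n + 1)],
    and there are countably many such intervals. *)
Lemma poly_null_preimage (p : {poly R}) (N : set R) : (1 < size p)%N ->
  measurable N -> mu N = 0%E -> mu (horner p @^-1` N) = 0%E.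
Proof.
move=> sp mN N0.
have mpN : measurable (horner p @^-1` N).
  by rewrite -[_ @^-1` _]setTI; exact: measurable_horner.
(* The intervals that do not qualify are replaced by the empty set; index 0 of [F]
   is kept for the critical points. *)
pose D (t : rat * rat * nat) : set R :=
  if `[< forall x y : R, ratr t.1.1 < x < ratr t.1.2 -> ratr t.1.1 < y < ratr t.1.2 ->
     t.2.+1%:R^-1 * `|x - y| <= `|p.[x] - p.[y]| >] then `]ratr t.1.1, ratr t.1.2[%classic else
         set0.
pose D' k := if unpickle k is Some t then D t else set0.
pose F k := if k is k'.+1 then D' k' `&` horner p @^-1` N else [set x | root p^`() x].
have mD' k : measurable (D' k).
  by rewrite /D'; case: unpickle => [t|//]; rewrite /D; case: asboolP.
have dp : p^`() != 0.
  apply/negP => /eqP /polyP /(_ (size p).-2); rewrite coef_deriv coef0.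
  case E : (size p) sp => [|[|k]] //= _ /eqP; rewrite mulrn_eq0 /= => /eqP pk.
  have : lead_coef p != 0 by rewrite lead_coef_eq0 -size_poly_gt0 E.
  by rewrite lead_coefE E /= pk eqxx.
have fr := finite_set_countable (finite_roots dp).
apply: (@lebesgue_null_cover _ F mpN).
- by case=> [|k]; [exact: countable_measurable|exact: measurableI].
- case=> [|k]; first exact: countable_lebesgue_measure0.
  rewrite /F /D'; case: unpickle => [t|]; last by rewrite set0I measure0.
  rewrite /D; case: asboolP => [h|_]; last by rewrite set0I measure0.
  apply: (null_preimage_expanding (c := t.2.+1%:R^-1) _ _ (measurable_horner p) _ mN N0) => //.
  move=> x pNx; have [rx|rx] := boolP (root p^`() x); [by exists 0%N|].
  have [a [b [c c0 [ax xb abc]]]] := poly_expanding_near rx.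
  have [q1 q1i] := rat_in_itvoo ax.
  have [q2 q2i] := rat_in_itvoo xb.
  have [n cn] : exists n : nat, n.+1%:R^-1 <= c.
    exists (Num.truncn c^-1); rewrite invf_ple ?posrE // ?ltr0n //.
    exact/ltW/truncnS_gt.
  exists (pickle (q1, q2, n)).+1; first exact: I.
  rewrite /F /D' pickleK; split => //.
  move: q1i q2i; rewrite !in_itv /= => /andP[q1a q1x] /andP[q2x q2b].
  rewrite /D /= asboolT; first by rewrite /= in_itv /= q1x.
  move=> u v /andP[u1 u2] /andP[v1 v2].
  apply: le_trans (abc u v _ _); first by rewrite ler_wpM2r.
    by apply/andP; split; [exact: lt_trans u1|exact: lt_trans q2b].
  by apply/andP; split; [exact: lt_trans v1|exact: lt_trans q2b].
Qed.

(** On [a < s < a + n + 1] the square root expands distances by [1 / (2 sqrt (n +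
    1))]. *)
Lemma sqrt_null_preimage (N : set R) (a : R) : measurable N -> mu N = 0%E ->
  mu (`]a, +oo[ `&` (fun s => Num.sqrt (s - a)) @^-1` N) = 0%E.
Proof.
move=> mN N0.
have ms : measurable_fun setT (fun s : R => Num.sqrt (s - a)).
  apply: continuous_measurable_fun => s.
  apply: (@continuous_comp _ _ _ (fun s => s - a) Num.sqrt); last exact: sqrt_continuous.
  by apply: cvgB => //; exact: cvg_cst.
have mD n : measurable (`]a, a + n.+1%:R[ `&` (fun s => Num.sqrt (s - a)) @^-1` N).
  by apply: measurableI => //; rewrite -[_ @^-1` _]setTI; exact: ms.
apply: (@lebesgue_null_cover _ (fun n => `]a, a + n.+1%:R[ `&` (fun s =>
    Num.sqrt (s - a)) @^-1` N)).
- by apply: measurableI => //; rewrite -[_ @^-1` _]setTI; exact: ms.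
- exact: mD.
- move=> n.
  pose c : R := (2 * Num.sqrt n.+1%:R)^-1.
  have c0 : 0 < c by rewrite invr_gt0 mulr_gt0 // sqrtr_gt0.
  apply: (@null_preimage_expanding _ _ _ c) => // x y /=.
  rewrite !in_itv /= => /andP[ax xn] /andP[ay yn].
  set u := Num.sqrt (x - a); set v := Num.sqrt (y - a).
  have E : x - y = (u - v) * (u + v).
    rewrite -subr_sqr !sqr_sqrtr ?subr_ge0 ?ltW //; ring.
  have uv0 : 0 <= u + v by rewrite addr_ge0 ?sqrtr_ge0.
  rewrite E normrM (ger0_norm uv0) mulrCA ler_piMr //.
  rewrite /c mulrC ler_pdivrMr ?mulr_gt0 ?sqrtr_gt0 // mul1r mulr2n mulrDl mul1r lerD //.
    by rewrite ler_sqrt // lerBlDl ltW.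
  by rewrite ler_sqrt // lerBlDl ltW.
- move=> s [/=]; rewrite in_itv /= andbT => as_ sN; exists (Num.truncn (s - a)) => //.
  split => //=; rewrite in_itv /= as_ -ltrBlDl; exact: truncnS_gt.
Qed.

End null_preimages.

(** * Events determined by cosines of random variables *)

Section trig_closure.
Context {T : Type} {R : realType}.
Implicit Types (V : set (T -> R)) (f g h L : T -> R).

(** An identity between integrals that holds for the cosines [cos (L + c)] extends
    to this class, by linearity and dominated convergence. *)
Inductive trig_closure V : (T -> R) -> Prop :=
| trig_closure_cos L c : V L -> trig_closure V (fun x => cos (L x + c))
| trig_closure_lin a f g : trig_closure V f -> trig_closure V g ->
    trig_closure V (fun x => a * f x + g x)
| trig_closure_lim (g_ : nat -> T -> R) h M : (forall n, trig_closure V (g_ n)) ->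
    (forall n x, `|g_ n x| <= M) -> (forall x, g_ n x @[n --> \oo] --> h x) ->
    trig_closure V h.

Definition function_space V := V (fun=> 0) /\
  forall (a : R) L L', V L -> V L' -> V (fun x => a * L x + L' x).

Variable V : set (T -> R).
Hypothesis sV : function_space V.
Local Notation clV := (trig_closure V).

Lemma function_spaceZ a L : V L -> V (fun x => a * L x).
Proof.
move=> VL; have := sV.2 a _ _ VL sV.1; congr V; apply/funext => x; exact: addr0.
Qed.

Lemma trig_closure_bounded f : clV f -> exists M, forall x, `|f x| <= M.
Proof.
elim=> [L c _|a g h _ [M gM] _ [N hN]|g h M _ _ gM gh].
- by exists 1 => x; rewrite ler_norml cos_geN1 cos_le1.
- exists (`|a| * M + N) => x; apply: le_trans (ler_normD _ _) _.
  by rewrite normrM lerD // ler_wpM2l.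
- exists M => x; have /cvg_norm := gh x => /cvgr_to_le; apply.
  by apply: nearW => n; exact: gM.
Qed.

Lemma trig_closure_cst c : clV (fun=> c).
Proof.
have h1 : clV (fun=> 1).
  have := trig_closure_cos 0 sV.1; congr trig_closure; apply/funext => x.
  by rewrite addr0 cos0.
have h0 : clV (fun=> 0).
  have := trig_closure_lin (-1) h1 h1; congr trig_closure; apply/funext => x; ring.
have := trig_closure_lin c h1 h0; congr trig_closure; apply/funext => x; ring.
Qed.

Lemma trig_closureD f g : clV f -> clV g -> clV (fun x => f x + g x).
Proof.
move=> cf cg; have := trig_closure_lin 1 cf cg; congr trig_closure; apply/funext => x; ring.
Qed.

Lemma trig_closureZ a f : clV f -> clV (fun x => a * f x).
Proof.
move=> cf; have := trig_closure_lin a cf (trig_closure_cst 0).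
by congr trig_closure; apply/funext => x; ring.
Qed.

(** Product-to-sum formula for two cosines; the other two constructors commute
    with the multiplication by a fixed bounded function. *)
Lemma trig_closureM f g : clV f -> clV g -> clV (fun x => f x * g x).
Proof.
move=> cf; elim: cf g => {f} [L c VL g|a f1 f2 _ IH1 _ IH2 g cg|g h M cg IH gM gh k ck].
- elim=> {g} [L' c' VL'|a g1 g2 _ IH1 _ IH2|g h M cg IH gM gh].
  + have s : V (fun x => L x + L' x).
      have := sV.2 1 _ _ VL VL'; congr V; apply/funext => x; ring.
    have d : V (fun x => L x - L' x).
      have := sV.2 (-1) _ _ VL' VL; congr V; apply/funext => x; ring.
    have := trig_closureZ 2^-1 (trig_closureD (trig_closure_cos (c + c') s) (trig_closure_cos (c -
        c') d)).
    congr trig_closure; apply/funext => x.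
    have -> : L x + L' x + (c + c') = (L x + c) + (L' x + c') by ring.
    have -> : L x - L' x + (c - c') = (L x + c) - (L' x + c') by ring.
    by rewrite cosD cosB; field.
  + have := trig_closure_lin a IH1 IH2; congr trig_closure; apply/funext => x; ring.
  + apply: (trig_closure_lim (M := M) IH) => [n x|x].
      rewrite normrM; apply: le_trans (gM n x); rewrite ler_piMl //.
      by rewrite ler_norml cos_geN1 cos_le1.
    by apply: cvgM; [exact: cvg_cst|exact: gh].
- have := trig_closure_lin a (IH1 _ cg) (IH2 _ cg); congr trig_closure; apply/funext => x; ring.
- have [N kN] := trig_closure_bounded ck.
  apply: (trig_closure_lim (M := M * N) (fun n => IH n k ck)) => [n x|x].
    by rewrite normrM ler_pM.
  by apply: cvgM; [exact: gh|exact: cvg_cst].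
Qed.

(** The iterates of this map preserve the interval from [-1] to [1] and converge
    pointwise to the sign: the indicator of [f > 0] becomes a bounded limit of
    polynomials in [f]. *)
Let p (x : R) := x * (3 - x ^+ 2) / 2.

Let iterN n x : iter n p (- x) = - iter n p x.
Proof. by elim: n => //= n ->; rewrite /p; ring. Qed.

Let iter_pos n x : 0 < x <= 1 -> x <= iter n p x <= 1 /\ 1 - iter n p x <= (1 - x / 2) ^+ n.
Proof.
move=> /andP[x0 x1]; elim: n => [|n [/andP[IH1 IH2] IH3]] /=.
  by rewrite lexx x1 expr0; split => //; lra.
set y := iter n p x in IH1 IH2 IH3 *.
have E1 : p y - y = y * (1 - y ^+ 2) / 2 by rewrite /p; field.
have E2 : 1 - p y = (1 - y) * (1 - (y + y ^+ 2) / 2) by rewrite /p; field.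
have y0 : 0 <= y by lra.
have y2 : 0 <= y ^+ 2 <= 1 by rewrite sqr_ge0 exprn_ile1.
have a1 : 0 <= p y - y by rewrite E1 mulr_ge0 // mulr_ge0 //; lra.
have a2 : 0 <= 1 - p y by rewrite E2 mulr_ge0 //; lra.
split; first by apply/andP; split; lra.
rewrite E2 [in leRHS]exprSr; apply: ler_pM => //; lra.
Qed.

Let iter_sgr x : -1 <= x <= 1 -> iter n p x @[n --> \oo] --> Num.sg x.
Proof.
have pos y : 0 < y <= 1 -> iter n p y @[n --> \oo] --> Num.sg y.
  move=> yi; have /andP[y0 y1] := yi; rewrite gtr0_sg //.
  rewrite -[X in _ --> X](subr0 1).
  have -> : (fun n => iter n p y) = (fun n => 1 - (1 - iter n p y)).
    by apply/funext => n; ring.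
  apply: cvgB; first exact: cvg_cst.
  apply: (@squeeze_cvgr _ _ _ _ (cst 0) (fun n => (1 - y / 2) ^+ n)).
  - apply: nearW => n; have [/andP[_ h1] h2] := iter_pos n yi.
    by rewrite h2 andbT /= subr_ge0.
  - exact: cvg_cst.
  - by apply: cvg_expr; rewrite ltr_norml; lra.
move=> /andP[x1 x2]; have [x0|x0|->] := ltgtP x 0; last first.
- have -> : (fun n => iter n p 0) = (fun=> 0).
    apply/funext; elim=> //= n ->; rewrite /p; ring.
  rewrite sgr0; exact: cvg_cst.
- by apply: pos; rewrite x0 x2.
- rewrite -[x]opprK sgrN; under eq_fun do rewrite iterN.
  by apply: cvgN; apply: pos; lra.
Qed.

(** After rescaling [f] to values between [-1] and [1], its sign [s] is in the
    class, and the indicator of [s = 1] is [(s^2 + s) / 2]. *)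
Lemma trig_closure_gt0 f : clV f -> clV (fun x => ((0 : R) < f x)%R%:R).
Proof.
move=> cf; have [M fM] := trig_closure_bounded cf.
pose N := `|M| + 1; have N0 : 0 < N by rewrite /N ltr_wpDl.
pose g := fun x => N^-1 * f x.
have g1 x : -1 <= g x <= 1.
  rewrite -ler_norml /g normrM gtr0_norm ?invr_gt0 // mulrC ler_pdivrMr // mul1r.
  apply: le_trans (fM x) _; rewrite /N; have := ler_norm M; lra.
have it1 n x : `|iter n p (g x)| <= 1.
  have := g1 x; have pos y : 0 < y <= 1 -> `|iter n p y| <= 1.
    move=> yi; have [/andP[a b] _] := iter_pos n yi; rewrite ler_norml b andbT.
    by move: yi => /andP[y0 _]; lra.
  move: (g x) => y /andP[y1 y2]; have [y0|y0|->] := ltgtP y 0.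
  - by rewrite -[y]opprK iterN normrN pos //; lra.
  - by rewrite pos // y0.
  - have -> : iter n p 0 = 0 by elim: (n) => //= k ->; rewrite /p; ring.
    by rewrite normr0.
have ci n : clV (fun x => iter n p (g x)).
  elim: n => [|n IH]; first exact: trig_closureZ.
  have q := trig_closureM IH (trig_closureM IH IH).
  have := trig_closureZ 2^-1 (trig_closure_lin (-1) q (trig_closureZ 3 IH)).
  by congr trig_closure; apply/funext => x /=; rewrite /p; field.
have cs : clV (fun x => Num.sg (f x)).
  apply: (trig_closure_lim (M := 1) ci) => // x.
  have Ni : 0 < N^-1 by rewrite invr_gt0.
  have -> : Num.sg (f x) = Num.sg (g x) by rewrite /g sgrM (gtr0_sg Ni) mul1r.
  exact: iter_sgr.
have := trig_closureZ 2^-1 (trig_closureD (trig_closureM cs cs) cs).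
congr trig_closure; apply/funext => x.
have [x0|x0|->] := ltgtP (f x) 0.
- by rewrite ltr0_sg // mulrNN mulr1 subrr mulr0.
- by rewrite gtr0_sg //= mulr1; field.
- by rewrite sgr0 mulr0 addr0 mulr0.
Qed.

Definition trig_event : set (set T) := [set D | clV \1_D].

(** For [n] large, [(X - u) / (n + 1)] is in the interval where the sine has the
    sign of its argument; and the sine of [X / (n + 1) + c] is a shifted cosine.
    *)
Lemma trig_event_ray (X : T -> R) u : V X -> trig_event [set x | u < X x].
Proof.
move=> VX; rewrite /trig_event /=.
have cn n : clV (fun x => ((0 : R) < sin ((X x - u) / n.+1%:R))%R%:R).
  apply: trig_closure_gt0.
  have := trig_closure_cos (- u / n.+1%:R - pi / 2) (function_spaceZ n.+1%:R^-1 VX).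
  congr trig_closure; apply/funext => x.
  have -> : n.+1%:R^-1 * X x + (- u / n.+1%:R - pi / 2) = (X x - u) / n.+1%:R - pi / 2 by ring.
  by rewrite cosB cos_pihalf sin_pihalf mulr0 add0r mulr1.
apply: (trig_closure_lim (M := 1) cn).
  by move=> n x; case: (_ < _)%R; rewrite ?normr1 ?normr0.
move=> x; rewrite indicE; apply: cvg_near_cst.
near=> n.
have n0 : (0 : R) < n.+1%:R by rewrite ltr0n.
have hn : `|X x - u| < n.+1%:R * pi.
  apply: (@lt_le_trans _ _ n%:R).
    by near: n; exact: nbhs_infty_gtr.
  have := pi_ge2 R; have : (n%:R : R) <= n.+1%:R by rewrite ler_nat.
  nra.
have [ux|ux] := ltP u (X x).
  rewrite mem_set //= sin_gt0_pi // divr_gt0 ?subr_gt0 //=.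
  rewrite ltr_pdivrMr // mulrC; move: hn; rewrite ltr_norml => /andP[]; lra.
rewrite memNset /=; last by apply/negP; rewrite -leNgt.
rewrite ltNge (_ : sin _ <= 0) //.
rewrite -oppr_ge0 -sinN sin_ge0_pi // -mulNr divr_ge0 ?(ltW n0) //=; last lra.
rewrite ler_pdivrMr // mulrC; move: hn; rewrite ltr_norml => /andP[]; lra.
Unshelve. all: end_near. Qed.

Lemma trig_eventC D : trig_event D -> trig_event (~` D).
Proof.
move=> cD; have := trig_closure_lin (-1) cD (trig_closure_cst 1).
rewrite /trig_event /=; congr trig_closure; apply/funext => x.
by rewrite !indicE in_setC; case: (x \in D); rewrite /=; ring.
Qed.

Lemma trig_eventI D E : trig_event D -> trig_event E -> trig_event (D `&` E).
Proof. by move=> cD cE; rewrite /trig_event /= indicI; exact: trig_closureM. Qed.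

Lemma trig_event_sigma_algebra : sigma_algebra setT trig_event.
Proof.
split.
- rewrite /trig_event /=; have := trig_closure_cst 0; congr trig_closure.
  by apply/funext => x; rewrite indic0.
- by move=> D cD; rewrite setTD; exact: trig_eventC.
- move=> F cF.
  have cU n : trig_event (\big[setU/set0]_(i < n) F i).
    elim: n => [|n IH].
      rewrite big_ord0 /trig_event /=; have := trig_closure_cst 0; congr trig_closure.
      by apply/funext => x; rewrite indic0.
    rewrite big_ord_recr /= -[X in trig_event X]setCK; apply: trig_eventC.
    by rewrite setCU; apply: trig_eventI; exact: trig_eventC.
  apply: (trig_closure_lim (M := 1) cU).
    by move=> n x; rewrite indicE; case: (x \in _); rewrite ?normr1 ?normr0.
  move=> x; rewrite indicE; apply: cvg_near_cst.
  have [[i _ Fi]|nF] := pselect ((\bigcup_i F i) x).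
    near=> n; rewrite indicE mem_set; last first.
      rewrite -bigcup_mkord; exists i => //=.
      by near: n; exists i.+1.
    by rewrite mem_set //; exists i.
  apply: nearW => n; rewrite indicE memNset; last first.
    by rewrite -bigcup_mkord => -[i /= _ Fi]; apply: nF; exists i.
  by rewrite memNset.
Unshelve. all: end_near. Qed.

End trig_closure.

Section trig_closure_integral.
Context d (T : measurableType d) {R : realType}.
Implicit Types (V : set (T -> R)) (P Q : probability T R).

Lemma measurable_cosD (f : T -> R) (c : R) : measurable_fun setT f ->
  measurable_fun setT (fun x => cos (f x + c)).
Proof.
move=> mf; apply: (measurableT_comp (f := cos)).
  exact: continuous_measurable_fun (@continuous_cos R).
exact: measurable_funD.
Qed.

Lemma trig_closure_measurable V f : (forall L, V L -> measurable_fun setT L) ->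
  trig_closure V f -> measurable_fun setT f.
Proof.
move=> mV; elim=> {f} [L c VL|a f g _ mf _ mg|g h M _ IH _ gh].
- by apply: measurable_cosD => //; exact: mV.
- by apply: measurable_funD => //; exact: measurable_funM.
- by apply: (measurable_fun_cvg IH) => x _; exact: gh.
Qed.

Lemma bounded_integrable P (f : T -> R) M : measurable_fun setT f ->
  (forall x, `|f x| <= M) -> P.-integrable setT (EFin \o f).
Proof.
move=> mf fM; apply: (@le_integrable _ _ _ P _ _ _ (EFin \o cst M)) => //.
- exact/measurable_EFinP.
- by move=> x _; rewrite /= lee_fin; apply: le_trans (fM x) (ler_norm _).
- exact: finite_measure_integrable_cst.
Qed.

Lemma cvg_Rintegral_bounded P (g_ : nat -> T -> R) h M :
  (forall n, measurable_fun setT (g_ n)) -> (forall n x, `|g_ n x| <= M) ->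
  (forall x, g_ n x @[n --> \oo] --> h x) ->
  \int[P]_x g_ n x @[n --> \oo] --> \int[P]_x h x.
Proof.
move=> mg gM gh; apply: fine_cvg.
have mh : measurable_fun setT h by apply: (measurable_fun_cvg mg) => x _; exact: gh.
have hM x : `|h x| <= M.
  by have /cvg_norm := gh x => /cvgr_to_le; apply; apply: nearW => n; exact: gM.
rewrite fineK; last exact: integrable_fin_num (bounded_integrable P mh hM).
apply: (@dominated_cvg _ _ _ P setT _ (fun n x => (g_ n x)%:E) _ (EFin \o cst M)) => //.
- by move=> n; exact/measurable_EFinP.
- by move=> x _; apply: cvg_EFin; [exact: nearW|exact: gh].
- exact: finite_measure_integrable_cst.
- by move=> n x _; rewrite /= lee_fin.
Qed.

Lemma Rintegral_indic P D : measurable D -> \int[P]_x \1_D x = fine (P D).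
Proof. by move=> mD; rewrite /Rintegral integral_indic // setIT. Qed.

Lemma trig_event_measurable V D : (forall L, V L -> measurable_fun setT L) ->
  trig_event V D -> measurable D.
Proof.
by move=> mV /(trig_closure_measurable mV) => /measurable_indicP.
Qed.

(** Induction on the construction of the indicator of [D]. This plays the part of
    the injectivity of the characteristic function. *)
Lemma trig_event_unique V P Q : function_space V ->
  (forall L, V L -> measurable_fun setT L) ->
  (forall L c, V L -> \int[P]_x cos (L x + c) = \int[Q]_x cos (L x + c)) ->
  forall D, trig_event V D -> P D = Q D.
Proof.
move=> sV mV PQ D cD; have mD := trig_event_measurable mV cD.
suff H f : trig_closure V f -> \int[P]_x f x = \int[Q]_x f x.
  have := H _ cD; rewrite !Rintegral_indic // => E.
  by rewrite -(fineK (fin_num_measure P _ mD)) -(fineK (fin_num_measure Q _ mD)) E.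
move=> {}cf.
have mcl g : trig_closure V g -> measurable_fun setT g := trig_closure_measurable mV.
elim: cf => {f} [L c VL|a f g cf IHf cg IHg|g h M cg IH gM gh].
- exact: PQ.
- have [M fM] := trig_closure_bounded cf; have [N gN] := trig_closure_bounded cg.
  have key (S : probability T R) :
      \int[S]_x (a * f x + g x) = a * \int[S]_x f x + \int[S]_x g x.
    have i1 := bounded_integrable S (mcl _ cf) fM.
    have i2 := bounded_integrable S (mcl _ cg) gN.
    rewrite RintegralD // ?RintegralZl //.
    by under [X in integrable _ _ X]eq_fun do rewrite EFinM; exact: integrableZl.
  by rewrite !key IHf IHg.
- have mg n := mcl _ (cg n).
  have cP := cvg_Rintegral_bounded (P := P) mg gM gh.
  have cQ := cvg_Rintegral_bounded (P := Q) mg gM gh.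
  rewrite (funext IH) in cP.
  exact: cvg_unique cP cQ.
Qed.

(** Independence from the factorization of the cosine transforms, by induction on
    the construction of one indicator, and of the other one when the first
    function is a cosine. *)
Lemma trig_event_independent V V' P : function_space V -> function_space V' ->
  (forall L, V L -> measurable_fun setT L) ->
  (forall L, V' L -> measurable_fun setT L) ->
  (forall L c L' c', V L -> V' L' ->
     \int[P]_x (cos (L x + c) * cos (L' x + c')) =
     \int[P]_x cos (L x + c) * \int[P]_x cos (L' x + c')) ->
  forall D D', trig_event V D -> trig_event V' D' -> (P (D `&` D') = P D * P D')%E.
Proof.
move=> sV sV' mV mV' ind D D' cD cD'.
have mD := trig_event_measurable mV cD; have mD' := trig_event_measurable mV' cD'.
suff H f g : trig_closure V f -> trig_closure V' g ->
    \int[P]_x (f x * g x) = \int[P]_x f x * \int[P]_x g x.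
  have := H _ _ cD cD'; have -> : (fun x => \1_D x * \1_D' x) = \1_(D `&` D') :> (T -> R).
    by rewrite indicI.
  rewrite !Rintegral_indic //; last exact: measurableI.
  move=> E; rewrite -(fineK (fin_num_measure P _ (measurableI _ _ mD mD'))) E EFinM.
  by rewrite !fineK ?fin_num_measure.
have mcl f' : trig_closure V f' -> measurable_fun setT f' := trig_closure_measurable mV.
have mcl' f' : trig_closure V' f' -> measurable_fun setT f' := trig_closure_measurable mV'.
have lin (a : R) (u v w : T -> R) (M1 M2 M3 : R) : measurable_fun setT u -> measurable_fun setT v ->
    measurable_fun setT w -> (forall x, `|u x| <= M1) -> (forall x, `|v x| <= M2) ->
    (forall x, `|w x| <= M3) ->
    \int[P]_x ((a * u x + v x) * w x) = a * \int[P]_x (u x * w x) + \int[P]_x (v x * w x).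
  move=> mu mv mw uM vM wM.
  have i1 : P.-integrable setT (EFin \o (fun x => u x * w x)).
    apply: (@bounded_integrable P _ (M1 * M3)); first exact: measurable_funM.
    by move=> x; rewrite normrM ler_pM.
  have i2 : P.-integrable setT (EFin \o (fun x => v x * w x)).
    apply: (@bounded_integrable P _ (M2 * M3)); first exact: measurable_funM.
    by move=> x; rewrite normrM ler_pM.
  under eq_Rintegral do rewrite mulrDl -mulrA.
  rewrite RintegralD // ?RintegralZl //.
  by under [X in integrable _ _ X]eq_fun do rewrite EFinM; exact: integrableZl.
have lin1 (a : R) (u v : T -> R) (M1 M2 : R) : measurable_fun setT u -> measurable_fun setT v ->
    (forall x, `|u x| <= M1) -> (forall x, `|v x| <= M2) ->
    \int[P]_x (a * u x + v x) = a * \int[P]_x u x + \int[P]_x v x.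
  move=> mu mv uM vM.
  have one (x : T) : `|cst (1 : R) x| <= 1 by rewrite /= normr1.
  have := lin a u v (cst 1) M1 M2 1 mu mv (measurable_cst _) uM vM one.
  have E (k : T -> R) : \int[P]_x (k x * cst 1 x) = \int[P]_x k x.
    by apply: eq_Rintegral => x _; rewrite mulr1.
  by rewrite !E.
move=> cf; elim: cf g => {f} [L c VL|a f1 f2 cf1 IH1 cf2 IH2|f_ f M cf IH fM ff] g cg.
- elim: cg => {g} [L' c' VL'|a g1 g2 cg1 IH1 cg2 IH2|g_ g M cg IH gM gg].
  + exact: ind.
  + have [M1 gM1] := trig_closure_bounded cg1; have [M2 gM2] := trig_closure_bounded cg2.
    have cL := trig_closure_cos c VL; have [M0 LM0] := trig_closure_bounded cL.
    rewrite (lin1 a g1 g2 M1 M2 (mcl' _ cg1) (mcl' _ cg2) gM1 gM2) mulrDr mulrCA -IH1 -IH2.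
    have := lin a g1 g2 _ M1 M2 M0 (mcl' _ cg1) (mcl' _ cg2) (mcl _ cL) gM1 gM2 LM0.
    under eq_Rintegral do rewrite mulrC.
    move=> ->; congr (_ * _ + _); apply: eq_Rintegral => x _; exact: mulrC.
  + have cL := trig_closure_cos c VL; have mg n := mcl' _ (cg n).
    have c1 := cvg_Rintegral_bounded (P := P) mg gM gg.
    have c2 : \int[P]_x (cos (L x + c) * g_ n x) @[n --> \oo] --> \int[P]_x (cos (L x + c) * g x).
      apply: (cvg_Rintegral_bounded (M := M)).
      * by move=> n; apply: measurable_funM => //; exact: mcl cL.
      * move=> n x; rewrite normrM; apply: le_trans (gM n x); rewrite ler_piMl //.
        by rewrite ler_norml cos_geN1 cos_le1.
      * by move=> x; apply: cvgM; [exact: cvg_cst|exact: gg].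
    rewrite (funext IH) in c2.
    have c3 : \int[P]_x cos (L x + c) * \int[P]_x g_ n x @[n --> \oo] --> \int[P]_x cos (L x +
        c) * \int[P]_x g x.
      by apply: cvgM => //; exact: cvg_cst.
    exact: cvg_unique c2 c3.
- have [M1 fM1] := trig_closure_bounded cf1; have [M2 fM2] := trig_closure_bounded cf2.
  have [M0 gM0] := trig_closure_bounded cg.
  rewrite (lin1 a f1 f2 M1 M2 (mcl _ cf1) (mcl _ cf2) fM1 fM2) mulrDl -mulrA -IH1 // -IH2 //.
  exact: (lin a f1 f2 _ M1 M2 M0 (mcl _ cf1) (mcl _ cf2) (mcl' _ cg)).
- have mf n := mcl _ (cf n); have [N gN] := trig_closure_bounded cg.
  have c1 := cvg_Rintegral_bounded (P := P) mf fM ff.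
  have c2 : \int[P]_x (f_ n x * g x) @[n --> \oo] --> \int[P]_x (f x * g x).
    apply: (cvg_Rintegral_bounded (M := M * N)).
    * by move=> n; apply: measurable_funM => //; exact: mcl' cg.
    * by move=> n x; rewrite normrM ler_pM.
    * by move=> x; apply: cvgM; [exact: ff|exact: cvg_cst].
  have e2 : (fun n => \int[P]_x (f_ n x * g x)) = (fun n => \int[P]_x f_ n x * \int[P]_x g x).
    by apply/funext => n; exact: IH.
  rewrite e2 in c2.
  have c3 : \int[P]_x f_ n x * \int[P]_x g x @[n --> \oo] --> \int[P]_x f x * \int[P]_x g x.
    by apply: cvgM => //; exact: cvg_cst.
  exact: cvg_unique c2 c3.
Qed.

End trig_closure_integral.

Section trig_event_measurable.
Context {T : pointedType} {R : realType} (V : set (T -> R)).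
Hypothesis sV : function_space V.
Local Notation TV := (g_sigma_algebraType (trig_event V)).

Lemma measurable_trig_event (D : set TV) : measurable D -> trig_event V D.
Proof. by rewrite /measurable /= sigma_algebra_id //; exact: trig_event_sigma_algebra. Qed.

(** Rays generate the Borel sets of the line. *)
Lemma measurable_fun_trig (X : T -> R) : V X ->
  measurable_fun (setT : set TV) (X : TV -> measurableTypeR R).
Proof.
move=> VX; apply: (measurability _ (RGenOInfty.measurableE R)).
move=> _ [_ [u ->] <-]; rewrite setTI; apply: sub_sigma_algebra.
have -> : X @^-1` `]u, +oo[%classic = [set x | u < X x].
  by apply/seteqP; split=> x /=; rewrite in_itv /= andbT.
exact: trig_event_ray.
Qed.
End trig_event_measurable.

(** * Null sets of the standard Gaussian law of the plane *)

Section product_null.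
Context d1 d2 (T1 : measurableType d1) (T2 : measurableType d2) {R : realType}.
Variables (m1 : {sigma_finite_measure set T1 -> \bar R})
  (m2 : {sigma_finite_measure set T2 -> \bar R}).

Lemma ge0_integral_eq0P d (T : measurableType d) (m : {measure set T -> \bar R}) f :
  measurable_fun setT f -> (forall x, 0 <= f x)%E ->
  (\int[m]_x f x = 0)%E <-> {ae m, forall x, f x = 0%E}.
Proof.
move=> mf f0; have := ae_eq_integral_abs m measurableT mf.
under eq_integral do rewrite gee0_abs //.
move=> ->; split; apply: filterS => x /=; first exact.
by move=> ->.
Qed.

Lemma prod_null_xsection A : measurable A -> (m1 \x m2)%E A = 0%E <->
  {ae m1, forall x, m2 [set y | A (x, y)] = 0%E}.
Proof.
move=> mA; rewrite /product_measure1.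
rewrite ge0_integral_eq0P //; last exact: measurable_fun_xsection.
by split; apply: filterS => x /=; rewrite xsectionE.
Qed.

Lemma prod_null_ysection A : measurable A -> (m1 \x m2)%E A = 0%E <->
  {ae m2, forall y, m1 [set x | A (x, y)] = 0%E}.
Proof.
move=> mA.
have -> : (m1 \x m2)%E A = (m1 \x^ m2)%E A.
  by apply: product_measure_unique => //= ? ? ? ?; rewrite product_measure2E.
rewrite /product_measure2 ge0_integral_eq0P //; last exact: measurable_fun_ysection.
by split; apply: filterS => x /=; rewrite ysectionE.
Qed.

End product_null.

Section gauss_plane.
Context {R : realType}.
Local Notation RR := (measurableTypeR R).
Local Notation mu := (@lebesgue_measure R).
Local Notation gauss := (normal_prob (0 : R) 1).

Definition gauss2 : probability (RR * RR)%type R := (gauss \x gauss)%E.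

Lemma gauss2_null_xsection (A : set (RR * RR)) : measurable A ->
  gauss2 A = 0%E <-> {ae gauss, forall x, gauss [set y | A (x, y)] = 0%E}.
Proof. exact: prod_null_xsection. Qed.

Lemma gauss_null (A : set RR) : measurable A -> mu A = 0%E -> gauss A = 0%E.
Proof. exact: (null_content_dominatesP _ _).1 (@normal_prob_dominates R 0 1) A. Qed.

(** The Gaussian density vanishes nowhere. *)
Lemma gauss_null_inv (A : set RR) : measurable A -> gauss A = 0%E -> mu A = 0%E.
Proof.
move=> mA; rewrite /normal_prob => A0.
have mpdf : measurable_fun A (fun x => (normal_pdf (0 : R) 1 x)%:E).
  by apply: measurable_funTS; apply/measurable_EFinP; exact: measurable_normal_pdf.
have := (ae_eq_integral_abs mu mA mpdf).1.
under eq_integral do rewrite gee0_abs ?lee_fin ?normal_pdf_ge0 //.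
move=> /(_ A0) [N [mN N0 AN]].
apply/eqP; rewrite eq_le measure_ge0 andbT -N0.
apply: le_measure; rewrite ?inE // => x Ax; apply: AN => /= /(_ Ax) /eqP.
rewrite eqe normal_pdfE ?oner_eq0 // gt_eqF //.
by rewrite mulr_gt0 ?expR_gt0 // normal_peak_gt0 // oner_eq0.
Qed.

Lemma leb2_null_gauss2 (A : set (RR * RR)) : measurable A ->
  (mu \x mu)%E A = 0%E -> gauss2 A = 0%E.
Proof.
move=> mA /prod_null_xsection - /(_ mA) h; apply/gauss2_null_xsection => //.
case: h => N [mN N0 AN]; exists N; split => //; first exact: gauss_null.
apply: subset_trans AN => x /= nx; apply: contra_not nx => h; apply: gauss_null h.
by have := measurable_xsection x mA; rewrite xsectionE.
Qed.

Lemma gauss2_cos (a b c : R) :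
  \int[gauss2]_x cos (a * x.1 + b * x.2 + c) = expR (- ((a ^+ 2 + b ^+ 2) / 2)) * cos c.
Proof.
have mf : measurable_fun setT (fun x : RR * RR => cos (a * x.1 + b * x.2 + c)).
  apply: measurable_cosD => //; apply: measurable_funD.
    by apply: measurable_funM => //; exact: measurable_fst.
  by apply: measurable_funM => //; exact: measurable_snd.
have i2 : gauss2.-integrable setT (EFin \o (fun x : RR * RR => cos (a * x.1 + b * x.2 + c))).
  apply: (@bounded_integrable _ _ _ _ _ 1) => // x.
  by rewrite ler_norml cos_geN1 cos_le1.
have s1 : (1 : R) != 0 by rewrite oner_eq0.
have g1 (t e : R) : (\int[gauss]_x (cos (t * x + e))%:E = (expR (- (t ^+ 2 / 2)) * cos e)%:E)%E.
  rewrite -(@fineK _ (\int[gauss]_x (cos (t * x + e))%:E)%E).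
    have := normal_prob_cos t e s1; rewrite /Rintegral => ->.
    by rewrite expr1n mul1r.
  apply: integrable_fin_num => //; apply: (@bounded_integrable _ _ _ _ _ 1).
    by apply: measurable_cosD => //; exact: measurable_funM.
  by move=> x; rewrite ler_norml cos_geN1 cos_le1.
rewrite /Rintegral /gauss2 -(integral12_prod_meas1 i2) /fubini_F /=.
under eq_integral => x _.
  under eq_integral => y _ do rewrite addrAC addrC.
  rewrite g1 EFinM; over.
rewrite integralZl //=; last first.
  apply: (@bounded_integrable _ _ _ _ _ 1).
    by apply: measurable_cosD => //; exact: measurable_funM.
  by move=> x; rewrite ler_norml cos_geN1 cos_le1.
by rewrite g1 -EFinM /= mulrA -expRD; congr (expR _ * _); field.
Qed.

Lemma gauss2_unique (Q : probability (RR * RR)%type R) :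
  (forall a b c : R, \int[Q]_x cos (a * x.1 + b * x.2 + c) =
      expR (- ((a ^+ 2 + b ^+ 2) / 2)) * cos c) ->
  forall B, measurable B -> Q B = gauss2 B.
Proof.
move=> Qcos B mB.
pose V : set (RR * RR -> R) := [set L | exists a b : R, L = fun x => a * x.1 + b * x.2].
have sV : function_space V.
  split; first by exists 0, 0; apply/funext => x; rewrite !mul0r addr0.
  move=> e _ _ [a [b ->]] [a' [b' ->]]; exists (e * a + a'), (e * b + b').
  by apply/funext => x; ring.
have mV L : V L -> measurable_fun setT L.
  move=> [a [b ->]]; apply: measurable_funD.
    by apply: measurable_funM => //; exact: measurable_fst.
  by apply: measurable_funM => //; exact: measurable_snd.
apply: (@trig_event_unique _ _ _ V) => //.
  by move=> _ c [a [b ->]]; rewrite Qcos gauss2_cos.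
apply: measurable_trig_event => //.
have m1 : measurable_fun (setT : set (g_sigma_algebraType (trig_event V))) (fst : _ -> RR).
  by apply: measurable_fun_trig => //; exists 1, 0; apply/funext => x; rewrite mul1r mul0r addr0.
have m2 : measurable_fun (setT : set (g_sigma_algebraType (trig_event V))) (snd : _ -> RR).
  by apply: measurable_fun_trig => //; exists 0, 1; apply/funext => x; rewrite mul1r mul0r add0r.
have := measurable_fun_pair m1 m2 measurableT mB; rewrite setTI.
by congr measurable; apply/seteqP; split => -[].
Qed.

Definition rot (t : R) (v : RR * RR) : RR * RR :=
  (cos t * v.1 - sin t * v.2, sin t * v.1 + cos t * v.2).

Lemma measurable_rot : measurable_fun setT (fun w : (RR * RR) * RR => rot w.2 w.1).
Proof.
have mc : measurable_fun setT (cos : RR -> RR) by exact: continuous_measurable_fun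
    (@continuous_cos R).
have ms : measurable_fun setT (sin : RR -> RR) by exact: continuous_measurable_fun
    (@continuous_sin R).
have m2 : measurable_fun setT (fun w : (RR * RR) * RR => w.2) by exact: measurable_snd.
have m11 : measurable_fun setT (fun w : (RR * RR) * RR => w.1.1).
  by apply: measurableT_comp; [exact: measurable_fst|exact: measurable_fst].
have m12 : measurable_fun setT (fun w : (RR * RR) * RR => w.1.2).
  by apply: measurableT_comp; [exact: measurable_snd|exact: measurable_fst].
apply: measurable_fun_pair.
  by apply: measurable_funB; apply: measurable_funM => //; exact: measurableT_comp.
by apply: measurable_funD; apply: measurable_funM => //; exact: measurableT_comp.
Qed.

Lemma measurable_rot1 t : measurable_fun setT (rot t).
Proof. exact: (measurable_fun_pair1 t measurable_rot). Qed.

(** A rotation acts isometrically on the linear forms, and the cosine transform of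
    [gauss2] depends only on their norms. *)
Lemma gauss2_rot t B : measurable B -> gauss2 (rot t @^-1` B) = gauss2 B.
Proof.
move=> mB.
pose X : {mfun (RR * RR)%type >-> (RR * RR)%type} := mfun_Sub (mem_set (measurable_rot1 t)).
transitivity (distribution gauss2 X B); first by [].
apply: gauss2_unique => // a b c.
have mf : measurable_fun setT (fun x : RR * RR => cos (a * x.1 + b * x.2 + c)).
  apply: measurable_cosD => //; apply: measurable_funD.
    by apply: measurable_funM => //; exact: measurable_fst.
  by apply: measurable_funM => //; exact: measurable_snd.
rewrite /Rintegral integral_distribution //; first last.
- apply: (@bounded_integrable _ _ _ gauss2 ((fun x : RR * RR =>
      cos (a * x.1 + b * x.2 + c)) \o X) 1).
    exact: measurableT_comp.
  by move=> x; rewrite ler_norml cos_geN1 cos_le1.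
- exact/measurable_EFinP.
have := gauss2_cos (a * cos t + b * sin t) (b * cos t - a * sin t) c; rewrite /Rintegral.
have -> : (a * cos t + b * sin t) ^+ 2 + (b * cos t - a * sin t) ^+ 2 =
    (a ^+ 2 + b ^+ 2) * (cos t ^+ 2 + sin t ^+ 2) by ring.
rewrite cos2Dsin2 mulr1 => <-; congr fine; apply: eq_integral => x _ /=.
by congr (cos _)%:E; rewrite /rot /=; ring.
Qed.

Definition sqn (v : RR * RR) : R := v.1 ^+ 2 + v.2 ^+ 2.

Lemma measurable_sqn : measurable_fun setT sqn.
Proof.
apply: measurable_funD; apply: measurable_funX; [exact: measurable_fst|exact: measurable_snd].
Qed.

Lemma measurable_preimageT d1 d2 (T1 : measurableType d1) (T2 : measurableType d2) (f : T1 -> T2)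
    A :
  measurable_fun setT f -> measurable A -> measurable (f @^-1` A).
Proof. by move=> mf mA; rewrite -[_ @^-1` _]setTI; exact: mf. Qed.

(** Each section is the preimage of [N] under the polynomial [y^2 + x^2]. *)
Lemma gauss2_sqn_null (N : set RR) : measurable N -> mu N = 0%E ->
  gauss2 (sqn @^-1` N) = 0%E.
Proof.
move=> mN N0; apply/gauss2_null_xsection.
  exact: measurable_preimageT measurable_sqn mN.
apply: aeW => x.
have -> : [set y | (sqn @^-1` N) (x, y)] = horner ('X^2 + (x ^+ 2)%:P) @^-1` N.
  by apply/seteqP; split => y /=; rewrite /sqn /= !hornerE addrC.
apply: gauss_null; first exact: measurable_preimageT (measurable_horner _) mN.
apply: poly_null_preimage => //.
by rewrite size_polyDl ?size_polyXn // (leq_ltn_trans (size_polyC_leq1 _)).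
Qed.

(** By Fubini almost every vertical section is null. The section at [x] determines
    [B] on the half-line beyond [x^2] through [s = x^2 + y^2], and [x] may be
    taken arbitrarily close to 0. *)
Lemma gauss2_sqn_null_inv (B : set RR) : measurable B ->
  gauss2 (sqn @^-1` B) = 0%E -> mu (`]0, +oo[ `&` B) = 0%E.
Proof.
move=> mB /gauss2_null_xsection - /(_ (measurable_preimageT measurable_sqn mB)) ae0.
have ex n : exists x : R, x ^+ 2 <= n.+1%:R^-1 /\ mu [set y | B (x ^+ 2 + y ^+ 2)] = 0%E.
  apply: contrapT => /forallNP nx.
  case: ae0 => N [mN N0 AN].
  have sub : `]0, n.+1%:R^-1[%classic `<=` N.
    move=> x /=; rewrite in_itv /= => /andP[x0 xn]; apply: AN => /= h.
    apply: (nx x); split.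
      rewrite expr2; apply: le_trans (_ : x * 1 <= _); last by rewrite mulr1 ltW.
      rewrite ler_wpM2l ?(ltW x0) //; apply: le_trans (ltW xn) _.
      by rewrite invf_le1 ?ltr0n // ler1n.
    apply: gauss_null_inv h.
    have := measurable_xsection x (measurable_preimageT measurable_sqn mB).
    by rewrite xsectionE.
  pose I : set R := `]0, n.+1%:R^-1[%classic.
  have : (mu I <= 0)%E.
    rewrite -(gauss_null_inv mN N0); apply: le_measure => //; rewrite inE //; exact: measurable_itv.
  rewrite /I lebesgue_measure_itv /= lte_fin invr_gt0 ltr0n /= sube0 lee_fin.
  by rewrite leNgt invr_gt0 ltr0n.
have /choice[x xP] := ex.
pose F n := `](x n) ^+ 2, +oo[ `&` (fun s => Num.sqrt (s -
    (x n) ^+ 2)) @^-1` [set y | B ((x n) ^+ 2 + y ^+ 2)].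
have mBn n : measurable [set y | B ((x n) ^+ 2 + y ^+ 2)].
  have := measurable_xsection (x n) (measurable_preimageT measurable_sqn mB).
  by rewrite xsectionE.
apply: (@lebesgue_null_cover _ _ (fun n => `](x n) ^+ 2, +oo[ `&` B)).
- exact: measurableI.
- by move=> n; exact: measurableI.
- move=> n.
  have -> : `](x n) ^+ 2, +oo[ `&` B = F n.
    rewrite /F; apply/seteqP; split => s [/=]; rewrite in_itv /= andbT => sx Bs; split => //=;
        rewrite ?in_itv /= ?sx //.
      by rewrite sqr_sqrtr ?subr_ge0 ?(ltW sx) // addrC subrK.
    by move: Bs; rewrite sqr_sqrtr ?subr_ge0 ?(ltW sx) // addrC subrK.
  exact: sqrt_null_preimage (mBn n) (xP n).2.
- move=> s [/=]; rewrite in_itv /= andbT => s0 Bs.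
  exists (Num.truncn s^-1) => //; split => //=; rewrite in_itv /= andbT.
  apply: le_lt_trans (xP _).1 _; rewrite invf_plt ?posrE ?ltr0n //.
  exact: truncnS_gt.
Qed.

Lemma gauss2_norm_null (N : set RR) : measurable N -> mu N = 0%E ->
  gauss2 [set v | N (Num.sqrt (sqn v))] = 0%E.
Proof.
move=> mN N0.
have ms : measurable_fun setT (Num.sqrt : RR -> RR).
  by apply: continuous_measurable_fun; exact: sqrt_continuous.
have mM : measurable ([set 0] `|` (`]0, +oo[ `&` Num.sqrt @^-1` N) : set RR).
  by apply: measurableU => //; apply: measurableI => //; exact: measurable_preimageT ms mN.
apply/eqP; rewrite eq_le measure_ge0 andbT.
pose M : set RR := [set 0] `|` (`]0, +oo[ `&` Num.sqrt @^-1` N).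
have M0 : mu M = 0%E.
  have := @sqrt_null_preimage R N 0 mN N0.
  have -> : (fun s : R => Num.sqrt (s - 0)) = Num.sqrt by apply/funext => s; rewrite subr0.
  move=> h; apply/eqP; rewrite eq_le measure_ge0 andbT.
  apply: le_trans (measureU2 _ _ _) _ => //.
    by apply: measurableI => //; exact: measurable_preimageT ms mN.
  by rewrite [X in (X + _)%E](lebesgue_measure_set1 0) add0e [leLHS]h.
rewrite -[leRHS](gauss2_sqn_null mM M0).
apply: le_measure; rewrite ?inE.
- exact: measurable_preimageT (measurableT_comp ms measurable_sqn) mN.
- exact: measurable_preimageT measurable_sqn mM.
- move=> v /= Nv; have : 0 <= sqn v by rewrite addr_ge0 ?sqr_ge0.
  rewrite le_eqVlt => /predU1P[<-|s0]; [by left|right].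
  by rewrite in_itv /= s0.
Qed.

Definition circle_section (A : set (RR * RR)) (r : R) : set RR :=
  [set t | A (r * cos t, r * sin t)].

Lemma polar (v : RR * RR) : exists t : R, v = (Num.sqrt (sqn v) * cos t, Num.sqrt (sqn v) * sin t).
Proof.
case: v => x y; set r := Num.sqrt _.
have r2 : r ^+ 2 = x ^+ 2 + y ^+ 2 by rewrite sqr_sqrtr // addr_ge0 ?sqr_ge0.
have [r0|r0] := eqVneq r 0.
  exists 0; rewrite r0 !mul0r; move/eqP: r2.
  rewrite r0 expr0n /= eq_sym paddr_eq0 ?sqr_ge0 // !sqrf_eq0.
  by move=> /andP[/eqP -> /eqP ->].
have rp : 0 < r by rewrite lt_def r0 sqrtr_ge0.
have xr : -1 <= x / r <= 1.
  rewrite ler_pdivlMr // ler_pdivrMr // mulN1r mul1r -ler_norml.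
  rewrite -(@ler_pXn2r _ 2) ?nnegrE ?normr_ge0 ?(ltW rp) // real_normK ?num_real //.
  by rewrite r2 lerDl sqr_ge0.
have [/andP[t0 tpi] ct] := acos_def xr.
have st : (r * sin (acos (x / r))) ^+ 2 = y ^+ 2.
  rewrite exprMn sin2cos2 ct mulrBr mulr1 -exprMn mulrCA divff // mulr1 r2.
  by rewrite addrAC subrr add0r.
have ct' : r * cos (acos (x / r)) = x by rewrite ct mulrCA divff // mulr1.
move/eqP : st; rewrite eqf_sqr => /orP[/eqP st|/eqP st].
  by exists (acos (x / r)); rewrite ct' st.
by exists (- acos (x / r)); rewrite cosN sinN mulrN ct' st opprK.
Qed.

Lemma rot_polar (r s t : R) : rot t (r * cos s, r * sin s) = (r * cos (t + s), r * sin (t + s)).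
Proof. by rewrite /rot /= cosD sinD; congr pair; ring. Qed.

Lemma sqn_rot t v : sqn (rot t v) = sqn v.
Proof.
have := cos2Dsin2 t; rewrite /sqn /rot /= => h.
transitivity ((v.1 ^+ 2 + v.2 ^+ 2) * (cos t ^+ 2 + sin t ^+ 2)); first by ring.
by rewrite h mulr1.
Qed.

Lemma measurable_polar (A : set (RR * RR)) : measurable A ->
  measurable [set st : RR * RR | A (Num.sqrt st.1 * cos st.2, Num.sqrt st.1 * sin st.2)].
Proof.
move=> mA.
have ms : measurable_fun setT (Num.sqrt : RR -> RR).
  by apply: continuous_measurable_fun; exact: sqrt_continuous.
have m1 : measurable_fun setT (fun w : RR * RR => Num.sqrt w.1).
  by apply: measurableT_comp => //; exact: measurable_fst.
apply: (@measurable_preimageT _ _ _ _ (fun st : RR * RR =>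
    (Num.sqrt st.1 * cos st.2, Num.sqrt st.1 * sin st.2))) => //.
apply: measurable_fun_pair; apply: measurable_funM => //; apply: measurableT_comp.
- exact: continuous_measurable_fun (@continuous_cos R).
- exact: measurable_snd.
- exact: continuous_measurable_fun (@continuous_sin R).
- exact: measurable_snd.
Qed.

Lemma measurable_circle_section A r : measurable A -> 0 <= r -> measurable (circle_section A r).
Proof.
move=> mA r0; have := measurable_xsection (r ^+ 2) (measurable_polar mA).
rewrite xsectionE; congr measurable; apply/seteqP.
by split=> t /=; rewrite /circle_section /= sqrtr_sqr ger0_norm.
Qed.

Lemma affine_null_preimage (S : set RR) (d s : R) : measurable S -> d != 0 ->
  mu S = 0%E -> mu [set t | S (d * t + s)] = 0%E.
Proof.
move=> mS d0 h.
have -> : [set t | S (d * t + s)] = horner (d *: 'X + s%:P) @^-1` S.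
  by apply/seteqP; split => t /=; rewrite !hornerE.
apply: poly_null_preimage => //.
rewrite size_polyDl ?size_scale // ?size_polyX //.
by rewrite (leq_ltn_trans (size_polyC_leq1 _)).
Qed.

(** All the rotations of [A] are null, so by Fubini almost every [v] is carried
    into [A] by a null set of angles only: the section of [A] by the circle of [v]
    is null. Exceptional circles are indexed by the square of the radius, in
    accordance with [gauss2_sqn_null_inv]. *)
Lemma gauss2_null_circles (A : set (RR * RR)) : measurable A -> gauss2 A = 0%E ->
  exists N : set RR, [/\ measurable N, mu N = 0%E &
    forall r : R, 0 < r -> ~ N (r ^+ 2) -> mu (circle_section A r) = 0%E].
Proof.
move=> mA A0.
pose B : set RR := [set s | mu [set t | A (Num.sqrt s * cos t, Num.sqrt s * sin t)] != 0%E].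
have mB : measurable B.
  have := measurable_fun_xsection (@lebesgue_measure R) (measurable_polar mA) => mf.
  have -> : B = (fun s => mu [set t | A (Num.sqrt s * cos t, Num.sqrt s *
      sin t)]) @^-1` (~` [set 0%E]).
    by apply/seteqP; split => s /= /eqP.
  apply: measurable_preimageT; last exact: measurableC (emeasurable_set1 _).
  by move: mf; congr measurable_fun; apply/funext => s; rewrite /= xsectionE.
exists (`]0, +oo[ `&` B); split; first exact: measurableI.
  apply: gauss2_sqn_null_inv; first exact: mB.
  have mW := measurable_preimageT measurable_rot mA.
  have : (gauss2 \x @lebesgue_measure R)%E ((fun w => rot w.2 w.1) @^-1` A) = 0%E.
    apply: (prod_null_ysection gauss2 (@lebesgue_measure R) mW).2; apply: aeW => t.
    have -> : [set x | ((fun w => rot w.2 w.1) @^-1` A) (x, t)] = rot t @^-1` A by [].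
    exact: etrans (gauss2_rot t mA) A0.
  move/(prod_null_xsection gauss2 (@lebesgue_measure R) mW).1 => [Z [mZ Z0 AZ]].
  apply/eqP; rewrite eq_le measure_ge0 andbT -[leRHS]Z0.
  apply: le_measure; rewrite ?inE //; first exact: measurable_preimageT measurable_sqn mB.
  move=> v Bv; apply: AZ => /= h; move: Bv; rewrite /B /= => /negP; apply; apply/eqP.
  have [s sE] := polar v.
  have mS : measurable [set t | A (rot t v)].
    by have := measurable_xsection v mW; rewrite xsectionE.
  have := affine_null_preimage (- s) mS (oner_neq0 _) h.
  have E t : rot t v = (Num.sqrt (sqn v) * cos (t + s), Num.sqrt (sqn v) * sin (t + s)).
    by rewrite [in LHS]sE rot_polar.
  by congr (mu _ = _); apply/seteqP; split => t /=; rewrite mul1r E subrK.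
move=> r r0 nB; apply: contrapT => /eqP h; apply: nB; split.
  by rewrite /= in_itv /= andbT exprn_gt0.
by rewrite /B /= sqrtr_sqr gtr0_norm.
Qed.

(** The angles [t] for which [rot t v] is in the preimage of [A] form, up to the
    affine change [t |-> d t + s], the section of [A] by the circle of [G v],
    which is null for almost every [v]. By Fubini some rotation of the preimage is
    null, hence so is the preimage. *)
Lemma gauss2_equivariant_null (G : RR * RR -> RR * RR) (d : R) (q : {poly R})
    (A : set (RR * RR)) : measurable_fun setT G -> d != 0 ->
  (forall t v, G (rot t v) = rot (d * t) (G v)) ->
  (forall v, sqn (G v) = q.[Num.sqrt (sqn v)]) -> (1 < size q)%N ->
  measurable A -> gauss2 A = 0%E -> gauss2 (G @^-1` A) = 0%E.
Proof.
move=> mG d0 Grot Gq sq mA A0.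
have [N [mN N0 NA]] := gauss2_null_circles mA A0.
have mE := measurable_preimageT mG mA.
have mW := measurable_preimageT measurable_rot mE.
have : (gauss2 \x @lebesgue_measure R)%E ((fun w => rot w.2 w.1) @^-1` (G @^-1` A)) = 0%E.
  apply: (prod_null_xsection gauss2 (@lebesgue_measure R) mW).2.
  (* The origin is added to the exceptional radii, since [gauss2_null_circles]
     speaks of circles of positive radius. *)
  pose M := horner q @^-1` (N `|` [set 0]).
  have mN0 : measurable (N `|` [set 0] : set RR) by apply: measurableU.
  have mM : measurable M by exact: measurable_preimageT (measurable_horner q) mN0.
  have M0 : mu M = 0%E.
    apply: poly_null_preimage => //.
    apply/eqP; rewrite eq_le measure_ge0 andbT.
    apply: le_trans (measureU2 _ _ _) _ => //.
    by rewrite [X in (X + _)%E]N0 add0e [leLHS](lebesgue_measure_set1 0).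
  have ms : measurable_fun setT (fun v : RR * RR => Num.sqrt (sqn v)).
    apply: measurableT_comp; last exact: measurable_sqn.
    by apply: continuous_measurable_fun; exact: sqrt_continuous.
  exists [set v | M (Num.sqrt (sqn v))]; split.
  - exact: measurable_preimageT ms mM.
  - exact: gauss2_norm_null mM M0.
  - move=> v /=; apply: contra_notP => /not_orP[nN n0].
    have [s sE] := polar (G v).
    have r0 : 0 < Num.sqrt (sqn (G v)).
      rewrite sqrtr_gt0 lt_def addr_ge0 ?sqr_ge0 // andbT Gq; exact/eqP.
    have h : mu (circle_section A (Num.sqrt (sqn (G v)))) = 0%E.
      by apply: NA r0 _; rewrite sqr_sqrtr ?addr_ge0 ?sqr_ge0 // Gq.
    have mC := measurable_circle_section mA (ltW r0).
    have := affine_null_preimage s mC d0 h.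
    by congr (mu _ = _); apply/seteqP; split => t /=;
        rewrite /circle_section /= Grot [in rot _ _]sE rot_polar.
move/(prod_null_ysection gauss2 (@lebesgue_measure R) mW).1 => [Z [mZ Z0 AZ]].
have [t nZt] : exists t, ~ Z t.
  apply: contrapT => /forallNP h; have ZT : Z = setT by apply/seteqP; split => // t _;
      apply: contrapT; exact: h.
  have := lebesgue_measure_itv (R := R) `]-oo, +oo[; rewrite /= set_itvE -ZT Z0 => /eqP.
  by [].
have := AZ t; rewrite /= => /contra_notP - /(_ nZt).
have -> : [set x | ((fun w => rot w.2 w.1) @^-1` (G @^-1` A)) (x, t)] =
    rot t @^-1` (G @^-1` A) by [].
by rewrite [LHS]gauss2_rot; [|exact: mE].
Qed.

End gauss_plane.

(** * Power series with infinite radius of convergence *)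

Section entire_series.
Context {R : realType}.
Implicit Types (c : nat -> R) (f : R -> R).

Definition entire_series c f := forall t, pseries c t @ \oo --> f t.

(** Comparison with the series at [2 K], where [K = |t| + 1]: the factor [n + 1]
    brought by the derivative is at most [2^(n + 1)]. *)
Lemma is_cvg_pseries_diffs c : (forall t, cvgn (pseries c t)) ->
  forall t, cvgn (pseries (pseries_diffs c) t).
Proof.
move=> cc t; apply: normed_cvg.
pose K := `|t| + 1.
have K0 : 0 < K by rewrite ltr_wpDl.
have tK : `|t| <= K by rewrite lerDl.
have K2 : `|2 * K| < `|2 * K + 1| by rewrite !gtr0_norm ?ltrDl //; lra.
have := is_cvg_pseries_inside_norm (cc (2 * K + 1)) K2; rewrite /pseries => h.
have h' : cvgn [series K^-1 * (`|c i.+1| * (2 * K) ^+ i.+1)]_i.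
  apply: is_cvg_seriesZ.
  have := h; rewrite -(is_cvg_series_restrict 1) => /cvg_ex[l hl]; apply/cvg_ex; exists l.
  rewrite (_ : [series `|c i.+1| * (2 * K) ^+ i.+1]_i =
    fun n => \sum_(1 <= k < n.+1) `|c k| * (2 * K) ^+ k); last first.
    by apply/funext => n; rewrite /series /= big_add1.
  by rewrite (cvg_shiftS (fun n => \sum_(1 <= k < n) `|c k| * (2 * K) ^+ k)).
apply: (series_le_cvg _ _ _ h').
- by move=> n; rewrite normr_ge0.
- by move=> n; rewrite mulr_ge0 ?invr_ge0 ?mulr_ge0 ?exprn_ge0 ?mulr_ge0 ?(ltW K0).
- move=> n; rewrite /= /pseries_diffs !normrM normrX.
  have -> : K^-1 * (`|c n.+1| * (2 * K) ^+ n.+1) = `|c n.+1| * 2 ^+ n.+1 * K ^+ n.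
    by rewrite exprMn [K ^+ n.+1]exprS; field; rewrite gt_eqF.
  apply: ler_pM; rewrite ?mulr_ge0 ?exprn_ge0 //.
    rewrite mulrC ler_wpM2l // normr_nat -natrX ler_nat; exact/ltnW/ltn_expl.
  by rewrite lerXn2r ?nnegrE ?(ltW K0).
Qed.

Lemma entire_series_diffs c f f' : entire_series c f ->
  (forall t : R, is_derive t 1 f (f' t)) -> entire_series (pseries_diffs c) f'.
Proof.
move=> cf df t.
have c0 t' : cvgn (pseries c t') by apply/cvg_ex; exists (f t'); exact: cf.
have c1 := is_cvg_pseries_diffs c0.
have c2 := is_cvg_pseries_diffs c1.
pose K := `|t| + 1.
have tK : `|t| < `|K| by rewrite [ltRHS]ger0_norm ?addr_ge0 // ltrDl.
have d := pseries_snd_diffs (c0 K) (c1 K) (c2 K) tK.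
have E : (fun x => limn (pseries c x)) = f by apply/funext => x; apply/cvg_lim => //; exact: cf.
rewrite E in d.
have -> : f' t = limn (pseries (pseries_diffs c) t).
  by have [_ <-] := df t; have [_ <-] := d.
exact: c1.
Qed.

Lemma entire_series0 c f : entire_series c f -> c 0%N = f 0.
Proof.
move=> /(_ 0) h; apply/esym/(cvg_unique _ h) => //.
apply: cvg_near_cst; near=> n.
have [m ->] : exists m, n = m.+1 by exists n.-1; rewrite prednK //; near: n; exact: nbhs_infty_gt.
rewrite /pseries /series /= big_mkord big_ord_recl /= expr0 mulr1 big1 ?addr0 //.
by move=> i _; rewrite expr0n /= mulr0.
Unshelve. all: end_near. Qed.

Lemma entire_series_eq0 c : entire_series c (fun=> 0) -> forall n, c n = 0.
Proof.
move=> h n; elim: n c h => [|n IH] c h; first exact: (entire_series0 h).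
have : pseries_diffs c n = 0.
  by apply: IH; apply: (entire_series_diffs h) => t; exact: is_derive_cst.
by move/eqP; rewrite mulf_eq0 pnatr_eq0 /= => /eqP.
Qed.

(** The sum [f] satisfies [f' = (a - 2 b t) f]; comparing the coefficients gives
    the recurrence. *)
Lemma entire_series_exp_quadratic c (a b : R) :
  entire_series c (fun t => expR (a * t - b * t ^+ 2)) ->
  [/\ c 0%N = 1, c 1%N = a &
    forall n, n.+2%:R * c n.+2 = a * c n.+1 - 2 * b * c n].
Proof.
move=> h.
have c0 := entire_series0 h; rewrite mulr0 expr0n /= mulr0 subr0 expR0 in c0.
pose f' := fun t : R => (a - 2 * b * t) * expR (a * t - b * t ^+ 2).
have df (t : R) : is_derive t 1 (fun t => expR (a * t - b * t ^+ 2)) (f' t).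
  by apply: is_derive_eq; rewrite /GRing.scale /= /f'; ring.
have h' := entire_series_diffs h df.
(* coefficients of [t f] *)
pose sh n := if n is m.+1 then c m else 0.
pose d n := pseries_diffs c n - a * c n + 2 * b * sh n.
have dn : forall n, d n = 0.
  apply: entire_series_eq0 => t.
  have hs : (t * pseries c t n @[n --> \oo]) --> t * expR (a * t - b * t ^+ 2).
    by apply: cvgM; [exact: cvg_cst|exact: h].
  have hs1 : pseries sh t @ \oo --> t * expR (a * t - b * t ^+ 2).
    rewrite -(cvg_shiftS (pseries sh t)).
    rewrite (_ : (fun n => t * pseries c t n) =
      (fun n => pseries sh t n.+1)) // in hs.
    apply/funext => n.
    rewrite /pseries /series /= !big_mkord big_ord_recl /= mul0r add0r mulr_sumr.
    by apply: eq_bigr => i _; rewrite /bump /= add1n exprS; ring.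
  have -> : (0 : R) = f' t - a * expR (a * t - b * t ^+ 2) + 2 * b * (t * expR (a * t -
      b * t ^+ 2)).
    by rewrite /f'; ring.
  have -> : pseries d t = (fun n => pseries (pseries_diffs c) t n - a * pseries c t n +
     2 * b * pseries sh t n).
    apply/funext => n; rewrite /pseries /series /= !mulr_sumr -sumrB -big_split /=.
    by apply: eq_bigr => i _; rewrite /d; move: (pseries_diffs c i) (sh i) => u v; ring.
  apply: cvgD; first apply: cvgB; first exact: h'.
    by apply: cvgM; [exact: cvg_cst|exact: h].
  by apply: cvgM; [exact: cvg_cst|exact: hs1].
split => //.
  have := dn 0%N; rewrite /d /pseries_diffs /sh c0 /=; lra.
move=> n; have := dn n.+1; rewrite /d /pseries_diffs /sh /=; lra.
Qed.

End entire_series.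

(** * Double series summed by triangles *)

Section double_series.
Context {R : realType}.
Local Notation C := R[i].
Local Notation normc := (@Normc.normc R).

Lemma normc_ge0 (x : C) : 0 <= normc x.
Proof. by case: x => a b; exact: sqrtr_ge0. Qed.

Lemma normc_sum (I : Type) (r : seq I) (P : pred I) (F : I -> C) :
  normc (\sum_(i <- r | P i) F i) <= \sum_(i <- r | P i) normc (F i).
Proof.
elim/big_ind2: _ => [|x1 x2 y1 y2 h1 h2|//]; first by rewrite Normc.normc0.
by apply: le_trans (le_normcD _ _) _; exact: lerD.
Qed.

Lemma normc_ge_absRe (x : C) : `|complex.Re x| <= normc x.
Proof.
case: x => a b /=; rewrite -sqrtr_sqr ler_sqrt ?addr_ge0 ?sqr_ge0 //.
by rewrite lerDl sqr_ge0.
Qed.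

Lemma normc_ge_absIm (x : C) : `|complex.Im x| <= normc x.
Proof.
case: x => a b /=; rewrite -sqrtr_sqr ler_sqrt ?addr_ge0 ?sqr_ge0 //.
by rewrite lerDr sqr_ge0.
Qed.

Lemma summable_square_bounded (t : nat -> nat -> C) :
  summable [set: nat * nat] (fun m => (normc (t m.1 m.2))%:E) ->
  exists M, forall N, \sum_(p < N) \sum_(q < N) normc (t p q) <= M.
Proof.
rewrite /summable => h.
exists (fine (\esum_(x in [set: nat * nat]) `|(normc (t x.1 x.2))%:E|)%E) => N.
rewrite -lee_fin fineK; last by rewrite ge0_fin_numE // esum_ge0.
apply: esum_ge; pose r := [seq (p, q) | p <- iota 0 N, q <- iota 0 N].
have ur : uniq r by rewrite allpairs_uniq ?iota_uniq // => -[? ?] [? ?].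
exists [set` r].
  by split => //; exact: finite_seq.
rewrite -fsbig_seq // big_allpairs /= -sumEFin.
have -> : iota 0 N = index_iota 0 N by rewrite /index_iota subn0.
rewrite big_mkord; apply: lee_sum => p _.
rewrite big_mkord -sumEFin; apply: lee_sum => q _.
by rewrite lee_fin ler_norm.
Qed.

Lemma triangle_sumE (V : nmodType) (t : nat -> nat -> V) N :
  \sum_(n < N) \sum_(p < n.+1) t p (n - p)%N = \sum_(p < N) \sum_(q < N - p) t p q.
Proof.
elim: N => [|N IH]; first by rewrite !big_ord0.
rewrite big_ord_recr /= IH [RHS]big_ord_recr /= subSnn big_ord1.
rewrite [X in _ + X]big_ord_recr /= subnn addrA; congr (_ + _).
rewrite -big_split /=; apply: eq_bigr => p _.
by rewrite subSn ?(ltnW (ltn_ord p)) // big_ord_recr.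
Qed.

(** The triangle [p + q < N] contains the square of side [N / 2] and is contained
    in the square of side [N]. The norms of the terms between the triangle and the
    large square thus add up to less than the difference of two sequences with the
    same limit. *)
Lemma double_series_triangle (t : nat -> nat -> C) s : double_series t s ->
  normc (\sum_(n < N) \sum_(p < n.+1) t p (n - p)%N - s) @[N --> \oo] --> (0 : R).
Proof.
move=> [/summable_square_bounded[M QM] tS].
pose Q N := \sum_(p < N) \sum_(q < N) normc (t p q).
pose U N := \sum_(p < N) \sum_(q < N - p) normc (t p q).
have ge0S (F : nat -> R) m n : (forall i, 0 <= F i) -> (m <= n)%N ->
    \sum_(i < m) F i <= \sum_(i < n) F i.
  move=> F0 mn; rewrite -!(big_mkord xpredT) (big_cat_nat (leq0n m) mn) //= lerDl.
  by rewrite sumr_ge0.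
have Qnd : {homo Q : m n / (m <= n)%N >-> m <= n}.
  move=> m n mn; apply: le_trans (ge0S (fun p => \sum_(q < n) normc (t p q)) m n _ mn).
    by apply: ler_sum => p _; apply: (ge0S (fun q => normc (t p q))) => // i; exact: normc_ge0.
  by move=> i; apply: sumr_ge0 => j _; exact: normc_ge0.
have cQ : cvgn Q.
  apply: nondecreasing_is_cvgn => //.
  by exists M => _ [n _ <-]; exact: QM.
have UQ N : U N <= Q N.
  apply: ler_sum => p _; apply: (ge0S (fun q => normc (t p q))); last exact: leq_subr.
  by move=> i; exact: normc_ge0.
have hN N : (N./2 + N./2 <= N)%N by rewrite addnn -[leqRHS](odd_double_half N) leq_addl.
have QU N : Q N./2 <= U N.
  apply: le_trans (ge0S (fun p => \sum_(q < N - p) normc (t p q)) N./2 N _ _).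
  - apply: ler_sum => p _; apply: (ge0S (fun q => normc (t p q))); first by move=> i;
        exact: normc_ge0.
    apply: leq_trans (leq_sub2l N (ltnW (ltn_ord p))).
    by rewrite -(leq_add2r N./2) subnK // (leq_trans (leq_addr _ _) (hN N)).
  - by move=> i; apply: sumr_ge0 => j _; exact: normc_ge0.
  - exact: leq_trans (leq_addr _ _) (hN N).
have cQ2 : Q N./2 @[N --> \oo] --> limn Q.
  apply: (cvg_comp half Q _ cQ).
  move=> A [k _ kA]; exists k.*2 => //= n kn; apply: kA => /=.
  by rewrite -[k]doubleK half_leq.
have cU : U @ \oo --> limn Q.
  by apply: (squeeze_cvgr _ cQ2 cQ); apply: nearW => N; rewrite QU UQ.
apply: (@squeeze_cvgr _ _ _ _ (cst 0) (fun N => (Q N -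
    U N) + normc (\sum_(p < N) \sum_(q < N) t p q - s))).
- apply: nearW => N; rewrite normc_ge0 /=.
  rewrite triangle_sumE; set T := (\sum_(p < N) \sum_(q < N - p) _ : C);
      set S := (\sum_(p < N) \sum_(q < N) _ : C).
  have -> : T - s = (T - S) + (S - s) by ring.
  apply: le_trans (le_normcD _ _) _; rewrite lerD2r -opprB normcN /S /T -sumrB.
  have -> : Q N - U N = \sum_(p < N) \sum_(N - p <= q < N) normc (t p q).
    rewrite /Q /U -sumrB; apply: eq_bigr => p _.
    rewrite -!(big_mkord xpredT (fun q => normc (t p q))) (big_cat_nat (leq0n (N -
        p)) (leq_subr _ _)) //=.
    by rewrite addrAC subrr add0r.
  apply: le_trans (normc_sum _ _ _) _; apply: ler_sum => p _.
  rewrite -!(big_mkord xpredT (fun q => t p q)) (big_cat_nat (leq0n (N - p)) (leq_subr _ _)) //=.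
  by rewrite addrAC subrr add0r; exact: normc_sum.
- exact: cvg_cst.
- rewrite -[X in _ --> X](addr0 0); apply: cvgD; last exact: tS.
  by rewrite -[X in _ --> X](subrr (limn Q)); apply: cvgB.
Qed.

End double_series.

(** * Complex numbers as vectors of the plane *)

Section measurable_complex.
Context {R : realType}.
Local Notation RR := (measurableTypeR R).

Definition to_complex (v : RR * RR) : R[i] := v.1 +i* v.2.
Definition of_complex (z : R[i]) : RR * RR := (complex.Re z, complex.Im z).

Lemma to_complexK : cancel to_complex of_complex. Proof. by case. Qed.
Lemma of_complex_inj : injective of_complex. Proof. by move=> [a b] [c d] [-> ->]. Qed.

Context d (T : measurableType d).
Implicit Types f g : T -> R[i].

Lemma measurable_of_complexD f g :
  measurable_fun setT (of_complex \o f) -> measurable_fun setT (of_complex \o g) ->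
  measurable_fun setT (fun w => of_complex (f w + g w)).
Proof.
move=> mf mg.
have mf1 := measurableT_comp (@measurable_fst _ _ RR RR) mf.
have mf2 := measurableT_comp (@measurable_snd _ _ RR RR) mf.
have mg1 := measurableT_comp (@measurable_fst _ _ RR RR) mg.
have mg2 := measurableT_comp (@measurable_snd _ _ RR RR) mg.
have := measurable_fun_pair (measurable_funD mf1 mg1) (measurable_funD mf2 mg2).
by congr measurable_fun; apply/funext => w /=; case: (f w) (g w) => ? ? [].
Qed.

Lemma measurable_of_complexM f g :
  measurable_fun setT (of_complex \o f) -> measurable_fun setT (of_complex \o g) ->
  measurable_fun setT (fun w => of_complex (f w * g w)).
Proof.
move=> mf mg.
have mf1 := measurableT_comp (@measurable_fst _ _ RR RR) mf.
have mf2 := measurableT_comp (@measurable_snd _ _ RR RR) mf.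
have mg1 := measurableT_comp (@measurable_fst _ _ RR RR) mg.
have mg2 := measurableT_comp (@measurable_snd _ _ RR RR) mg.
have := measurable_fun_pair
  (measurable_funB (measurable_funM mf1 mg1) (measurable_funM mf2 mg2))
  (measurable_funD (measurable_funM mf1 mg2) (measurable_funM mf2 mg1)).
by congr measurable_fun; apply/funext => w /=; case: (f w) (g w) => ? ? [].
Qed.

Lemma measurable_of_complex_prod (I : Type) (r : seq I) (Q : pred I) (f : I -> T -> R[i]) :
  (forall i, Q i -> measurable_fun setT (of_complex \o f i)) ->
  measurable_fun setT (fun w => of_complex (\prod_(i <- r | Q i) f i w)).
Proof.
move=> mf; elim: r => [|i r IH].
  by under eq_fun do rewrite big_nil; exact: measurable_cst.
have [Qi|/negbTE nQi] := boolP (Q i).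
  under eq_fun do rewrite big_cons Qi.
  by apply: measurable_of_complexM => //; exact: mf.
by under eq_fun do rewrite big_cons nQi.
Qed.

Lemma measurable_origin : measurable [set ((0, 0) : RR * RR)].
Proof.
have -> : [set ((0, 0) : RR * RR)] = [set (0 : RR)] `*` [set (0 : RR)].
  by apply/seteqP; split => [_ -> //|[x y] /= [-> ->]].
by apply: measurableX; exact: measurable_set1.
Qed.

End measurable_complex.

(** * Complex Hermite polynomials *)

Section hermite.
Context {R : realType}.
Local Notation C := R[i].
Local Notation normc := (@Normc.normc R).
Variable J : nat -> nat -> C -> C.
Hypothesis hJ : complex_hermite J.

Let a p q z : C := J p q z / (p`! * q`!)%N%:R.
(** The part of the generating function that is homogeneous of degree [n] in [l]. *)
Let c n z l : C := \sum_(p < n.+1) a p (n - p) z * (conjc l ^+ p * l ^+ (n - p)).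

Let ReD (x y : C) : complex.Re (x + y) = complex.Re x + complex.Re y.
Proof. by case: x; case: y. Qed.

Let ImD (x y : C) : complex.Im (x + y) = complex.Im x + complex.Im y.
Proof. by case: x; case: y. Qed.

Let cjM (x y : C) : conjc (x * y) = conjc x * conjc y. Proof. exact: rmorphM. Qed.
Let cjD (x y : C) : conjc (x + y) = conjc x + conjc y. Proof. exact: rmorphD. Qed.
Let cjB (x y : C) : conjc (x - y) = conjc x - conjc y. Proof. exact: rmorphB. Qed.
Let natC n : (n%:R : C) = (n%:R : R)%:C. Proof. by rewrite rmorph_nat. Qed.

Let homogeneous n z l (t : R) : c n z (t%:C * l) = (t ^+ n)%:C * c n z l.
Proof.
rewrite /c mulr_sumr; apply: eq_bigr => p _; rewrite cjM conjc_real !exprMn.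
have pn : (p <= n)%N by rewrite -ltnS.
have -> : (t ^+ n)%:C = t%:C ^+ p * t%:C ^+ (n - p) :> C by rewrite -exprD subnKC // rmorphXn.
ring.
Qed.

(** On the real multiples of [l] the double series, summed by homogeneous parts,
    is a power series in one real variable. *)
Let hermite_series z l :
  entire_series (fun n => complex.Re (c n z l))
    (fun t => expR (complex.Re (l * conjc z + conjc l * z) * t - 2 * normc l ^+ 2 * t ^+ 2)) /\
  entire_series (fun n => complex.Im (c n z l)) (fun=> 0).
Proof.
have arg t : complex.Re (t%:C * l * conjc z + conjc (t%:C * l) * z -
    2 * ((normc (t%:C * l)) ^+ 2)%:C) =
    complex.Re (l * conjc z + conjc l * z) * t - 2 * normc l ^+ 2 * t ^+ 2.
  have -> : normc (t%:C * l) ^+ 2 = t ^+ 2 * normc l ^+ 2.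
    rewrite Normc.normcM exprMn; congr (_ * _).
    by rewrite /= expr0n /= addr0 sqr_sqrtr // sqr_ge0.
  case: l => l1 l2; case: z => z1 z2 /=; set m := Num.sqrt _; ring.
have key t := double_series_triangle (hJ (t%:C * l) z).
have sumE t N : \sum_(n < N) \sum_(p < n.+1)
    conjc (t%:C * l) ^+ p * (t%:C * l) ^+ (n - p) / (p`! * (n - p)`!)%N%:R * J p (n - p)%N z =
    \sum_(n < N) (t ^+ n)%:C * c n z l.
  apply: eq_bigr => n _; rewrite -homogeneous; apply: eq_bigr => p _.
  by rewrite /a; ring.
have {}key t : normc (\sum_(n < N) (t ^+ n)%:C * c n z l -
    (expR (complex.Re (l * conjc z + conjc l * z) * t - 2 * normc l ^+ 2 * t ^+ 2))%:C)
    @[N --> \oo] --> (0 : R).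
  have := key t; rewrite arg; apply: cvg_trans; apply: near_eq_cvg.
  by apply: nearW => N; rewrite sumE.
split => t.
- set e := expR _.
  have h : pseries (fun n => complex.Re (c n z l)) t N - e @[N --> \oo] --> (0 : R).
    apply: (@norm_cvg0 _ R^o); apply: (squeeze_cvgr _ _ (key t)); last exact: cvg_cst.
    apply: nearW => N; rewrite normr_ge0 /=.
    apply: le_trans (normc_ge_absRe _); rewrite ReD (big_morph _ ReD (erefl _)).
    rewrite /pseries /series /= big_mkord.
    rewrite (_ : \sum_(i < N) _ = \sum_(i < N) complex.Re ((t ^+ i)%:C * c i z l)) //.
    by apply: eq_bigr => i _; case: (c i z l) => x y /=; ring.
  by move/cvg_sub0 : h => /(_ _ (cvg_cst e)).
- apply: (@norm_cvg0 _ R^o); apply: (squeeze_cvgr _ _ (key t)); last exact: cvg_cst.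
  apply: nearW => N; rewrite normr_ge0 /=.
  apply: le_trans (normc_ge_absIm _); rewrite ImD (big_morph _ ImD (erefl _)) /= oppr0 addr0.
  rewrite /pseries /series /= big_mkord.
  rewrite (_ : \sum_(i < N) _ = \sum_(i < N) complex.Im ((t ^+ i)%:C * c i z l)) //.
  by apply: eq_bigr => i _; case: (c i z l) => x y /=; ring.
Qed.

Let c_rec z l : [/\ c 0 z l = 1, c 1 z l = l * conjc z + conjc l * z &
  forall n, n.+2%:R * c n.+2 z l = (l * conjc z + conjc l * z) * c n.+1 z l
     - 4 * (l * conjc l) * c n z l].
Proof.
have [hr hi] := hermite_series z l.
have im0 := entire_series_eq0 hi.
have cE n : c n z l = (complex.Re (c n z l))%:C.
  by have := im0 n; case: (c n z l) => x y /= ->.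
have [c0 c1 cn] := entire_series_exp_quadratic hr.
have aE : l * conjc z + conjc l * z = (complex.Re (l * conjc z + conjc l * z))%:C.
  by case: l {hr hi im0 cE c0 c1 cn} => l1 l2; case: z => z1 z2; apply/eqP; rewrite eq_complex /=;
      apply/andP; split; apply/eqP; ring.
have bE : l * conjc l = (normc l ^+ 2)%:C.
  case: l {hr hi im0 cE c0 c1 cn aE} => l1 l2; apply/eqP;
      rewrite eq_complex /= sqr_sqrtr ?addr_ge0 ?sqr_ge0 //.
  by apply/andP; split; apply/eqP; ring.
split; first by rewrite cE c0.
  by rewrite cE c1 -aE.
move=> n; rewrite cE (cE n.+1) (cE n) aE bE.
rewrite (natC 4) (natC n.+2).
rewrite -!rmorphM -rmorphB /= cn; congr (_%:C); ring.
Qed.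

Let P n z : {poly C} := \poly_(q < n.+1) a (n - q) q z.

(** The homogeneous part [c n z l] is [conjc l ^+ n] times a polynomial in the
    ratio [l / conjc l]. As this ratio takes infinitely many values, identities
    between the [c n z l] are identities between coefficients
    ([poly_eq_on_ratio]). *)
Let cP n z l : conjc l != 0 -> c n z l = conjc l ^+ n * (P n z).[l / conjc l].
Proof.
move=> l0; rewrite horner_poly mulr_sumr /c (reindex_inj rev_ord_inj) /=.
apply: eq_bigr => q _; have qn : (q <= n)%N by rewrite -ltnS.
rewrite subSS subKn // exprMn exprVn.
have -> : conjc l ^+ n = conjc l ^+ (n - q) * conjc l ^+ q by rewrite -exprD subnK.
have : conjc l ^+ q != 0 by rewrite expf_neq0.
by move: (conjc l ^+ q) (conjc l ^+ (n - q)) => e e' e0; field.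
Qed.

Let poly_eq_on_ratio (p q : {poly C}) :
  (forall l : C, conjc l != 0 -> p.[l / conjc l] = q.[l / conjc l]) -> p = q.
Proof.
move=> h; apply/eqP; rewrite -subr_eq0; apply/eqP.
pose l (k : nat) : C := 1 +i* k%:R.
have l0 k : conjc (l k) != 0 by rewrite eq_complex /= oner_eq0.
pose rs := [seq l k / conjc (l k) | k <- iota 0 (size (p - q))].
apply: (@roots_geq_poly_eq0 _ _ rs).
- by apply/allP => _ /mapP[k _ ->]; rewrite rootE !hornerE h // subrr.
- rewrite map_inj_uniq ?iota_uniq // => i j /eqP.
  rewrite eqr_div // /l => /eqP [] /= _ /eqP.
  rewrite !mul1r !mulr1 -subr_eq0 => /eqP e.
  apply/eqP; rewrite -(eqr_nat R) -subr_eq0; apply/eqP; lra.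
- by rewrite size_map size_iota.
Qed.

Let P_rec z : [/\ P 0 z = 1, P 1 z = (conjc z)%:P * 'X + z%:P &
  forall n, n.+2%:R%:P * P n.+2 z =
    (conjc z)%:P * ('X * P n.+1 z) + z%:P * P n.+1 z - 4%:P * ('X * P n z)].
Proof.
split; [| |move=> n]; apply: poly_eq_on_ratio => l l0; have [c0 c1 cn] := c_rec z l.
- by move: c0; rewrite cP // expr0 mul1r hornerE.
- move: c1; rewrite cP // expr1 hornerD hornerM !hornerC hornerX => /(congr1 (fun x =>
      (conjc l)^-1 * x)).
  by rewrite mulKf // => ->; field.
- have := cn n; rewrite !cP // hornerD hornerN hornerD !hornerM !hornerC hornerX =>
      /(congr1 (fun x => (conjc l ^+ n.+2)^-1 * x)).
  rewrite !exprS; have ln : conjc l ^+ n != 0 by rewrite expf_neq0.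
  move: (conjc l ^+ n) ln (P n z).[_] (P n.+1 z).[_] (P n.+2 z).[_] => e e0 x y w h.
  have -> : n.+2%:R * w = (conjc l * (conjc l * e))^-1 * (n.+2%:R * (conjc l * (conjc l * e) * w)).
    by field; rewrite ?e0 ?l0.
  by rewrite h; field; rewrite ?e0 ?l0.
Qed.

Let a00 z : a 0 0 z = 1.
Proof.
have [+ _ _] := P_rec z => /(congr1 (fun p : {poly C} => p`_0)).
by rewrite coef_poly /= coef1.
Qed.

(** The coefficient of degree [q] in [P_rec]; all the properties of the Hermite
    polynomials below are proved by induction on [p + q] from it. *)
Let a_rec p q z : (0 < p + q)%N -> (p + q)%:R * a p q z =
  conjc z * (if q is q'.+1 then a p q' z else 0) +
  z * (if p is p'.+1 then a p' q z else 0) -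
  4 * (if p is p'.+1 then if q is q'.+1 then a p' q' z else 0 else 0).
Proof.
have [_ P1 Pn] := P_rec z.
case E : (p + q)%N => [//|[|n]] _.
  have := congr1 (fun p : {poly C} => p`_q) P1.
  rewrite coef_poly -E ltnS leq_addl addnK coefD coefCM coefX coefC.
  move: p q E => [|[|p]] [|[|q]] //= _ ->; rewrite ?a00; ring.
have := congr1 (fun p : {poly C} => p`_q) (Pn n).
have qn : (q < n.+3)%N by rewrite ltnS -E leq_addl.
have pE : (n.+2 - q)%N = p by rewrite -E addnK.
rewrite coefCM coef_poly qn pE coefB coefD !coefCM !coefXM !coef_poly => ->.
case: q E qn pE => [|q] E qn pE /=.
  rewrite addn0 in E; rewrite E /= subn0; ring.
have -> : (q < n.+2)%N by rewrite -ltnS.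
have -> : (n.+1 - q)%N = p by rewrite -pE.
case: p E pE => [|p] E pE /=.
  have -> : q = n.+1 by rewrite add0n in E; case: E.
  by rewrite !ltnn; ring.
have qn1 : (q < n.+1)%N by move/eqP: E; rewrite addSn addnS !eqSS => /eqP <-; rewrite ltnS leq_addl.
rewrite ltnS qn1; have e1 : (n - q)%N = p by move/eqP: E; rewrite addSn addnS !eqSS => /eqP <-;
    rewrite addnK.
by rewrite subSS e1 !mulrA.
Qed.

Let a_conj p q z : a q p z = conjc (a p q z).
Proof.
have [n] := ubnP (p + q); elim: n p q => // n IH p q.
case: (posnP (p + q)) => [|pq].
  by move=> /eqP; rewrite addn_eq0 => /andP[/eqP -> /eqP ->] _; rewrite a00 conjc1.
move=> lt; have n0 : (p + q)%:R != 0 :> C by rewrite pnatr_eq0 -lt0n.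
apply: (mulfI n0); have -> : (p + q)%:R = conjc (p + q)%:R :> C by rewrite conjc_nat.
rewrite -cjM a_rec // conjc_nat [in LHS]addnC a_rec 1?addnC //.
rewrite cjB cjD !cjM conjcK conjc_nat.
congr (_ - _); last first.
  case: p q pq lt n0 => [|p] [|q] _ lt _; rewrite ?conjc0 //.
  rewrite -IH // -ltnS (leq_trans _ lt) // addSn addnS; exact: leqnSn.
rewrite addrC; congr (_ + _).
  case: q pq lt n0 => [|q] _ lt _; rewrite ?conjc0 //; rewrite -IH //.
  by rewrite -ltnS (leq_trans _ lt) // addnS.
case: p pq lt n0 => [|p] _ lt _; rewrite ?conjc0 //; rewrite -IH //.
Qed.

Let a_rot p q z u : u * conjc u = 1 -> a p q (u * z) = u ^+ p * conjc u ^+ q * a p q z.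
Proof.
move=> u1; have [n] := ubnP (p + q); elim: n p q => // n IH p q.
case: (posnP (p + q)) => [|pq].
  by move=> /eqP; rewrite addn_eq0 => /andP[/eqP -> /eqP ->] _; rewrite !a00 !expr0 !mulr1.
move=> lt; have n0 : (p + q)%:R != 0 :> C by rewrite pnatr_eq0 -lt0n.
apply: (mulfI n0); rewrite [RHS]mulrCA !a_rec // cjM.
rewrite mulrBr mulrDr; congr (_ + _ - _).
- case: q pq lt n0 => [|q] _ lt _; first by rewrite !mulr0.
  by rewrite IH ?exprS; [ring|rewrite -ltnS (leq_trans _ lt) // addnS].
- case: p pq lt n0 => [|p] _ lt _; first by rewrite !mulr0.
  by rewrite IH ?exprS; [ring|].
- case: p q pq lt n0 => [|p] [|q] _ lt _; rewrite ?mulr0 //.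
  rewrite IH; last by rewrite -ltnS (leq_trans _ lt) // addSn addnS; exact: leqnSn.
  have -> : u ^+ p.+1 * conjc u ^+ q.+1 = u ^+ p * conjc u ^+ q by rewrite !exprS mulrACA u1 mul1r.
  ring.
Qed.

(** The leading coefficient is stated to keep track of the exact degree: by the
    recurrence it is [(q + p) / ((p + q) p! q!)]. *)
Let a_poly p q : exists A : {poly R}, [/\ (size A <= (p + q).+1)%N, A`_(p + q) =
    ((p`! * q`!)%N%:R)^-1 &
  forall x : R, a p q x%:C = (A.[x])%:C].
Proof.
have [n] := ubnP (p + q); elim: n p q => // n IH p q.
case: (posnP (p + q)) => [|pq].
  move=> /eqP; rewrite addn_eq0 => /andP[/eqP -> /eqP ->] _; exists 1.
  split; [by rewrite size_poly1|by rewrite coef1 /= fact0 invr1|].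
  by move=> x; rewrite a00 hornerE.
move=> lt; have n0 : (p + q)%:R != 0 :> R by rewrite pnatr_eq0 -lt0n.
have n0C : (p + q)%:R != 0 :> C by rewrite pnatr_eq0 -lt0n.
have [A1 [s1 l1 h1]] : exists A : {poly R}, [/\ (size A <= p + q)%N,
    A`_(p + q).-1 = q%:R * ((p`! * q`!)%N%:R)^-1 &
    forall x : R, (if q is q'.+1 then a p q' x%:C else 0) = (A.[x])%:C].
  case: q pq lt {n0 n0C} => [|q] _ lt.
    by exists 0; split; rewrite ?size_poly0 ?coef0 ?mul0r // => x; rewrite hornerE.
  have [|A [s l h]] := IH p q; first by rewrite -ltnS (leq_trans _ lt) // addnS.
  exists A; split => //; first by rewrite addnS.
  rewrite addnS /= l [in RHS]factS [in RHS]mulnCA [in RHS]natrM invfM mulVKf // pnatr_eq0 //.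
have [A2 [s2 l2 h2]] : exists A : {poly R}, [/\ (size A <= p + q)%N,
    A`_(p + q).-1 = p%:R * ((p`! * q`!)%N%:R)^-1 &
    forall x : R, (if p is p'.+1 then a p' q x%:C else 0) = (A.[x])%:C].
  case: p pq lt {n0 n0C A1 s1 l1 h1} => [|p] _ lt.
    by exists 0; split; rewrite ?size_poly0 ?coef0 ?mul0r // => x; rewrite hornerE.
  have [|A [s l h]] := IH p q; first by [].
  exists A; split => //; rewrite addSn /= l [in RHS]factS -[in RHS]mulnA [in RHS]natrM invfM
      mulVKf // pnatr_eq0 //.
have [A3 [s3 h3]] : exists A : {poly R}, (size A <= (p + q).-1)%N /\
    forall x : R, (if p is p'.+1 then if q is q'.+1 then a p' q' x%:C else 0 else 0) = (A.[x])%:C.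
  case: p pq lt {n0 n0C A1 s1 l1 h1 A2 s2 l2 h2} => [|p] _ lt; first by exists 0;
      rewrite size_poly0; split => // x; rewrite hornerE.
  case: q lt => [|q] lt; first by exists 0; rewrite size_poly0; split => // x; rewrite hornerE.
  have [|A [s l h]] := IH p q; first by rewrite -ltnS (leq_trans _ lt) // addSn addnS;
      exact: leqnSn.
  by exists A; split => //; rewrite addSn addnS.
exists ((p + q)%:R^-1 *: ('X * A1 + 'X * A2 - 4 *: A3)); split.
- apply: leq_trans (size_scale_leq _ _) _.
  have sX (A : {poly R}) : (size A <= p + q)%N -> (size ('X * A)%R <= (p + q).+1)%N.
    move=> sA; have [->|A0] := eqVneq A 0; first by rewrite mulr0 size_poly0.
    by rewrite mulrC size_mulX.
  apply: leq_trans (size_polyD _ _) _; rewrite geq_max; apply/andP; split.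
    by apply: leq_trans (size_polyD _ _) _; rewrite geq_max !sX.
  rewrite size_polyN; apply: leq_trans (size_scale_leq _ _) _; apply: leq_trans s3 _.
  by rewrite (leq_trans (leq_pred _)).
- rewrite coefZ coefB coefD !coefXM coefZ.
  have -> : ((p + q)%N == 0%N) = false by apply/negbTE; rewrite -lt0n.
  rewrite l1 l2 (nth_default _ (leq_trans s3 (leq_pred _))) mulr0 subr0 -mulrDl -natrD addnC.
  by rewrite mulKf // addnC.
- move=> x; apply: (mulfI n0C); rewrite a_rec // conjc_real h1 h2 h3.
  rewrite (natC 4) (natC (p + q)).
  rewrite -!rmorphM -rmorphD -rmorphB /=; congr (_%:C).
  by rewrite hornerZ mulVKf // !hornerE.
Qed.

Let a_measurable p q : measurable_fun setT (fun v => of_complex (a p q (to_complex v))).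
Proof.
have mz : measurable_fun setT (of_complex \o @to_complex R).
  by rewrite (_ : _ \o _ = id) //; apply/funext => v; exact: to_complexK.
have mzc : measurable_fun setT (of_complex \o (fun v => conjc (@to_complex R v))).
  apply: measurable_fun_pair; first exact: measurable_fst.
  by apply: measurableT_comp (@measurable_snd _ _ _ _); exact: oppr_measurable.
have [n] := ubnP (p + q); elim: n p q => // n IH p q.
case: (posnP (p + q)) => [|pq].
  move=> /eqP; rewrite addn_eq0 => /andP[/eqP -> /eqP ->] _.
  by under eq_fun do rewrite a00; exact: measurable_cst.
move=> lt; have n0C : (p + q)%:R != 0 :> C by rewrite pnatr_eq0 -lt0n.
have E v : a p q (to_complex v) = ((p + q)%:R)^-1 * (
    conjc (to_complex v) * (if q is q'.+1 then a p q' (to_complex v) else 0) +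
    to_complex v * (if p is p'.+1 then a p' q (to_complex v) else 0) +
    (- 4) * (if p is p'.+1 then if q is q'.+1 then a p' q' (to_complex v) else 0 else 0)).
  by apply: (mulfI n0C); rewrite a_rec // mulVKf // mulNr.
under eq_fun do rewrite E.
apply: measurable_of_complexM; first exact: measurable_cst.
apply: measurable_of_complexD; first apply: measurable_of_complexD;
  apply: measurable_of_complexM => //; try exact: measurable_cst.
- case: q pq lt n0C {E} => [|q] _ lt _; first exact: measurable_cst.
  by apply: IH; rewrite -ltnS (leq_trans _ lt) // addnS.
- case: p pq lt n0C {E} => [|p] _ lt _; first exact: measurable_cst.
  exact: IH.
- case: p q pq lt n0C {E} => [|p] [|q] _ lt _; try exact: measurable_cst.
  by apply: IH; rewrite -ltnS (leq_trans _ lt) // addSn addnS; exact: leqnSn.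
Qed.

Let JE p q z : J p q z = (p`! * q`!)%N%:R * a p q z.
Proof. by rewrite /a mulrC divfK. Qed.

Lemma hermite_diag_real p z : complex.Im (J p p z) = 0.
Proof.
have : conjc (J p p z) = J p p z by rewrite JE cjM conjc_nat -a_conj.
by case: (J p p z) => x y [] /eqP; rewrite eq_sym -addr_eq0 -mulr2n mulrn_eq0 /= => /eqP.
Qed.

Lemma hermite_rot p q z u : u * conjc u = 1 -> J p q (u * z) = u ^+ p * conjc u ^+ q * J p q z.
Proof. by move=> u1; rewrite !JE a_rot // mulrCA. Qed.

Lemma hermite_real_poly p q : exists A : {poly R}, size A = (p + q).+1 /\
  forall x : R, J p q x%:C = (A.[x])%:C.
Proof.
have [A [s l h]] := a_poly p q.
have f0 : (p`! * q`!)%N%:R != 0 :> R by rewrite pnatr_eq0 -lt0n muln_gt0 !fact_gt0.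
exists ((p`! * q`!)%N%:R *: A); split.
  rewrite size_scale //; apply/eqP; rewrite eqn_leq s /= ltnNge; apply/negP => s'.
  by move/eqP: l; rewrite nth_default // eq_sym invr_eq0 (negbTE f0).
by move=> x; rewrite JE h hornerZ natC -rmorphM.
Qed.

Lemma hermite_measurable p q : measurable_fun setT (fun v => of_complex (J p q (to_complex v))).
Proof.
under eq_fun do rewrite JE.
by apply: measurable_of_complexM; [exact: measurable_cst|exact: a_measurable].
Qed.

End hermite.

(** * Gaussian variables and isonormal processes *)

Section gaussian.
Context {R : realType} d (Omega : measurableType d) (P : probability Omega R).
Local Notation RR := (measurableTypeR R).

Lemma Rintegral_distribution (S : {RV P >-> RR}) (f : RR -> R) : measurable_fun setT f ->
  P.-integrable setT (EFin \o (f \o S)) ->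
  \int[distribution P S]_x f x = \int[P]_w f (S w).
Proof.
move=> mf intf; rewrite /Rintegral; congr fine; rewrite integral_distribution //.
exact/measurable_EFinP.
Qed.

Lemma integrable_sqr (S : Omega -> R) (v : R) : measurable_fun setT S ->
  ('E_P[fun w => (S w ^+ 2)%R] = v%:E)%E -> P.-integrable setT (EFin \o (fun w => S w ^+ 2)).
Proof.
move=> mS; rewrite unlock => h; apply/integrableP; split.
  by apply/measurable_EFinP; exact: measurable_funX.
rewrite (eq_integral (fun w => (S w ^+ 2)%:E)) ?h ?ltry // => w _ /=.
by rewrite ger0_norm // sqr_ge0.
Qed.

Lemma integrable_of_sqr (S : Omega -> R) : measurable_fun setT S ->
  P.-integrable setT (EFin \o (fun w => S w ^+ 2)) -> P.-integrable setT (EFin \o S).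
Proof.
move=> mS i2; apply: (@le_integrable _ _ _ P _ _ _ (fun w => (1 + S w ^+ 2)%:E)) => //.
- exact/measurable_EFinP.
- move=> w _; rewrite /= lee_fin [leRHS]ger0_norm ?ler_norm1D_sq //.
  by rewrite addr_ge0 // sqr_ge0.
- under eq_fun do rewrite EFinD; apply: integrableD => //.
  exact: finite_measure_integrable_cst.
Qed.

(** The mean and the second moment identify the parameters of the normal law, or
    the location of the Dirac mass. *)
Lemma gaussian_cos (S : {RV P >-> R}) (v t c : R) :
  gaussian_law (pushforward P S) -> ('E_P[S] = 0)%E -> ('E_P[fun w => (S w ^+ 2)%R] = v%:E)%E ->
  \int[P]_w cos (t * S w + c) = expR (- (v * t ^+ 2 / 2)) * cos c.
Proof.
move=> gS ES ES2.
have mS : measurable_fun setT S by [].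
have i2 := integrable_sqr mS ES2.
have i1 := integrable_of_sqr mS i2.
have m1 : \int[P]_w S w = 0 by move: ES; rewrite unlock /Rintegral => ->.
have m2 : \int[P]_w S w ^+ 2 = v by move: ES2; rewrite unlock /Rintegral => ->.
have mSR : measurable_fun setT (S : Omega -> RR) by exact: mS.
pose SR : {RV P >-> RR} := @mfun_Sub _ _ Omega RR S (mem_set mSR).
have mcos : measurable_fun setT (fun x : RR => cos (t * x + c)).
  by apply: measurable_cosD => //; exact: measurable_funM.
have icos : P.-integrable setT (EFin \o ((fun x : RR => cos (t * x + c)) \o S)).
  apply: (@bounded_integrable _ _ _ _ _ 1); first exact: measurableT_comp.
  by move=> x; rewrite ler_norml cos_geN1 cos_le1.
have msqr : measurable_fun setT (fun x : RR => x ^+ 2) by exact: measurable_funX.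
have mid : measurable_fun setT (fun x : RR => x : R) by exact: measurable_id.
rewrite -(@Rintegral_distribution SR (fun x => cos (t * x + c))) //.
rewrite -(@Rintegral_distribution SR (fun x => x)) // in m1.
rewrite -(@Rintegral_distribution SR (fun x => x ^+ 2)) // in m2.
case: gS => m [[s s0 law]|law].
- have sn0 : s != 0 by rewrite gt_eqF.
  have EQ (A : set RR) : measurable A -> A `<=` setT -> distribution P SR A = normal_prob m s A.
    by move=> mA _; exact: law.
  have E (f : RR -> R) : \int[distribution P SR]_x f x = \int[normal_prob m s]_x f x.
    by rewrite /Rintegral; congr fine; exact: (@eq_measure_integral _ _ _ setT (normal_prob m s)
        (distribution P SR)).
  have I (f : RR -> R) : measurable_fun setT f -> P.-integrable setT (EFin \o (f \o S)) ->
      (normal_prob m s).-integrable setT (EFin \o f).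
    move=> mf /integrableP[_ h]; apply/integrableP; split; first exact/measurable_EFinP.
    rewrite -(@eq_measure_integral _ _ _ setT (normal_prob m s) (distribution P SR)) //.
    rewrite ge0_integral_distribution //.
    by apply: measurableT_comp => //; exact/measurable_EFinP.
  have m0 : m = 0.
    by rewrite -[LHS](normal_prob_mean sn0) -?E //; exact: I.
  subst m; rewrite E normal_prob_cos //.
  by rewrite -m2 E normal_prob_sqr //; exact: I.
- have E (f : RR -> R) : measurable_fun setT f -> \int[distribution P SR]_x f x = f m.
    move=> mf; rewrite /Rintegral (@eq_measure_integral _ _ _ setT (\d_(m : RR)) (distribution P
        SR)); last first.
      by move=> A mA _; exact: law.
    by rewrite integral_dirac ?diracT ?mul1e //; exact/measurable_EFinP.
  have m0 : m = 0 by rewrite -m1 E.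
  have v0 : v = 0 by rewrite -m2 E // m0 expr0n.
  by rewrite E // m0 v0 mul0r mul0r oppr0 expR0 mul1r mulr0 add0r.
Qed.

Lemma RintegralDZ (k : R) (f g : Omega -> R) : P.-integrable setT (EFin \o f) ->
  P.-integrable setT (EFin \o g) ->
  P.-integrable setT (EFin \o (fun w => k * f w + g w)) /\
  \int[P]_w (k * f w + g w) = k * \int[P]_w f w + \int[P]_w g w.
Proof.
move=> jf jg.
have jkf : P.-integrable setT (EFin \o (fun w => k * f w)).
  by under [X in integrable _ _ X]eq_fun do rewrite EFinM; exact: integrableZl.
split; last by rewrite RintegralD // RintegralZl.
by under [X in integrable _ _ X]eq_fun do rewrite EFinD; exact: integrableD.
Qed.

Context (H : completeNormedModType R) (dot : {dot H for idfun}).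

Lemma dot_linl a u v w : dot (a *: u + v) w = a * dot u w + dot v w.
Proof. by rewrite linearDl linearZl_LR. Qed.

Lemma dot_linr a u v w : dot w (a *: u + v) = a * dot w u + dot w v.
Proof. by rewrite linearDr linearZr_LR. Qed.

Lemma isonormal_prod (X : H -> {RV P >-> R}) h g : isonormal dot X ->
  P.-integrable setT (EFin \o (fun w => X h w * X g w)) /\
  \int[P]_w (X h w * X g w) = dot h g.
Proof.
move=> [_ _ cov]; split; last by have := cov h g; rewrite unlock /Rintegral => ->.
have i2 k : P.-integrable setT (EFin \o (fun w => X k w ^+ 2)).
  by apply: (@integrable_sqr _ (dot k k)) => //; rewrite -cov; congr expectation.
apply: (@le_integrable _ _ _ P _ _ _ (fun w => (1 * X h w ^+ 2 + X g w ^+ 2)%:E)) => //.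
- by apply/measurable_EFinP; exact: measurable_funM.
- move=> w _; rewrite /= lee_fin mul1r [leRHS]ger0_norm ?addr_ge0 ?sqr_ge0 //.
  by rewrite ler_norml; apply/andP; split; nra.
- exact: (RintegralDZ 1 (i2 h) (i2 g)).1.
Qed.

(** By the covariance, the second moment of the difference of both sides is the
    squared norm of a vector that vanishes. *)
Lemma isonormal_linear (X : H -> {RV P >-> R}) (a : R) h g : isonormal dot X ->
  {ae P, forall w, X (a *: h + g) w = a * X h w + X g w}.
Proof.
move=> iX; set u := a *: h + g.
have [iuu Euu] := isonormal_prod u u iX; have [ihh Ehh] := isonormal_prod h h iX.
have [igg Egg] := isonormal_prod g g iX; have [iuh Euh] := isonormal_prod u h iX.
have [iug Eug] := isonormal_prod u g iX; have [ihg Ehg] := isonormal_prod h g iX.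
have [j1 e1] := RintegralDZ (2 * a) ihg iuu.
have [j2 e2] := RintegralDZ (a ^+ 2) ihh j1.
have [j3 e3] := RintegralDZ 1 igg j2.
have [j4 e4] := RintegralDZ (- 2 * a) iuh j3.
have [j5 e5] := RintegralDZ (- 2) iug j4.
pose D w := (X u w - (a * X h w + X g w)) ^+ 2.
have DE : D = (fun w => - 2 * (X u w * X g w) + (- 2 * a * (X u w * X h w) + (1 * (X g w * X g w) +
   (a ^+ 2 * (X h w * X h w) + (2 * a * (X h w * X g w) + X u w * X u w))))).
  by apply/funext => w; rewrite /D; ring.
have D0 : \int[P]_w D w = 0.
  rewrite DE e5 e4 e3 e2 e1 Euu Ehh Egg Euh Eug Ehg /u.
  rewrite !(dot_linl, dot_linr).
  have -> : dot g h = dot h g by rewrite hermC expr0 mul1r.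
  ring.
have mD : measurable_fun setT D.
  by rewrite DE; apply/measurable_EFinP; exact: measurable_int j5.
have : (\int[P]_w (D w)%:E = 0)%E.
  rewrite -[LHS]fineK; first by rewrite -[fine _]/(\int[P]_w D w) D0.
  by apply: integrable_fin_num => //; rewrite DE.
have mD' : measurable_fun setT (EFin \o D) by exact/measurable_EFinP.
have D_ge0 w : (0 <= (EFin \o D) w)%E by rewrite lee_fin sqr_ge0.
move=> /(ge0_integral_eq0P P mD' D_ge0).1; apply: filterS => w /= [] /eqP.
by rewrite sqrf_eq0 subr_eq0 => /eqP.
Qed.

Lemma isonormal_cos (X : H -> {RV P >-> R}) h t c : isonormal dot X ->
  \int[P]_w cos (t * X h w + c) = expR (- (dot h h * t ^+ 2 / 2)) * cos c.
Proof.
move=> [gX EX cov]; apply: gaussian_cos.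
- have := gX 1%N (fun=> h) (fun=> 1); congr (gaussian_law (pushforward P _)).
  by apply/funext => w; rewrite big_ord1 mul1r.
- exact: EX.
- by rewrite -cov; congr expectation.
Qed.

(** The joint law is a product, and Fubini integrates over one variable after the
    other. *)
Lemma independent_cos (X Y : H -> {RV P >-> R}) h g c : isonormal dot X -> isonormal dot Y ->
  independent_processes X Y ->
  \int[P]_w cos (X h w - Y g w + c) = expR (- ((dot h h + dot g g) / 2)) * cos c.
Proof.
move=> iX iY ind.
have mXh : measurable_fun setT (X h : Omega -> RR) by exact: (measurable_funPT (X h)).
have mYg : measurable_fun setT (Y g : Omega -> RR) by exact: (measurable_funPT (Y g)).
pose XR : {RV P >-> RR} := @mfun_Sub _ _ Omega RR (X h) (mem_set mXh).
pose YR : {RV P >-> RR} := @mfun_Sub _ _ Omega RR (Y g) (mem_set mYg).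
pose mX : probability RR R := distribution P XR.
pose mY : probability RR R := distribution P YR.
have mXY : measurable_fun setT (fun w => (X h w, Y g w) : RR * RR).
  exact: measurable_fun_pair.
pose Z : {RV P >-> (RR * RR)%type} := @mfun_Sub _ _ Omega (RR * RR)%type _ (mem_set mXY).
have law A : measurable A -> (mX \x mY)%E A = distribution P Z A.
  apply: product_measure_unique => A1 A2 mA1 mA2.
  have := ind (X h @^-1` A1) (Y g @^-1` A2) _ _; apply.
    by apply: sub_sigma_algebra; exists h, A1.
  by apply: sub_sigma_algebra; exists g, A2.
pose f := fun x : RR * RR => cos (x.1 - x.2 + c).
have mf : measurable_fun setT f.
  apply: measurable_cosD => //; apply: measurable_funB.
    exact: measurable_fst.
  exact: measurable_snd.
have f1 x : `|f x| <= 1 by rewrite ler_norml cos_geN1 cos_le1.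
have mcos t e : measurable_fun setT (fun x : RR => cos (t * x + e)).
  by apply: measurable_cosD => //; exact: measurable_funM.
have law1 (U : {RV P >-> RR}) (v : R) :
    (forall t e, \int[P]_w cos (t * U w + e) = expR (- (v * t ^+ 2 / 2)) * cos e) ->
    forall t e, (\int[distribution P U]_x (cos (t * x + e))%:E =
        (expR (- (v * t ^+ 2 / 2)) * cos e)%:E)%E.
  move=> hU t e; have iU : P.-integrable setT ((EFin \o (fun x : RR => cos (t * x + e))) \o U).
    apply: (@bounded_integrable _ _ _ _ ((fun x : RR => cos (t * x + e)) \o U) 1).
      exact: measurableT_comp.
    by move=> x; rewrite ler_norml cos_geN1 cos_le1.
  rewrite integral_distribution //; last exact/measurable_EFinP.
  by rewrite -(hU t e) /Rintegral fineK //; exact: integrable_fin_num iU.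
have gX := law1 XR _ (fun t e => isonormal_cos h t e iX).
have gY := law1 YR _ (fun t e => isonormal_cos g t e iY).
have -> : \int[P]_w cos (X h w - Y g w + c) = \int[(mX \x mY)%E]_x f x.
  rewrite /Rintegral; congr fine.
  rewrite (@eq_measure_integral _ _ _ setT (distribution P Z) (mX \x mY)%E); last first.
    by move=> A mA _; exact: law.
  rewrite integral_distribution //; first exact/measurable_EFinP.
  apply: (@bounded_integrable _ _ _ _ (f \o Z) 1); first exact: measurableT_comp.
  by move=> x; exact: f1.
have i2 : (mX \x mY)%E.-integrable setT (EFin \o f) by exact: bounded_integrable f1.
rewrite /Rintegral -(integral12_prod_meas1 i2) /fubini_F /=.
under eq_integral => x _.
  under eq_integral => y _.
    have -> : f (x, y) = cos (-1 * y + (x + c)) by rewrite /f /=; congr cos; ring.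
    over.
  rewrite gY EFinM; over.
have mc : measurable_fun setT (fun x : RR => cos (x + c)).
  by have := mcos 1 c; under eq_fun do rewrite mul1r.
rewrite integralZl //; last first.
  by apply: (@bounded_integrable _ _ _ _ _ 1) => // x; rewrite ler_norml cos_geN1 cos_le1.
have := gX 1 c; rewrite (eq_integral (fun x : RR => (cos (x + c))%:E)); last by move=> x _;
    rewrite mul1r.
move=> ->; rewrite -EFinM /= mulrA -expRD; congr (expR _ * _).
by rewrite sqrrN !expr1n !mulr1; field.
Qed.

End gaussian.

(** * Null sets under Hermite polynomials of a Gaussian vector *)

Section hermite_null.
Context {R : realType} (J : nat -> nat -> R[i] -> R[i]) (J_hermite : complex_hermite J).
Local Notation RR := (measurableTypeR R).
Local Notation mu := (@lebesgue_measure R).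

Definition expi (t : R) : R[i] := cos t +i* sin t.

Lemma sqn_eq0 (v : RR * RR) : sqn v = 0 -> v = (0, 0).
Proof.
case: v => x y /eqP; rewrite /sqn /= paddr_eq0 ?sqr_ge0 // !sqrf_eq0.
by move=> /andP[/eqP -> /eqP ->].
Qed.

Lemma expiD s t : expi (s + t) = expi s * expi t.
Proof. by rewrite /expi cosD sinD; congr (_ +i* _); rewrite addrC. Qed.

Lemma expi0 : expi 0 = 1. Proof. by rewrite /expi cos0 sin0. Qed.

Lemma expiX t n : expi t ^+ n = expi (n%:R * t).
Proof.
elim: n => [|n IH]; first by rewrite mul0r expi0.
by rewrite exprS IH -expiD -nat1r mulrDl mul1r.
Qed.

Lemma expi_conj t : conjc (expi t) = expi (- t).
Proof. by rewrite /expi cosN sinN. Qed.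

Lemma expi_unit t : expi t * conjc (expi t) = 1.
Proof. by rewrite expi_conj -expiD subrr expi0. Qed.

Lemma to_complex_rot t v : to_complex (rot t v) = expi t * to_complex v.
Proof. by rewrite /to_complex /rot /expi /=; congr (_ +i* _); ring. Qed.

Lemma of_complex_expi t z : of_complex (expi t * z) = rot t (of_complex z).
Proof. by case: z => x y; rewrite /of_complex /rot /=; congr (_, _); ring. Qed.

Lemma sqn_of_complexM (c z : R[i]) : sqn (of_complex (c * z)) =
    sqn (of_complex c) * sqn (of_complex z).
Proof. by case: c z => a b [x y]; rewrite /sqn /=; ring. Qed.

Lemma to_complex_polar v : exists t, to_complex v = expi t * (Num.sqrt (sqn v))%:C.
Proof.
have [t vE] := polar v; exists t.
by rewrite {1}vE /to_complex /expi /=; congr (_ +i* _); ring.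
Qed.

Lemma gauss2_norm_root (q : {poly R}) : q != 0 ->
  gauss2 [set v | q.[Num.sqrt (sqn v)] = 0] = 0%E.
Proof.
move=> q0; have c := finite_set_countable (finite_roots q0).
have -> : [set v | q.[Num.sqrt (sqn v)] = 0] = [set v | [set x | root q x] (Num.sqrt (sqn v))].
  by apply/seteqP; split => v /= /eqP.
apply: gauss2_norm_null; last exact: countable_lebesgue_measure0.
by apply: countable_measurable => // x; exact: measurable_set1.
Qed.

(** By [hermite_rot] the modulus at [v] is the modulus at [|v|], where [J m n] is
    a real polynomial. *)
Lemma hermite_modulus m n : exists2 A : {poly R}, size A = (m + n).+1 &
  forall v, sqn (of_complex (J m n (to_complex v))) = A.[Num.sqrt (sqn v)] ^+ 2.
Proof.
have [A [sA JA]] := hermite_real_poly J_hermite m n; exists A => // v.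
have [t ->] := to_complex_polar v.
rewrite (hermite_rot J_hermite) ?expi_unit // expi_conj !expiX -expiD of_complex_expi sqn_rot JA.
by rewrite /sqn /= expr0n addr0.
Qed.

Lemma hermite_neq0 m n : gauss2 [set v | J m n (to_complex v) = 0] = 0%E.
Proof.
have [A sA JA] := hermite_modulus m n.
have A0 : A != 0 by rewrite -size_poly_eq0 sA.
rewrite -[RHS](gauss2_norm_root A0); congr (gauss2 _); apply/seteqP; split => v /= h.
  by apply/eqP; rewrite -sqrf_eq0 -JA h /sqn /= expr0n addr0.
by apply: of_complex_inj; apply: sqn_eq0; rewrite JA h expr0n.
Qed.

(** Rotating [v] by [t] rotates the value by [(m - n) t], and the square of its
    modulus is a polynomial of degree [2 (m + n) > 0] in [|v|]: this is an
    instance of [gauss2_equivariant_null]. *)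
Lemma hermite_null m n (c : R[i]) (A : set (RR * RR)) : m != n -> c != 0 ->
  measurable A -> gauss2 A = 0%E ->
  gauss2 [set v | A (of_complex (c * J m n (to_complex v)))] = 0%E.
Proof.
move=> mn c0 mA A0; have [B sB JB] := hermite_modulus m n.
have B0 : B != 0 by rewrite -size_poly_eq0 sB.
have sc : sqn (of_complex c) != 0.
  by apply: contra c0 => /eqP/sqn_eq0 h; apply/eqP/of_complex_inj; exact: h.
have mn0 : (0 < m + n)%N.
  by rewrite lt0n addn_eq0; apply: contra mn => /andP[/eqP-> /eqP->].
apply: (@gauss2_equivariant_null R (fun v => of_complex (c * J m n (to_complex v))) (m%:R - n%:R)
  (sqn (of_complex c) *: B ^+ 2)) => //.
- apply: measurable_of_complexM; first exact: measurable_cst.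
  exact: hermite_measurable J_hermite _ _.
- by rewrite subr_eq0 eqr_nat.
- move=> t v; rewrite to_complex_rot (hermite_rot J_hermite) ?expi_unit // expi_conj !expiX -expiD.
  by rewrite mulrCA of_complex_expi mulrN -mulNr -mulrDl.
- by move=> v; rewrite sqn_of_complexM JB hornerZ horner_exp.
- by rewrite size_scale // expr2 size_mul // sB addSn addnS /= ltnS addn_gt0 mn0.
Qed.

End hermite_null.

(** * The planar Gaussian process *)

Section cdot_theory.
Context {R : realType} (H : completeNormedModType R) (dot : {dot H for idfun}).
Local Notation HC := (complexification H).
Local Notation cdot := (@cdot R H dot).
Implicit Types (x y z : HC) (a : R[i]).

Lemma dot_sym (h g : H) : dot h g = dot g h.
Proof. by rewrite hermC expr0 mul1r. Qed.

Lemma cdot_conj x y : cdot y x = conjc (cdot x y).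
Proof.
rewrite /Defs.cdot /=; congr (_ +i* _); first by rewrite (dot_sym y.1) (dot_sym y.2).
by rewrite opprB (dot_sym y.1) (dot_sym y.2) .
Qed.

Lemma cdot_linl a x y z : cdot (a *: x + y) z = a * cdot x z + cdot y z.
Proof.
case: a => a b; case: x => x1 x2; case: y => y1 y2; rewrite /Defs.cdot /=.
rewrite -!(scalerN, scaleNr) !(dot_linl, linearDl, linearZl_LR, linearNl) /=.
by congr (_ +i* _); ring.
Qed.

Lemma cdotZl a x z : cdot (a *: x) z = a * cdot x z.
Proof.
have c0 : cdot 0 z = 0.
  by have := cdot_linl 1 0 0 z; rewrite scaler0 addr0 mul1r => /eqP;
      rewrite addrC -subr_eq subrr => /eqP.
by have := cdot_linl a x 0 z; rewrite addr0 c0 addr0.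
Qed.

Lemma cdotDl x y z : cdot (x + y) z = cdot x z + cdot y z.
Proof. by have := cdot_linl 1 x y z; rewrite scale1r mul1r. Qed.

Lemma cdotZr a x z : cdot z (a *: x) = conjc a * cdot z x.
Proof. rewrite cdot_conj cdotZl (cdot_conj z); case: a (cdot z x) => a b [u v] /=;
    congr (_ +i* _); ring. Qed.

Lemma cdotDr x y z : cdot z (x + y) = cdot z x + cdot z y.
Proof. rewrite cdot_conj cdotDl !(cdot_conj z); case: (cdot z x) (cdot z y) => a b [u v] /=;
    congr (_ +i* _); ring. Qed.

End cdot_theory.

Section process.
Context {R : realType} d (Omega : measurableType d) (P : probability Omega R).
Context (H : completeNormedModType R) (dot : {dot H for idfun}).
Context (X Y : H -> {RV P >-> R}).
Hypotheses (iX : isonormal dot X) (iY : isonormal dot Y) (XY : independent_processes X Y).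
Local Notation RR := (measurableTypeR R).
Local Notation HC := (complexification H).
Local Notation cdot := (@cdot R H dot).

(** The real part of [sqrt 2 Z]. The imaginary part is the same process at [- i h]
    ([real_process_i]), so that one real process of covariance [Re <h, g>]
    describes [Z]. *)
Definition real_process (h : HC) (w : Omega) : R := X h.1 w - Y h.2 w.
Local Notation B := real_process.

Lemma measurable_real_process h : measurable_fun setT (B h).
Proof. by apply: measurable_funB. Qed.

Lemma real_process_linear (a : R) h g :
  {ae P, forall w, B (a%:C *: h + g) w = a * B h w + B g w}.
Proof.
have := isonormal_linear a h.2 g.2 iY; apply: filterS2 (isonormal_linear a h.1 g.1 iX).
move=> w; rewrite /real_process /= scale0r subr0 scale0r addr0 => -> ->; ring.
Qed.

Lemma real_process_cos h c :
  \int[P]_w cos (B h w + c) = expR (- (complex.Re (cdot h h) / 2)) * cos c.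
Proof. exact: independent_cos iX iY XY. Qed.

Lemma complex_isonormalE h w :
  (Num.sqrt 2)%:C * complex_isonormal X Y h w = B h w +i* (X h.2 w + Y h.1 w).
Proof.
rewrite /complex_isonormal /complexify /real_process mulrC divfK.
  by simpc; congr (_ +i* _); ring.
by rewrite eq_complex /= eqxx andbT sqrtr_eq0 -ltNge.
Qed.

Lemma real_process_i h :
  {ae P, forall w, B (- 'i%C *: h) w = X h.2 w + Y h.1 w}.
Proof.
have E : - 'i%C *: h = (h.2, - h.1) :> HC.
  by apply: injective_projections => /=; rewrite oppr0 scale0r ?scaleN1r ?sub0r ?opprK ?add0r.
have := isonormal_linear (-1) h.1 0 iY; have := isonormal_linear (-1) 0 0 iY.
apply: filterS2 => w; rewrite E /real_process /= !scaleN1r !addr0 oppr0.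
move=> e0 ->; have -> : Y 0 w = 0 by move: e0; lra.
by ring.
Qed.

(** Closed under almost sure equality, because [real_process] is linear only
    almost surely while [function_space] asks for exact combinations. *)
Definition process_space (K : set HC) : set (Omega -> R) :=
  [set L | measurable_fun setT L /\ exists2 h, K h & {ae P, forall w, L w = B h w}].

Definition real_subspace (K : set HC) :=
  K 0 /\ forall (a : R) h g, K h -> K g -> K (a%:C *: h + g).

Lemma process_space_function_space K : real_subspace K -> function_space (process_space K).
Proof.
move=> [K0 KL]; split.
  split; first exact: measurable_cst.
  exists 0 => //; have := real_process_linear (-1) 0 0; apply: filterS => w.
  by rewrite scaler0 addr0; lra.
move=> a L L' [mL [h Kh Lh]] [mL' [g Kg Lg]]; split.
  by apply: measurable_funD => //; exact: measurable_funM.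
exists (a%:C *: h + g); first exact: KL.
by apply: filterS3 Lh Lg (real_process_linear a h g) => w -> -> ->.
Qed.

Lemma Rintegral_cos_ae L h c : measurable_fun setT L -> {ae P, forall w, L w = B h w} ->
  \int[P]_w cos (L w + c) = expR (- (complex.Re (cdot h h) / 2)) * cos c.
Proof.
move=> mL Lh; rewrite -real_process_cos /Rintegral; congr fine.
apply: ae_eq_integral => //.
- by apply/measurable_EFinP; exact: measurable_cosD.
- by apply/measurable_EFinP; apply: measurable_cosD; exact: measurable_real_process.
- by apply: filterS Lh => w -> _.
Qed.

(** The cosine transforms factor by the product-to-sum formula, as both [h + g]
    and [h - g] have for squared norm the sum of those of the orthogonal vectors
    [h] and [g]. *)
Lemma process_space_independent K K' : real_subspace K -> real_subspace K' ->
  (forall h g, K h -> K' g -> complex.Re (cdot h g) = 0) ->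
  forall D D', trig_event (process_space K) D -> trig_event (process_space K') D' ->
  P (D `&` D') = (P D * P D')%E.
Proof.
move=> sK sK' orth; apply: trig_event_independent.
- exact: process_space_function_space.
- exact: process_space_function_space.
- by move=> L [].
- by move=> L [].
move=> L c L' c' [mL [h Kh Lh]] [mL' [g Kg Lg]].
rewrite (Rintegral_cos_ae c mL Lh) (Rintegral_cos_ae c' mL' Lg).
have Lp : {ae P, forall w, 1 * L w + L' w = B (1%:C *: h + g) w}.
  by apply: filterS3 Lh Lg (real_process_linear 1 h g) => w -> -> ->.
have Lm : {ae P, forall w, -1 * L' w + L w = B ((-1)%:C *: g + h) w}.
  by apply: filterS3 Lh Lg (real_process_linear (-1) g h) => w -> -> ->.
have mLp : measurable_fun setT (fun w => 1 * L w + L' w).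
  by apply: measurable_funD => //; exact: measurable_funM.
have mLm : measurable_fun setT (fun w => -1 * L' w + L w).
  by apply: measurable_funD => //; exact: measurable_funM.
have icos (M : Omega -> R) (e : R) : measurable_fun setT M -> P.-integrable setT (EFin \o (fun w
    => cos (M w + e))).
  move=> mM; apply: (@bounded_integrable _ _ _ _ _ 1); first exact: measurable_cosD.
  by move=> x; rewrite ler_norml cos_geN1 cos_le1.
have E w : cos (L w + c) * cos (L' w + c') =
    2^-1 * cos (1 * L w + L' w + (c + c')) + 2^-1 * cos (-1 * L' w + L w + (c - c')).
  have -> : 1 * L w + L' w + (c + c') = (L w + c) + (L' w + c') by ring.
  have -> : -1 * L' w + L w + (c - c') = (L w + c) - (L' w + c') by ring.
  by move: (L w + c) (L' w + c') => u v; rewrite cosB cosD; field.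
under eq_Rintegral do rewrite E.
have i1 := icos _ (c + c') mLp; have i2 := icos _ (c - c') mLm.
have i2' : P.-integrable setT (EFin \o (fun w => 2^-1 * cos (-1 * L' w + L w + (c - c')))).
  by under [X in integrable _ _ X]eq_fun do rewrite EFinM; exact: integrableZl.
rewrite (RintegralDZ 2^-1 i1 i2').2 RintegralZl //.
rewrite (Rintegral_cos_ae _ mLp Lp) (Rintegral_cos_ae _ mLm Lm).
have ReD (x y : R[i]) : complex.Re (x + y) = complex.Re x + complex.Re y by case: x y => [? ?] [].
have ReN (x : R[i]) : complex.Re (- x) = - complex.Re x by case: x.
have o1 := orth _ _ Kh Kg.
have o2 : complex.Re (cdot g h) = 0 by rewrite cdot_conj; case: (cdot h g) o1.
have -> : complex.Re (cdot (1%:C *: h + g) (1%:C *: h + g)) =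
    complex.Re (cdot h h) + complex.Re (cdot g g).
  by rewrite scale1r cdotDl !cdotDr !ReD o1 o2 addr0 add0r.
have -> : complex.Re (cdot ((-1)%:C *: g + h) ((-1)%:C *: g + h)) =
    complex.Re (cdot h h) + complex.Re (cdot g g).
  rewrite rmorphN1 scaleN1r -scaleN1r cdotDl !cdotDr !cdotZl !cdotZr.
  have -> : conjc (-1 : R[i]) = -1 by rewrite /= oppr0.
  by rewrite !mulN1r !opprK !ReD !ReN o1 o2; ring.
rewrite mulrACA -expRD.
have -> : - (complex.Re (cdot h h) / 2) - complex.Re (cdot g g) / 2 =
    - ((complex.Re (cdot h h) + complex.Re (cdot g g)) / 2) by field.
by rewrite cosB cosD; field.
Qed.

(** The two [sigma]-algebras are independent, hence the law of the pair is the
    product of the laws. *)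
Lemma joint_law K K' d1 d2 (T1 : measurableType d1) (T2 : measurableType d2)
    (U : Omega -> T1) (V : Omega -> T2) (mU : measurable_fun setT U) (mV : measurable_fun setT V) :
  real_subspace K -> real_subspace K' ->
  (forall h g, K h -> K' g -> complex.Re (cdot h g) = 0) ->
  measurable_fun (setT : set (g_sigma_algebraType (trig_event (process_space K)))) U ->
  measurable_fun (setT : set (g_sigma_algebraType (trig_event (process_space K')))) V ->
  forall A, measurable A -> P ((fun w => (U w, V w)) @^-1` A) =
    (distribution P (mfun_Sub (mem_set mU)) \x distribution P (mfun_Sub (mem_set mV)))%E A.
Proof.
move=> sK sK' orth tU tV A mA.
have mUV : measurable_fun setT (fun w => (U w, V w) : T1 * T2) by exact: measurable_fun_pair.
pose Z : {mfun Omega >-> (T1 * T2)%type} := mfun_Sub (mem_set mUV).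
transitivity (distribution P Z A); first by [].
symmetry; apply: product_measure_unique => // A1 A2 mA1 mA2.
apply: (process_space_independent sK sK' orth).
  by apply: measurable_trig_event; [exact: process_space_function_space|exact:
      measurable_preimageT tU mA1].
by apply: measurable_trig_event; [exact: process_space_function_space|exact: measurable_preimageT
    tV mA2].
Qed.

Definition planar_process (h : HC) (w : Omega) : RR * RR := (B h w, B (- 'i%C *: h) w).

Lemma measurable_planar_process h : measurable_fun setT (planar_process h).
Proof.
by apply: measurable_fun_pair; exact: measurable_real_process.
Qed.

(** For the real scalar product [Re <h, g>] the vectors [h] and [- i h] are
    orthonormal. *)
Lemma planar_process_law h A : cdot h h = 1 -> measurable A ->
  P (planar_process h @^-1` A) = gauss2 A.
Proof.
move=> h1 mA.
pose Z : {mfun Omega >-> (RR * RR)%type} := mfun_Sub (mem_set (measurable_planar_process h)).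
transitivity (distribution P Z A); first by [].
apply: gauss2_unique => // a b c.
pose g : HC := a%:C *: h + (b%:C *: (- 'i%C *: h) + 0).
have gE : {ae P, forall w, a * B h w + b * B (- 'i%C *: h) w = B g w}.
  have := real_process_linear b (- 'i%C *: h) 0.
  have := real_process_linear a h (b%:C *: (- 'i%C *: h) + 0).
  have := real_process_linear (-1) 0 0.
  apply: filterS3 => w; rewrite scaler0 addr0 => e0 -> ->.
  have -> : B 0 w = 0 by lra.
  by rewrite addr0.
have mg : measurable_fun setT (fun w => a * B h w + b * B (- 'i%C *: h) w).
  by apply: measurable_funD; apply: measurable_funM => //; exact: measurable_real_process.
have mf : measurable_fun setT (fun x : RR * RR => cos (a * x.1 + b * x.2 + c)).
  apply: measurable_cosD => //; apply: measurable_funD.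
    by apply: measurable_funM => //; exact: measurable_fst.
  by apply: measurable_funM => //; exact: measurable_snd.
rewrite /Rintegral integral_distribution //; first last.
- apply: (@bounded_integrable _ _ _ P ((fun x : RR * RR => cos (a * x.1 + b * x.2 + c)) \o Z) 1).
    exact: measurableT_comp.
  by move=> x; rewrite ler_norml cos_geN1 cos_le1.
- exact/measurable_EFinP.
transitivity (\int[P]_w cos (a * B h w + b * B (- 'i%C *: h) w + c)); first by [].
rewrite (Rintegral_cos_ae c mg gE).
congr (expR (- (_ / 2)) * _); rewrite /g addr0 scalerA -scalerDl cdotZl cdotZr h1 mulr1 /=.
by ring.
Qed.

End process.

(** * Sorted sequences and multiplicities *)

Section sorted_counts.
Local Open Scope nat_scope.

Definition power_word (N : nat) (m : nat -> nat) : seq nat :=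
  flatten [seq nseq (m i) i | i <- iota 0 N].

Lemma power_word_sorted N m : sorted leq (power_word N m).
Proof.
rewrite /power_word (sorted_pairwise leq_trans).
elim: N 0 => //= N IH lo; rewrite pairwise_cat IH andbT; apply/andP; split.
  apply/allrelP => x y /nseqP[-> _] /flattenP[s /mapP[z]].
  by rewrite mem_iota => /andP[lz _] -> /nseqP[-> _]; exact: ltnW.
by elim: (m lo) => //= n ->; rewrite andbT; apply/allP => x /nseqP[->].
Qed.

Lemma count_power_word N m x : count_mem x (power_word N m) = if x < N then m x else 0.
Proof.
rewrite /power_word count_flatten sumnE !big_map -[x < N]/(0 <= x < 0 + N)%N -mem_iota.
have := iota_uniq 0 N; elim: (iota 0 N) => [|i s IH]; first by rewrite big_nil.
move=> /= /andP[nis us]; rewrite big_cons IH // count_nseq in_cons /= eq_sym.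
case: (eqVneq x i) nis => [->|_] nis //=.
by rewrite (negbTE nis) mul1n addn0.
Qed.

Lemma size_power_word N m : size (power_word N m) = \sum_(i < N) m i.
Proof.
rewrite /power_word size_flatten /shape -map_comp sumnE big_map -(big_mkord xpredT m).
by rewrite /index_iota subn0; apply: eq_bigr => i _ /=; rewrite size_nseq.
Qed.

(** Two sorted sequences with the same multiplicities are equal. *)
Lemma power_word_count N (s : seq nat) : sorted leq s -> all (ltn^~ N) s ->
  power_word N (fun i => count_mem i s) = s.
Proof.
move=> ss sN; apply: (sorted_eq leq_trans anti_leq) => //; first exact: power_word_sorted.
rewrite /perm_eq; apply/allP => x _ /=; rewrite count_power_word; case: ltnP => // Nx.
rewrite eq_sym; apply/eqP/count_memPn; apply: contraL Nx => /(allP sN) /=.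
by rewrite -ltnNge.
Qed.

Lemma sorted_count_neq (s t : seq nat) : sorted leq s -> sorted leq t -> s <> t ->
  exists i, count_mem i s != count_mem i t.
Proof.
move=> ss st st'; apply: contrapT => /forallNP h; apply: st'.
apply: (sorted_eq leq_trans anti_leq) => //; rewrite /perm_eq; apply/allP => i _ /=.
by have /negP := h i; rewrite negbK.
Qed.

Lemma bounded_seq (s : seq nat) : all (ltn^~ (\max_(i <- s) i).+1) s.
Proof. by apply/allP => i si /=; rewrite ltnS; exact: leq_bigmax_seq. Qed.

End sorted_counts.

(** * Symmetric tensors *)

Section tensors.
Context {R : realType} (H : completeNormedModType R) (dot : {dot H for idfun}).
Hypothesis dot_norm : forall x : H, `|x| ^+ 2 = dot x x.
Local Notation HC := (complexification H).
Local Notation cdot := (@cdot R H dot).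
Local Notation elementary := (@elementary R H dot).
Implicit Types (x y z : HC).

Lemma elementary_conj_multilinear n (x : 'I_n -> HC) : conj_multilinear (elementary x).
Proof.
move=> y i a u v.
have E w : elementary x (update y i w) = cdot (x i) w * \prod_(l < n | l != i) cdot (x l) (y l).
  rewrite /Defs.elementary (bigD1 i) //= /update eqxx; congr (_ * _).
  by apply: eq_bigr => l /negbTE ->.
by rewrite !E cdotDr cdotZr mulrDl mulrA.
Qed.

Lemma update_perm n (y : 'I_n -> HC) i v (s : {perm 'I_n}) :
  update y i v \o s = update (y \o s) (s^-1%g i) v.
Proof.
apply/funext => l; rewrite /update /=; congr (if _ then _ else _).
by apply/eqP/eqP => [<-|->]; rewrite ?permK ?permKV.
Qed.

Lemma symm_conj_multilinear n (T : tensor H n) : conj_multilinear T -> conj_multilinear (symm T).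
Proof.
move=> mT y i a u v; rewrite /symm mulrCA -mulrDr; congr (_ * _).
rewrite mulr_sumr -big_split /=; apply: eq_bigr => s _.
by rewrite !update_perm mT.
Qed.

Lemma symm_perm n (T : tensor H n) (y : 'I_n -> HC) (s : {perm 'I_n}) : symm T (y \o s) = symm T y.
Proof.
rewrite /symm; congr (_ * _); rewrite [RHS](reindex_inj (mulIg s)) /=.
by apply: eq_bigr => t _; congr T; apply/funext => i; rewrite /= permM.
Qed.

Lemma cdot_suml (I : finType) (f : I -> HC) z : cdot (\sum_i f i) z = \sum_i cdot (f i) z.
Proof.
elim/big_ind2: _ => [|x1 x2 y1 y2 <- <-|//]; last by rewrite cdotDl.
by rewrite -(scale0r 0) cdotZl mul0r.
Qed.

Lemma cdot_sumr (I : finType) (f : I -> HC) z : cdot z (\sum_i f i) = \sum_i cdot z (f i).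
Proof.
elim/big_ind2: _ => [|x1 x2 y1 y2 <- <-|//]; last by rewrite cdotDr.
by rewrite -(scale0r 0) cdotZr /= oppr0 mul0r.
Qed.

Lemma cdot_ge0 x : 0 <= complex.Re (cdot x x).
Proof. by rewrite /= -!dot_norm addr_ge0 ?sqr_ge0. Qed.

Lemma cdot_self x : cdot x x = (complex.Re (cdot x x))%:C.
Proof. by rewrite /Defs.cdot /= (dot_sym dot x.2 x.1) subrr. Qed.

Lemma mulc_conj (z : R[i]) : conjc z * z = (Normc.normc z ^+ 2)%:C.
Proof.
case: z => a b /=; rewrite sqr_sqrtr ?addr_ge0 ?sqr_ge0 //; congr (_ +i* _); ring.
Qed.

(** Expand the squared norm of [x - y], with [y] the projection of [x] on the span
    of the [u i]. *)
Lemma bessel N (u : 'I_N -> HC) x : orthonormal_family dot u ->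
  \sum_(i < N) Normc.normc (cdot x (u i)) ^+ 2 <= complex.Re (cdot x x).
Proof.
move=> ou; set S := \sum_(i < N) _.
pose y := \sum_(i < N) cdot x (u i) *: u i.
have yu i : cdot y (u i) = cdot x (u i).
  rewrite /y cdot_suml (bigD1 i) //= cdotZl ou eqxx mulr1 big1 ?addr0 // => l li.
  by rewrite cdotZl ou (negbTE li) mulr0.
have zy z : (forall i, cdot z (u i) = cdot x (u i)) -> cdot z y = S%:C.
  move=> zu; rewrite /y cdot_sumr /S rmorph_sum /=; apply: eq_bigr => i _.
  by rewrite cdotZr zu mulc_conj.
have yx : cdot y x = S%:C by rewrite cdot_conj zy // /= oppr0.
have := cdot_ge0 (x + (-1) *: y).
rewrite cdotDl !cdotDr !cdotZl !cdotZr zy // zy // yx /= => h.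
by move: h; rewrite /S; lra.
Qed.

(** Add up [c i * c j <= (c i ^+ 2 + c j ^+ 2) / 2]. *)
Lemma sqr_sum_le (I : finType) (c : I -> R) :
  (\sum_i c i) ^+ 2 <= #|I|%:R * \sum_i c i ^+ 2.
Proof.
rewrite expr2 big_distrlr /=.
apply: (@le_trans _ _ (\sum_i \sum_j (c i ^+ 2 / 2 + c j ^+ 2 / 2))).
  by apply: ler_sum => i _; apply: ler_sum => j _; have := sqr_ge0 (c i - c j); nra.
have -> : \sum_i \sum_j (c i ^+ 2 / 2 + c j ^+ 2 / 2) =
    \sum_i (c i ^+ 2 / 2 *+ #|I| + \sum_j c j ^+ 2 / 2).
  by apply: eq_bigr => i _; rewrite big_split /= sumr_const.
by rewrite big_split /= sumr_const sumrMnl -mulrnDl -mulr_suml -splitr mulr_natl.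
Qed.

(** The sum over the maps [a] is a product over [i] of sums over the [u k], each
    of them bounded by [bessel]. *)
Lemma elementary_sqnorm n (x : 'I_n -> HC) N (u : 'I_N -> HC) (s : {perm 'I_n}) :
  orthonormal_family dot u ->
  \sum_(a : {ffun 'I_n -> 'I_N}) Normc.normc (elementary x ((u \o a) \o s)) ^+ 2 <=
  \prod_(i < n) complex.Re (cdot (x i) (x i)).
Proof.
move=> ou.
have -> : \sum_(a : {ffun 'I_n -> 'I_N}) Normc.normc (elementary x ((u \o a) \o s)) ^+ 2 =
    \sum_(a : {ffun 'I_n -> 'I_N}) \prod_(i < n) Normc.normc (cdot (x (s^-1%g i)) (u (a i))) ^+ 2.
  apply: eq_bigr => a _; rewrite /Defs.elementary.
  have -> : forall f : 'I_n -> R[i], Normc.normc (\prod_i f i) ^+ 2 =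
      \prod_i Normc.normc (f i) ^+ 2.
    move=> f; elim/big_ind2: _ => [|z1 r1 z2 r2 <- <-|//].
      by rewrite Normc.normc1 expr1n.
    by rewrite Normc.normcM exprMn.
  by rewrite [LHS](reindex_inj (perm_inj (s := s^-1%g))) /=; apply: eq_bigr => i _; rewrite permKV.
rewrite -(bigA_distr_bigA (fun i k => Normc.normc (cdot (x (s^-1%g i)) (u k)) ^+ 2)).
rewrite [leRHS](reindex_inj (perm_inj (s := s^-1%g))) /=.
apply: ler_prod => i _; rewrite bessel // andbT.
by apply: sumr_ge0 => k _; exact: sqr_ge0.
Qed.

Lemma symm_elementary_sqnorm n (x : 'I_n -> HC) : exists M, forall N (u : 'I_N -> HC),
  orthonormal_family dot u ->
  \sum_(a : {ffun 'I_n -> 'I_N}) Normc.normc (symm (elementary x) (u \o a)) ^+ 2 <= M.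
Proof.
pose K : R := #|{perm 'I_n}|%:R.
pose M := \prod_(i < n) complex.Re (cdot (x i) (x i)).
exists (Normc.normc (n`!%:R : R[i])^-1 ^+ 2 * (K * (K * M))) => N u ou.
apply: (@le_trans _ _ (\sum_(a : {ffun 'I_n -> 'I_N}) Normc.normc (n`!%:R : R[i])^-1 ^+ 2 *
    (K * \sum_(s : {perm 'I_n}) Normc.normc (elementary x ((u \o a) \o s)) ^+ 2))).
  apply: ler_sum => a _; rewrite /symm Normc.normcM exprMn ler_wpM2l ?sqr_ge0 //.
  apply: le_trans (sqr_sum_le _).
  rewrite ler_pXn2r ?nnegrE ?normc_ge0 ?normc_sum //.
  by apply: sumr_ge0 => s _; exact: normc_ge0.
rewrite -!mulr_sumr ler_wpM2l ?sqr_ge0 // ler_wpM2l ?ler0n // exchange_big /=.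
apply: le_trans (ler_sum _ (fun s _ => elementary_sqnorm x s ou)) _.
by rewrite sumr_const mulr_natl.
Qed.

(** The linearity and the defining values of the multiple integral are available
    only for elements of [sym_tensor2]. The norm is finite as it factors, and each
    factor is an average of elementary tensors. *)
Lemma symm_elementary_sym_tensor2 p q (x : 'I_p -> HC) (y : 'I_q -> HC) :
  sym_tensor2 dot (tensor_mul (symm (elementary x)) (symm (elementary y))).
Proof.
split.
- move=> z u i a v w; rewrite /tensor_mul.
  by rewrite (symm_conj_multilinear (@elementary_conj_multilinear _ x)) mulrDl mulrA.
- move=> z u i a v w; rewrite /tensor_mul.
  by rewrite (symm_conj_multilinear (@elementary_conj_multilinear _ y)) mulrDr mulrCA.
- by move=> s t u v; rewrite /tensor_mul !symm_perm.
have [M1 h1] := symm_elementary_sqnorm x; have [M2 h2] := symm_elementary_sqnorm y.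
apply: le_lt_trans (ltry (M1 * M2)); apply: ub_ereal_sup => _ [N [u [ou ->]]].
rewrite lee_fin; apply: le_trans (ler_pM _ _ (h1 N u ou) (h2 N u ou)).
- rewrite big_distrlr /=; apply: ler_sum => a _; apply: ler_sum => b _.
  by rewrite /tensor_mul Normc.normcM exprMn.
- by apply: sumr_ge0 => a _; exact: sqr_ge0.
- by apply: sumr_ge0 => a _; exact: sqr_ge0.
Qed.

Lemma elementaryZ n (c : R[i]) (x y : 'I_n -> HC) :
  elementary (fun i => c *: x i) y = c ^+ n * elementary x y.
Proof.
transitivity (\prod_(i < n) (c * cdot (x i) (y i))).
  by apply: eq_bigr => i _; rewrite cdotZl.
by rewrite big_split /= prodr_const card_ord.
Qed.

Lemma symm_elementaryZ n (c : R[i]) (x y : 'I_n -> HC) :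
  symm (elementary (fun i => c *: x i)) y = c ^+ n * symm (elementary x) y.
Proof.
rewrite /symm [RHS]mulrCA; congr (_^-1 * _); rewrite mulr_sumr.
by apply: eq_bigr => s _; exact: elementaryZ.
Qed.

Lemma vconjZ (c : R) x : vconj (c%:C *: x) = c%:C *: vconj x.
Proof.
by apply: injective_projections => /=; rewrite !scale0r ?subr0 ?addr0 ?scalerN.
Qed.

Lemma power_familyE n (xi : nat -> HC) N (s : n.-tuple nat) : sorted leq s -> all (ltn^~ N) s ->
  @power_family R H n xi N (fun i => count_mem i s) = (fun l => xi (tnth s l)).
Proof.
move=> ss sN; apply/funext => l; rewrite /power_family -/(power_word _ _) power_word_count //.
by rewrite (tnth_nth 0%N).
Qed.

Lemma orthonormal_rescaling (e : nat -> HC) :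
  complete_orthogonal_system dot e -> (forall k, cnorm dot (e k) = Num.sqrt 2) ->
  let xi k : HC := ((Num.sqrt 2)^-1)%:C *: e k in
  [/\ complete_orthonormal_system dot xi,
      forall k, cdot (xi k) (xi k) = 1 &
      forall k, e k = (Num.sqrt 2)%:C *: xi k].
Proof.
move=> [orth compl] nrm xi.
have s0 : Num.sqrt 2 != 0 :> R by rewrite sqrtr_eq0 -ltNge.
have ne k : complex.Re (cdot (e k) (e k)) = 2.
  have := congr1 (fun t => t ^+ 2) (nrm k).
  by rewrite /cnorm !sqr_sqrtr // cdot_ge0.
have xi1 k : cdot (xi k) (xi k) = 1.
  rewrite cdotZl cdotZr cdot_self ne.
  have -> : conjc ((Num.sqrt 2)^-1 : R)%:C = ((Num.sqrt 2)^-1)%:C by rewrite /= oppr0.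
  by rewrite -!rmorphM /= mulrA -expr2 exprVn sqr_sqrtr // mulVf.
split => //; last first.
  by move=> k; rewrite /xi scalerA -rmorphM /= divff // scale1r.
split; last by move=> k; rewrite /cnorm xi1 sqrtr1.
split => [i j ij|x h].
  by rewrite cdotZl cdotZr orth // !mulr0.
apply: compl => i; have := h i; rewrite cdotZr => /eqP; rewrite mulf_eq0 => /orP[|/eqP //].
by rewrite /= oppr0 eq_complex /= eqxx andbT invr_eq0 (negbTE s0).
Qed.

End tensors.

(** * The multiple integral as a product of Hermite polynomials *)

Section hermite_product.
Context {R : realType} d (Omega : measurableType d) (P : probability Omega R).
Context (H : completeNormedModType R) (dot : {dot H for idfun}).
Context (X Y : H -> {RV P >-> R}).
Hypotheses (iX : isonormal dot X) (iY : isonormal dot Y) (XY : independent_processes X Y).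
Context (J : nat -> nat -> R[i] -> R[i]) (J_hermite : complex_hermite J).
Context (xi : nat -> complexification H)
  (xi_orth : forall i k, i <> k -> cdot dot (xi i) (xi k) = 0)
  (xi_unit : forall i, cdot dot (xi i) (xi i) = 1).
Local Notation RR := (measurableTypeR R).
Local Notation HC := (complexification H).
Local Notation mu := (@lebesgue_measure R).
Local Notation V i := (planar_process X Y (xi i)).

Lemma hermite_planar_neq0 m n i : {ae P, forall w, J m n (to_complex (V i w)) != 0}.
Proof.
pose A := [set v : RR * RR | J m n (to_complex v) = 0].
have mA : measurable A.
  have := measurable_preimageT (hermite_measurable J_hermite m n) (@measurable_origin R).
  congr measurable; apply/seteqP; split => v /=.
    by move=> h; apply: of_complex_inj; exact: h.
  by rewrite /A /= => ->.
exists (V i @^-1` A); split.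
- exact: measurable_preimageT (measurable_planar_process X Y (xi i)) mA.
- by rewrite (planar_process_law iX iY XY) //; exact: hermite_neq0.
- by move=> w /= h; apply: contrapT => h'; apply: h; apply/eqP.
Qed.

(** The factor of index [i0] is a function of the process on the complex line of
    [xi i0], the product of the other ones of the process on its orthogonal: they
    are independent. Fubini fixes the second one at a value [c], almost surely
    nonzero, and [hermite_null] applies. *)
Lemma hermite_product_null (N : nat) (m n : nat -> nat) (i0 : 'I_N) (A : set (RR * RR)) :
  m i0 != n i0 -> measurable A -> (mu \x mu)%E A = 0%E ->
  P ((fun w => of_complex (\prod_(i < N) J (m i) (n i) (to_complex (V i w)))) @^-1` A) = 0%E.
Proof.
move=> mn mA /(leb2_null_gauss2 mA) gA.
pose U w := of_complex (\prod_(i < N | i != i0) J (m i) (n i) (to_complex (V i w))).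
pose K : set HC := [set h | cdot dot h (xi i0) = 0].
pose K' : set HC := [set h | exists a : R[i], h = a *: xi i0].
have sK : real_subspace K.
  split => [|a h g]; rewrite /K /=.
    by rewrite -(scale0r 0) cdotZl mul0r.
  by rewrite cdot_linl => -> ->; rewrite mulr0 addr0.
have sK' : real_subspace K'.
  split => [|a h g]; first by exists 0; rewrite scale0r.
  by move=> [b ->] [b' ->]; exists (a%:C * b + b'); rewrite scalerDl scalerA.
have orth h g : K h -> K' g -> complex.Re (cdot dot h g) = 0.
  by move=> Kh [a ->]; rewrite cdotZr Kh mulr0.
have tV (L : set HC) i : real_subspace L -> (forall a : R[i], L (a *: xi i)) ->
    measurable_fun (setT : set (g_sigma_algebraType (trig_event (process_space X Y L)))) (V i : _
        -> RR * RR).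
  move=> sL La; have fL := process_space_function_space iX iY sL.
  apply: measurable_fun_pair; apply: measurable_fun_trig => //.
    split; first exact: measurable_real_process.
    by exists (xi i); [have := La 1; rewrite scale1r|exact: aeW].
  split; first exact: measurable_real_process.
  by exists (- 'i%C *: xi i); [exact: La|exact: aeW].
have tU : measurable_fun (setT : set (g_sigma_algebraType (trig_event (process_space X Y K)))) (U
    : _ -> RR * RR).
  apply: measurable_of_complex_prod => i ii0.
  apply: (measurableT_comp (f := fun v => of_complex (J (m i) (n i) (to_complex v)))).
    exact: hermite_measurable.
  apply: tV => // a; rewrite /K /= cdotZl xi_orth ?mulr0 //.
  by move=> h; move/eqP: ii0; apply; exact: val_inj.
have mU : measurable_fun setT U.
  apply: measurable_of_complex_prod => i ii0.
  apply: (measurableT_comp (f := fun v => of_complex (J (m i) (n i) (to_complex v)))).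
    exact: hermite_measurable.
  exact: measurable_planar_process.
have mV : measurable_fun setT (V i0) by exact: measurable_planar_process.
pose E := [set z : (RR * RR) * (RR * RR) | A (of_complex (to_complex z.1 *
    J (m i0) (n i0) (to_complex z.2)))].
have mE : measurable E.
  apply: (measurable_preimageT (f := fun z : (RR * RR) * (RR * RR) =>
      of_complex (to_complex z.1 * J (m i0) (n i0) (to_complex z.2)))) => //.
  apply: measurable_of_complexM.
    rewrite (_ : _ \o _ = fst); first exact: measurable_fst.
    by apply/funext => z; exact: to_complexK.
  apply: (measurableT_comp (f := fun v => of_complex (J (m i0) (n i0) (to_complex v))));
      last exact: measurable_snd.
  exact: hermite_measurable.
have -> : (fun w => of_complex (\prod_(i < N) J (m i) (n i) (to_complex (V i w)))) @^-1` A =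
    (fun w => (U w, V i0 w)) @^-1` E.
  by apply/seteqP; split => w /=; rewrite (bigD1 i0) //= mulrC /E /U /=;
      case: (\prod_(_ < _ | _) _).
rewrite (joint_law iX iY XY mU mV sK sK' orth tU _ mE); last by apply: tV => // a; exists a.
apply/prod_null_xsection => //.
have Z := @measurable_origin R.
exists [set (0, 0)]; split => //.
- have mU0 : measurable (U @^-1` [set (0, 0)]) by exact: measurable_preimageT mU Z.
  suff : P (U @^-1` [set (0, 0)]) = 0%E by [].
  have : {ae P, forall w, \prod_(i < N | i != i0) J (m i) (n i) (to_complex (V i w)) != 0}.
    have : {ae P, forall w, forall i : 'I_N, J (m i) (n i) (to_complex (V i w)) != 0}.
      by apply: filter_forall => i; exact: hermite_planar_neq0.
    by apply: filterS => w h; apply/prodf_neq0 => i _; exact: h.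
  move=> h; apply: measure_negligible mU0 _.
  apply: negligibleS h => w /= w0; apply/negP; rewrite negbK; apply/eqP.
  by apply: of_complex_inj; exact: w0.
- move=> c /=; apply: contra_notP => c0.
  have cc0 : to_complex c != 0 by apply: contra_not_neq c0 => h; rewrite -(to_complexK c) h.
  rewrite /distribution /pushforward /= [LHS](planar_process_law iX iY XY) //.
    exact: (hermite_null J_hermite mn cc0 mA gA).
  by have := measurable_xsection c mE; rewrite xsectionE.
Qed.

End hermite_product.

Section multiple_integral.
Context {R : realType} d (Omega : measurableType d) (P : probability Omega R).
Context (H : completeNormedModType R) (dot : {dot H for idfun}).
Hypothesis dot_norm : forall x : H, `|x| ^+ 2 = dot x x.
Context (X Y : H -> {RV P >-> R}).
Hypothesis (iY : isonormal dot Y).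
Context (J : nat -> nat -> R[i] -> R[i]) (xi : nat -> complexification H)
  (xi_complete : complete_orthonormal_system dot xi).
Local Notation RR := (measurableTypeR R).
Local Notation V i := (planar_process X Y (xi i)).

(** Rescaling the vectors multiplies the tensor by [sqrt 2] to the power [p + q],
    which cancels the powers of [sqrt 2] in the value of the integral at powers of
    the [xi i]. *)
Lemma integral_of_factors_hermite p q (Ipq : tensor2 H p q -> Omega -> R[i])
    (k : p.-tuple nat) (j : q.-tuple nat) (N : nat) :
  multiple_integral P dot J (complex_isonormal X Y) Ipq ->
  sorted leq k -> sorted leq j -> all (ltn^~ N) k -> all (ltn^~ N) j ->
  {ae P, forall w,
     integral_of_factors dot Ipq
         (fun l : 'I_p => (Num.sqrt 2)%:C *: xi (tnth k l))
         (fun l : 'I_q => vconj ((Num.sqrt 2)%:C *: xi (tnth j l))) w =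
     \prod_(i < N) J (count_mem (i : nat) k) (count_mem (i : nat) j) (to_complex (V i w))}.
Proof.
move=> [_ Ilin _ Iherm] ks js kN jN.
pose c : R[i] := (Num.sqrt 2)%:C.
have c0 : c != 0 by rewrite eq_complex /= eqxx andbT sqrtr_eq0 -ltNge.
pose m i := count_mem i k; pose n i := count_mem i j.
have mp : (\sum_(i < N) m i)%N = p by rewrite -size_power_word power_word_count // size_tuple.
have nq : (\sum_(i < N) n i)%N = q by rewrite -size_power_word power_word_count // size_tuple.
pose S := tensor_mul (symm (elementary dot (@power_family R H p xi N m)))
  (symm (elementary dot (@power_family R H q (@vconj R H \o xi) N n))).
have symS : sym_tensor2 dot S by exact: symm_elementary_sym_tensor2.
(* The linearity of the integral concerns combinations [a S + T]; with [T = S] it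
   also gives the multiples of [S]. *)
have E : tensor_mul (symm (elementary dot (fun l : 'I_p => c *: xi (tnth k l))))
    (symm (elementary dot (fun l : 'I_q => vconj (c *: xi (tnth j l))))) =
    (fun x y => (c ^+ (p + q) - 1) * S x y + S x y).
  apply/funext => x; apply/funext => y.
  rewrite /S !power_familyE // /tensor_mul symm_elementaryZ.
  have -> : (fun l : 'I_q => vconj (c *: xi (tnth j l))) = (fun l => c *: vconj (xi (tnth j l))).
    by apply/funext => l; rewrite vconjZ.
  by rewrite symm_elementaryZ mulrBl mul1r subrK exprD mulrACA.
have Zi (i : nat) : {ae P, forall w, c * complex_isonormal X Y (xi i) w = to_complex (V i w)}.
  have := real_process_i X iY (xi i); apply: filterS => w h.
  by rewrite /c complex_isonormalE /to_complex /planar_process /= h.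
have Z : {ae P, forall w, forall i : 'I_N, c * complex_isonormal X Y (xi i) w = to_complex (V i w)}.
  by apply: filter_forall => i; exact: Zi.
have := Iherm xi N m n xi_complete mp nq.
have := Ilin (c ^+ (p + q) - 1) S S symS symS.
apply: filterS3 Z => w Zw; rewrite /integral_of_factors -/c E => -> ->.
rewrite mulrBl mul1r subrK big_split /= mulrA.
have -> : c ^+ (p + q) * \prod_(i < N) c ^- (m i + n i) = 1.
  rewrite prodfV prodrXr big_split /= mp nq divff //.
  by rewrite expf_neq0.
rewrite mul1r; apply: eq_bigr => i _; congr (J _ _ _); exact: Zw.
Qed.

End multiple_integral.

(** * Absolute continuity of the law *)

(* [e k], [k : nat], is the vector of index [k + 1]. *)
Theorem corollary3p10 (R : realType)
    (H : completeNormedModType R) (dot : {dot H for idfun})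
    (dot_norm : forall x : H, `|x| ^+ 2 = dot x x)
    (H_separable : separable H)
    (d : measure_display) (Omega : measurableType d) (P : probability Omega R)
    (X Y : H -> {RV P >-> R})
    (X_isonormal : isonormal dot X) (Y_isonormal : isonormal dot Y)
    (XY_independent : independent_processes X Y)
    (J : nat -> nat -> R[i] -> R[i]) (J_hermite : complex_hermite J)
    (e : nat -> complexification H)
    (e_complete : complete_orthogonal_system dot e)
    (e_norm : forall k, cnorm dot (e k) = Num.sqrt 2)
    (p q : nat) (Ipq : tensor2 H p q -> Omega -> R[i])
    (Ipq_integral : multiple_integral P dot J (complex_isonormal X Y) Ipq)
    (k : p.-tuple nat) (j : q.-tuple nat)
    (k_sorted : sorted leq k) (j_sorted : sorted leq j)
    (F1 F2 : {RV P >-> R})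
    (F_integral : {ae P, forall w,
       integral_of_factors dot Ipq
         (fun l : 'I_p => e (tnth k l)) (fun l : 'I_q => vconj (e (tnth j l))) w
       = (F1 w)%:C + 'i%C * (F2 w)%:C}) :
  pushforward P (fun w => (F1 w, F2 w) : R * R)
    `<< (lebesgue_measure \x lebesgue_measure)%E
  <-> (p <> q \/
       (p = q /\ exists l : nat, (l < p)%N /\ nth 0%N k l <> nth 0%N j l)).
Proof.
pose xi i : complexification H := ((Num.sqrt 2)^-1)%:C *: e i.
have [xi_complete xi_unit eE] := orthonormal_rescaling dot_norm e_complete e_norm.
have xi_orth i l : i <> l -> cdot dot (xi i) (xi l) = 0 by exact: xi_complete.1.1.
pose N := (\max_(i <- k ++ j) i).+1.
have /andP[kN jN] : all (ltn^~ N) k && all (ltn^~ N) j by rewrite -all_cat bounded_seq.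
pose m i := count_mem i k; pose n i := count_mem i j.
pose G w := \prod_(i < N) J (m i) (n i) (to_complex (planar_process X Y (xi i) w)).
have FG : {ae P, forall w, (F1 w, F2 w) = of_complex (G w)}.
  have := integral_of_factors_hermite dot_norm Y_isonormal xi_complete Ipq_integral k_sorted
      j_sorted kN jN.
  apply: filterS2 F_integral => w.
  have -> : (fun l : 'I_p => e (tnth k l)) = (fun l => (Num.sqrt 2)%:C *: xi (tnth k l)).
    by apply/funext => l; rewrite eE.
  have -> : (fun l : 'I_q => vconj (e (tnth j l))) =
      (fun l => vconj ((Num.sqrt 2)%:C *: xi (tnth j l))).
    by apply/funext => l; rewrite eE.
  move=> -> h; rewrite /G -[\prod_(_ < _) _]h /of_complex; simpc.
  by congr (_, _).
have mF : measurable_fun setT (fun w => (F1 w, F2 w) : measurableTypeR R * measurableTypeR R).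
  by apply: measurable_fun_pair; [exact: (measurable_funPT F1)|exact: (measurable_funPT F2)].
split=> [/null_content_dominatesP dom|neq].
- apply: contrapT => /not_orP[/contrapT pq /not_andP[//|/forallNP kj]].
  have kjE : k = j :> seq nat.
    apply: (@eq_from_nth _ 0%N); rewrite ?size_tuple // => l lp.
    by apply: contrapT => h; apply: (kj l).
  (* The law is carried by the real axis. *)
  pose A : set (measurableTypeR R * measurableTypeR R) := setT `*` [set 0].
  have mA : measurable A by apply: measurableX => //; exact: measurable_set1.
  have A0 : (@lebesgue_measure R \x @lebesgue_measure R)%E A = 0%E.
    apply/prod_null_xsection => //; apply: aeW => x.
    rewrite (_ : [set y | A (x, y)] = [set 0]); first exact: lebesgue_measure_set1.
    by apply/seteqP; split => y /=; rewrite /A /=; tauto.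
  have FA : {ae P, forall w, A (F1 w, F2 w)}.
    apply: filterS FG => w ->; split => //=.
    rewrite /G /m /n kjE; elim/big_ind: _ => [//|z1 z2 h1 h2|i _].
      by case: z1 z2 h1 h2 => a b [a' b'] /= -> ->; rewrite mulr0 mul0r addr0.
    exact: hermite_diag_real.
  have mB : measurable ((fun w => (F1 w, F2 w)) @^-1` A) by exact: measurable_preimageT mF mA.
  have := dom A mA A0; rewrite /pushforward => PA0.
  have PC : P (~` ((fun w => (F1 w, F2 w)) @^-1` A)) = 0%E.
    by apply: measure_negligible; [exact: measurableC|exact: FA].
  have := probability_setC P mB; rewrite PC PA0 sube0 => /eqP.
  by rewrite eqe eq_sym oner_eq0.
have kj : tval k <> tval j.
  move=> kjE; case: neq => [|[pq [l [_]]]]; last by rewrite kjE.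
  by apply; rewrite -(size_tuple k) -(size_tuple j) kjE.
(* An index with two different multiplicities occurs in one of the sequences, so
   it is below [N]. *)
have [i0 mn] := sorted_count_neq k_sorted j_sorted kj.
have i0N : (i0 < N)%N.
  rewrite ltnNge; apply: contra mn => Ni.
  have ni s : all (ltn^~ N) s -> count_mem i0 s = 0%N.
    move=> sN; apply/count_memPn; apply: contraL Ni => /(allP sN) /=.
    by rewrite -ltnNge.
  by rewrite !ni.
apply/null_content_dominatesP => A mA A0; rewrite /pushforward.
have GA := hermite_product_null X_isonormal Y_isonormal XY_independent J_hermite
  xi_orth xi_unit (m := m) (n := n) (i0 := Ordinal i0N) mn mA A0.
have mG : measurable_fun setT (fun w => of_complex (G w)).
  apply: measurable_of_complex_prod => i _.
  apply: (measurableT_comp (f := fun v => of_complex (J (m i) (n i) (to_complex v)))).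
    exact: hermite_measurable.
  exact: measurable_planar_process.
have [Z [mZ Z0 ZF]] := FG.
apply: measure_negligible; first exact: measurable_preimageT mF mA.
have nB : P.-negligible (Z `|` ((fun w => of_complex (G w)) @^-1` A : set Omega)).
  apply: negligibleU; first by exists Z; split => //; exact: subset_refl.
  by apply/negligibleP; [exact: measurable_preimageT mG mA|exact: GA].
apply: negligibleS nB => w /= Aw; have [Zw|Zw] := pselect (Z w); [by left|right].
suff <- : (F1 w, F2 w) = of_complex (G w) by [].
by apply: contrapT => h; apply: Zw; exact: ZF.
Qed.
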